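(* Assume the setting of the context (one-dimensional exponential covariance model with monomial regressors) with some $\delta\in(0,1)$: $x_j(s)=n^{-\delta j}s^j$, $s\in[0,n^\delta]$, $j=1,\dots,p$. Suppose that $\mathbf Z\sim N(\mathbf X\boldsymbol\beta_0,\boldsymbol\Sigma(\boldsymbol\theta_0))$, where $\boldsymbol\beta_0=(\beta_{0,0},\dots,\beta_{0,p})'\in\mathbb R^{p+1}$ and $\boldsymbol\theta_0=(v_0^2,\sigma_0^2,\kappa_0)'\in\Theta\subseteq(0,\infty)^3$ are constant vectors. Assume that $\mathcal A=\{\varnothing,\{1\},\{1,2\},\dots,\{1,\dots,p\}\}$, that $\Theta$ is compact, and that $$\boldsymbol\theta_0+\big(0,\ \gamma(k),\ -(\sigma_0^2+\gamma(k))^{-1}\gamma(k)\kappa_0\big)'\in\Theta,\qquad k=0,1,\dots,p,$$ where $\gamma(k)=\boldsymbol\beta_0'\mathbf V_{p,p}\boldsymbol\beta_0-\boldsymbol\beta_0'\mathbf V_{p,k}\mathbf V_{k,k}^{-1}\mathbf V_{k,p}\boldsymbol\beta_0$ and $\mathbf V_{k,l}=\big(\frac1{i+j-1}\big)_{(k+1)\times(l+1)}$ (the $(k+1)\times(l+1)$ matrix with $(i,j)$ entry $1/(i+j-1)$). If $\lim_{n\to\infty}\tau_n=\infty$ and $\tau_n=o(n^\delta)$, then $\lim_{n\to\infty}P\{\hat\alpha_{\tau_n}=\alpha^0\}=1$.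
   Context: For each $n$, $D=[0,n^\delta]\subset\mathbb R$ and data $\mathbf Z=(Z(s_1),\dots,Z(s_n))'$ are observed at sites $s_i=s_{ni}=i\,n^{-(1-\delta)}$, $i=1,\dots,n$. The covariance parameter is $\boldsymbol\theta=(v^2,\sigma^2,\kappa)'\in\Theta$ and $\boldsymbol\Sigma(\boldsymbol\theta)=\boldsymbol\Sigma_\eta+v^2\mathbf I$, where $\boldsymbol\Sigma_\eta$ has $(i,j)$ entry $\sigma^2\exp(-\kappa|s_i-s_j|)$. The number $p$ of regressors and the set $\mathcal A$ of candidate models do not depend on $n$. $\mathbf X$ is the $n\times(p+1)$ matrix with rows $(1,x_1(s_i),\dots,x_p(s_i))$; $p(\alpha)$ is the number of elements of $\alpha$; $\mathbf X(\alpha)$ consists of the column $\mathbf 1$ and the columns of $\mathbf X$ indexed by $\alpha$ ($\varnothing$ is the intercept-only model). A model $\alpha$ is correct if the true mean function $\mu_0(s)=\beta_{0,0}+\sum_{j=1}^p\beta_{0,j}x_j(s)$ can be written as $\beta_0+\sum_{j\in\alpha}\beta_jx_j(s)$ for all $s\in D$; $\mathcal A^0\subseteq\mathcal A$ is the set of correct models and $\alpha^0=\arg\min_{\alpha\in\mathcal A^0}p(\alpha)$ is the smallest correct model. $\hat{\boldsymbol\mu}(\alpha;\boldsymbol\theta)=\mathbf X(\alpha)(\mathbf X(\alpha)'\boldsymbol\Sigma^{-1}(\boldsymbol\theta)\mathbf X(\alpha))^{-1}\mathbf X(\alpha)'\boldsymbol\Sigma^{-1}(\boldsymbol\theta)\mathbf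 Z$ (the inverses are assumed to exist), $$\ell(\alpha;\boldsymbol\theta)=-\tfrac n2\log(2\pi)-\tfrac12\log\det\boldsymbol\Sigma(\boldsymbol\theta)-\tfrac12(\mathbf Z-\hat{\boldsymbol\mu}(\alpha;\boldsymbol\theta))'\boldsymbol\Sigma^{-1}(\boldsymbol\theta)(\mathbf Z-\hat{\boldsymbol\mu}(\alpha;\boldsymbol\theta)),$$ and the ML estimate $\hat{\boldsymbol\theta}(\alpha)\in\Theta$ satisfies $\ell(\alpha;\hat{\boldsymbol\theta}(\alpha))=\sup_{\boldsymbol\theta\in\Theta}\ell(\alpha;\boldsymbol\theta)$. For a tuning parameter $\tau_n$, $\Gamma_{\tau_n}(\alpha)=-2\ell(\alpha;\hat{\boldsymbol\theta}(\alpha))+\tau_np(\alpha)$ (GIC) and $\hat\alpha_{\tau_n}=\arg\min_{\alpha\in\mathcal A}\Gamma_{\tau_n}(\alpha)$. *)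

(* Defs.v *)
From HB Require Import structures.
From mathcomp Require Import all_boot all_order all_algebra.
From mathcomp Require Import all_classical all_reals all_analysis.

Set Implicit Arguments.
Unset Strict Implicit.
Unset Printing Implicit Defensive.

Import Order.TTheory GRing.Theory Num.Theory.
Import numFieldNormedType.Exports.

Local Open Scope classical_set_scope.
Local Open Scope ring_scope.

Definition is_argmin {disp} {U : porderType disp} {M : Type}
    (A : set M) (f : M -> U) (x : M) : Prop :=
  A x /\ forall y, A y -> (f x <= f y)%O.

Section gaussian_vector.
Context {R : realType}.

(* The normal law on the line, parametrized by its variance; [normal_prob]
   takes the standard deviation and is not the Dirac mass when it is 0. *)
Definition normal_law (m v : R) (B : set R) : \bar R :=
  if v == 0 then \d_m B else normal_prob m (Num.sqrt v) B.

(* Z ~ N(m, S): every linear combination a'Z is N(a'm, a'Sa). *)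
Definition gaussian_vector d (T : measurableType d) (P : probability T R)
    n (Z : T -> 'cV[R]_n) (m : 'cV[R]_n) (S : 'M[R]_n) : Prop :=
  (forall i, measurable_fun [set: T] (fun w => Z w i 0)) /\
  (forall (a : 'cV[R]_n) (B : set R), measurable B ->
     P [set w | B ((a^T *m Z w) 0 0)] =
     normal_law ((a^T *m m) 0 0) ((a^T *m S *m a) 0 0) B).

End gaussian_vector.

Section model.
Context {R : realType}.

(* theta = (v^2, sigma^2, kappa) *)
Definition param : Type := (R * R * R)%type.
Definition v2 (th : param) : R := th.1.1.
Definition sigma2 (th : param) : R := th.1.2.
Definition kappa (th : param) : R := th.2.

Variable delta : R.

(* Ordinals start at 0, so i : 'I_n stands for the (i+1)-st site. *)
Definition site n (i : 'I_n) : R := i.+1%:R * n%:R `^ (- (1 - delta)).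

Definition Sigma n (th : param) : 'M[R]_n :=
  \matrix_(i, j) (sigma2 th * expR (- kappa th * `|site i - site j|))
  + (v2 th)%:M.

Definition regressor (n j : nat) (s : R) : R :=
  n%:R `^ (- (delta * j%:R)) * s ^+ j.

(* Column 0 is the intercept; column j > 0 holds x_j. *)
Definition design (n p : nat) : 'M[R]_(n, p.+1) :=
  \matrix_(i, j) if j == 0 :> nat then 1 else regressor n j (site i).

(* A model is a set of regressors; j : 'I_p stands for x_(j+1), i.e. for
   column [lift ord0 j] of the design matrix. *)
Definition submodel_design n p (a : {set 'I_p}) : 'M[R]_(n, 1 + #|a|) :=
  row_mx (col ord0 (design n p))
         (colsub (fun j : 'I_#|a| => lift ord0 (enum_val j)) (design n p)).

Definition nested_models p : set {set 'I_p} :=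
  [set a | exists2 k : nat, (k <= p)%N & a = [set j : 'I_p | (j < k)%N]%SET].

Definition true_mean n p (beta0 : 'cV[R]_p.+1) (s : R) : R :=
  beta0 ord0 0 + \sum_(j < p) beta0 (lift ord0 j) 0 * regressor n j.+1 s.

Definition correct_model n p (beta0 : 'cV[R]_p.+1) (a : {set 'I_p}) : Prop :=
  exists (b0 : R) (b : 'I_p -> R), forall s : R, 0 <= s <= n%:R `^ delta ->
    true_mean n beta0 s = b0 + \sum_(j in a) b j * regressor n j.+1 s.

Definition smallest_correct_model n p (beta0 : 'cV[R]_p.+1) (a : {set 'I_p}) :
    Prop :=
  is_argmin (@nested_models p `&` correct_model n beta0)
            (fun a' : {set 'I_p} => #|a'|) a.

Definition mu_hat n p (a : {set 'I_p}) (th : param) (z : 'cV[R]_n) : 'cV[R]_n :=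
  let X := submodel_design n a in
  let W := invmx (Sigma n th) in
  X *m invmx (X^T *m W *m X) *m X^T *m W *m z.

Definition loglik n p (a : {set 'I_p}) (z : 'cV[R]_n) (th : param) : R :=
  let r := z - mu_hat a th z in
  - (n%:R / 2) * ln (2 * pi) - 2^-1 * ln (\det (Sigma n th))
  - 2^-1 * (r^T *m invmx (Sigma n th) *m r) 0 0.

Definition is_MLE n p (Theta : set param) (a : {set 'I_p}) (z : 'cV[R]_n)
    (th : param) : Prop :=
  Theta th /\
  (loglik a z th)%:E = ereal_sup [set (loglik a z th')%:E | th' in Theta].

(* [thetahat a] is the estimate of the covariance parameter under model a. *)
Definition GIC n p (tau : R) (z : 'cV[R]_n) (thetahat : {set 'I_p} -> param)
    (a : {set 'I_p}) : R :=
  - 2 * loglik a z (thetahat a) + tau * #|a|%:R.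

End model.

Section gamma.
Context {R : realType}.

(* 1 / (i + j - 1) in 1-based indexing *)
Definition hilbert_mx (k l : nat) : 'M[R]_(k.+1, l.+1) :=
  \matrix_(i, j) ((i + j).+1%:R)^-1.

Definition gamma p (beta0 : 'cV[R]_p.+1) (k : nat) : R :=
  (beta0^T *m hilbert_mx p p *m beta0
   - beta0^T *m hilbert_mx p k *m invmx (hilbert_mx k k)
       *m hilbert_mx k p *m beta0) 0 0.

End gamma.

(* Main.v *)
Require Import Defs.
From HB Require Import structures.
From mathcomp Require Import all_boot all_order all_algebra.
From mathcomp Require Import all_classical all_reals all_analysis.
From mathcomp Require complex.
From mathcomp Require Import measurable_realfun ring lra zify.

Set Implicit Arguments.
Unset Strict Implicit.
Unset Printing Implicit Defensive.

Import Order.TTheory GRing.Theory Num.Theory.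
Import numFieldNormedType.Exports.

Local Open Scope classical_set_scope.
Local Open Scope ring_scope.

(* Write e = Z - X beta0, S = Sigma(theta), S0 = Sigma(theta0).  A spectral bound
   on S and a Gram bound for the monomials give, uniformly in theta,
     b'X'S^-1 X b >= K |b|^2   with K of order n^delta.
   Completing the square in (e + Xb)'S^-1(e + Xb) therefore decides the selection
   as soon as, with probability tending to 1 and uniformly in theta,
   - every score |x_j'S^-1 e| is at most a small multiple of sqrt(tau n^delta);
   - log det S + e'S^-1 e >= log det S0 + e'S0^-1 e - c n^delta, with c small.
   Overfitting then gains less than tau, and underfitting costs order n^delta.

   For the first point, the correlation matrix is that of an autoregression, whose
   inverse is tridiagonal: S^-1 x_j is a multiple t x_j, with t = O(n^(delta - 1)),
   up to a remainder that is bounded in l^1, so that two events free of theta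
   suffice.  For the second point, S and S0 are diagonalized simultaneously and the
   log likelihood ratio is split according to the sign of its coefficients; each
   part has an exponential moment equal to 1, so Markov's inequality gives a tail
   exp(- c n^delta / 4) at every theta.  It survives a union bound over a grid of
   polynomial size, and the likelihood varies little between grid points. *)

(** * Quadratic forms and simultaneous diagonalization *)

Section spectral.
Import complex Num.Def.
Context {R : rcfType}.

(** [gaussian_vector] gives the law of one linear combination at a time, never a product law.
    Quadratic forms are therefore reached from E exp(a'y) and E cos(a'y): averaging over a Gaussian
    coefficient turns a linear term into the exponential of a square, with a positive coefficient in
    the first case and a negative one in the second. This dictates the split of the log likelihood
    ratio by sign, and it is why the characteristic function of the normal law is computed. The
    estimates of theta are arbitrary maximizers, which may differ from model to model, and they
    enter through maximality alone. Against a larger model, the smallest correct model is evaluated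
    at the larger model's estimate, where log det S + e'S^-1 e cancels. Against a smaller model it
    is evaluated at theta0, which is why the comparison of likelihoods is one-sided and has theta0
    as its reference. The rate n^delta is a product: n from the Gram matrix of the monomials, and
    the spacing n^(delta - 1) of the sites, which is the order of the lower bound on the spectrum of
    S^-1. *)

Definition qform n (S : 'M[R]_n) (x : 'cV[R]_n) : R := (x^T *m S *m x) 0 0.

Definition posdef n (S : 'M[R]_n) : Prop :=
  S^T = S /\ forall x, x != 0 -> 0 < qform S x.

(** An eigenvalue z exists over the algebraically closed field [complex R]. For a left eigenvector
    v, the number v A v* = z v v* is fixed by conjugation because A is real and symmetric, and v v*
    is real and nonzero; so z is real and descends to R. *)
Lemma sym_eigenvalue n (A : 'M[R]_n.+1) : A^T = A -> exists a, eigenvalue A a.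
Proof.
move=> symA.
pose f : {rmorphism R -> complex R} := real_complex R.
pose AC : 'M[complex R]_n.+1 := map_mx f A.
have fr a : conjC (f a) = f a by apply: conj_Creal; rewrite realE (lecR 0 a) (lecR a 0) -realE num_real.
have [//|z /eigenvalueP[v vA v0]] := eigenvalue_closed AC.
pose w := (map_mx conjC v)^T.
have AcE : map_mx conjC AC = AC.
  by apply/matrixP=> i j; rewrite !mxE fr.
have AtE : AC^T = AC by apply/matrixP=> i j; rewrite !mxE -[in RHS]symA mxE.
have vwE : (v *m w) 0 0 = \sum_i `|v 0 i| ^+ 2.
  by rewrite mxE; apply: eq_bigr => i _; rewrite !mxE normCK.
have vw0 : (v *m w) 0 0 != 0.
  apply: contra v0; rewrite vwE psumr_eq0 => [/allP h|i _]; last exact: exprn_ge0.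
  apply/eqP/rowP => i; rewrite mxE; apply/eqP.
  by move: (h i); rewrite mem_index_enum sqrf_eq0 normr_eq0; apply.
have vwr : conjC ((v *m w) 0 0) = (v *m w) 0 0.
  by rewrite vwE rmorph_sum; apply: eq_bigr => i _; rewrite rmorphXn /= conj_Creal.
have e1 : (v *m AC *m w) 0 0 = z * (v *m w) 0 0.
  by rewrite vA -scalemxAl mxE.
have e2 : conjC ((v *m AC *m w) 0 0) = (v *m AC *m w) 0 0.
  transitivity ((map_mx conjC (v *m AC *m w)) 0 0); first by rewrite [RHS]mxE.
  rewrite !map_mxM /= AcE (_ : map_mx conjC w = v^T); last first.
    by apply/matrixP=> i j; rewrite !mxE /= conjCK.
  transitivity (((map_mx conjC v *m AC *m v^T)^T) 0 0); first by rewrite [RHS]mxE.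
  by rewrite !trmx_mul trmxK AtE mulmxA.
have zr : z \is Num.real.
  rewrite CrealE; apply/eqP; apply: (mulIf vw0).
  by rewrite -{1}vwr -rmorphM -e1; exact: e2.
have [a za] : exists a, z = f a.
  exists (Re z).
  by rewrite [LHS]complexE; move: zr; rewrite realE !lecE /= => /orP[] /andP[/eqP + _] => [->|<-]; rewrite mulr0 addr0.
exists a; move: (eigenvalue_map f A a); rewrite -za => <-.
by apply/eigenvalueP; exists v.
Qed.

(** The Householder reflection along w = v - e exchanges the unit vectors e and v; it degenerates
    only when v = e. *)
Lemma orthogonal_row0 n (v : 'rV[R]_(1 + n)) : v *m v^T = 1%:M ->
  exists Q : 'M[R]_(1 + n), Q *m Q^T = 1%:M /\ row 0 Q = v.
Proof.
move=> v1; pose e : 'rV[R]_(1 + n) := delta_mx 0 0.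
have e1 : e *m e^T = 1%:M by rewrite /e trmx_delta mul_delta_mx; apply/matrixP=> i j; rewrite !mxE !ord1.
have rowe (M : 'M[R]_(1 + n)) : row 0 M = e *m M by rewrite rowE.
have [->|ve] := eqVneq v e; first by exists 1%:M; rewrite trmx1 mulmx1 rowe mulmx1.
pose w := v - e; pose q : R := (w *m w^T) 0 0; pose c : R := (e *m v^T) 0 0.
have wwE : w *m w^T = q%:M by rewrite [LHS]mx11_scalar.
have evE : e *m v^T = c%:M by rewrite [LHS]mx11_scalar.
have veE : v *m e^T = c%:M by rewrite -[LHS]trmxK trmx_mul trmxK evE tr_scalar_mx.
have qE : q = 2 - 2 * c.
  rewrite /q /w linearB /= mulmxBl !mulmxBr v1 e1 evE veE !mxE /=; ring.
have q0 : q != 0.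
  have qs : q = \sum_i (w 0 i) ^+ 2.
    by rewrite /q mxE; apply: eq_bigr => i _; rewrite !mxE expr2.
  apply: contra ve; rewrite qs psumr_eq0 => [/allP h|i _]; last exact: sqr_ge0.
  rewrite -subr_eq0; apply/eqP/rowP => i; rewrite [RHS]mxE; apply/eqP.
  by move: (h i); rewrite mem_index_enum sqrf_eq0; apply.
pose Q : 'M[R]_(1 + n) := 1%:M - (2 / q) *: (w^T *m w).
have QT : Q^T = Q by rewrite /Q linearB linearZ /= trmx1 trmx_mul trmxK.
exists Q; split.
  have WW : (w^T *m w) *m (w^T *m w) = q *: (w^T *m w).
    by rewrite -mulmxA [w *m (w^T *m w)]mulmxA wwE mul_scalar_mx -scalemxAr.
  rewrite QT /Q; move: (w^T *m w) WW => M WW.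
  rewrite mulmxBl !mulmxBr mul1mx mulmx1 mul1mx.
  rewrite -scalemxAl -scalemxAr WW !scalerA.
  rewrite (_ : 2 / q * (2 / q) * q = 2 / q + 2 / q); last by field.
  by rewrite scalerDl; move: (_ *: M) => N; rewrite opprB addrK subrK.
rewrite rowe /Q mulmxBr mulmx1 -scalemxAr mulmxA.
have -> : e *m w^T = (c - 1)%:M.
  by rewrite /w linearB /= mulmxBr evE e1 -raddfB.
rewrite mul_scalar_mx scalerA (_ : 2 / q * (c - 1) = -1).
  by rewrite scaleN1r opprK /w addrC subrK.
apply: (mulIf q0); rewrite mulrAC divfK // qE; ring.
Qed.

(** Deflation: once a unit eigenvector is rotated into the first row, symmetry clears the first row
    and column off the diagonal, and the induction applies to the remaining block. *)
Lemma spectral_sym n (A : 'M[R]_n) : A^T = A ->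
  exists (Q : 'M[R]_n) (d : 'rV[R]_n), Q *m Q^T = 1%:M /\ Q *m A *m Q^T = diag_mx d.
Proof.
elim: n A => [|n IH] A symA.
  by exists 1%:M, 0; split; apply/matrixP => -[].
have [a /eigenvalueP[v0 v0A v0n]] := sym_eigenvalue symA.
pose s := (v0 *m v0^T) 0 0.
have sE : s = \sum_i (v0 0 i) ^+ 2.
  by rewrite /s mxE; apply: eq_bigr => i _; rewrite !mxE expr2.
have s0 : 0 < s.
  rewrite lt_def; apply/andP; split; last by rewrite sE sumr_ge0 // => i _; exact: sqr_ge0.
  apply: contra v0n; rewrite sE psumr_eq0 => [/allP h|i _]; last exact: sqr_ge0.
  apply/eqP/rowP => i; rewrite [RHS]mxE; apply/eqP.
  by move: (h i); rewrite mem_index_enum sqrf_eq0; apply.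
pose v : 'rV[R]_(1 + n) := (Num.sqrt s)^-1 *: v0.
have vA : v *m A = a *: v by rewrite /v -scalemxAl v0A !scalerA mulrC.
have v1 : v *m v^T = 1%:M.
  rewrite /v linearZ /= -scalemxAl -scalemxAr scalerA [v0 *m _]mx11_scalar -/s.
  by rewrite scale_scalar_mx -expr2 exprVn sqr_sqrtr ?ltW// mulVf// gt_eqF.
have [Q0 [Q0o Q0v]] := orthogonal_row0 v1.
have [B BD] : exists B : 'M[R]_(1 + n), B = Q0 *m A *m Q0^T by eexists.
have symB : B^T = B by rewrite BD !trmx_mul trmxK symA mulmxA.
have r0B : row 0 B = a *: delta_mx 0 0.
  by rewrite BD !row_mul Q0v vA -scalemxAl -{1}Q0v -row_mul Q0o row1.
have ulB : ulsubmx B = a%:M.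
  apply/matrixP=> i j; rewrite !ord1 !mxE.
  have /rowP/(_ 0) := r0B; rewrite !mxE ?eqxx /= ?mulr1 => <-.
  by congr (B _ _); apply/val_inj.
have urB : ursubmx B = 0.
  apply/matrixP=> i j; rewrite !ord1 !mxE.
  have /rowP/(_ (rshift 1 j)) := r0B; rewrite !mxE /= mulr0 => <-.
  by congr (B _ _); apply/val_inj.
have dlB : dlsubmx B = 0.
  by rewrite -[LHS]trmxK trmx_dlsub symB urB trmx0.
pose B' := drsubmx B.
have symB' : B'^T = B' by rewrite /B' trmx_drsub symB.
have BE : B = block_mx a%:M 0 0 B'.
  by rewrite -[LHS]submxK ulB urB dlB.
have [Q' [d' [Q'o Q'B]]] := IH _ symB'.
pose Q1 : 'M[R]_(1 + n) := block_mx 1%:M 0 0 Q'.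
have Q1T : Q1^T = block_mx 1%:M 0 0 Q'^T by rewrite tr_block_mx !trmx0 trmx1.
have Q1o : Q1 *m Q1^T = 1%:M.
  by rewrite Q1T /Q1 mulmx_block !mulmx0 !mul0mx !addr0 !add0r mulmx1 Q'o -scalar_mx_block.
have Q1B : Q1 *m B *m Q1^T = diag_mx (row_mx a%:M d').
  rewrite BE Q1T /Q1 !mulmx_block !mulmx0 !mul0mx !addr0 !add0r !mulmx1 !mul1mx ?mul0mx ?mulmx0 Q'B.
  by rewrite diag_mx_row; congr block_mx; apply/matrixP=> i j; rewrite !ord1 !mxE.
exists (Q1 *m Q0), (row_mx a%:M d'); split.
  by rewrite trmx_mul mulmxA -[Q1 *m Q0 *m _]mulmxA Q0o mulmx1.
by rewrite -Q1B BD trmx_mul !mulmxA.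
Qed.

Lemma qform_ext n (S : 'M[R]_n) (A : 'M[R]_n) x :
  qform (A *m S *m A^T) x = qform S (A^T *m x).
Proof. by rewrite /qform trmx_mul trmxK !mulmxA. Qed.

Lemma qform_diag n (d : 'rV[R]_n) x :
  qform (diag_mx d) x = \sum_i d 0 i * x i 0 ^+ 2.
Proof.
rewrite /qform mul_mx_diag mxE; apply: eq_bigr => i _.
by rewrite !mxE; ring.
Qed.

Lemma qform1 n (x : 'cV[R]_n) : qform 1%:M x = \sum_i x i 0 ^+ 2.
Proof.
rewrite -diag_const_mx qform_diag; apply: eq_bigr => i _.
by rewrite mxE mul1r.
Qed.

Lemma posdef_unit n (S : 'M[R]_n) : posdef S -> S \in unitmx.
Proof.
move=> [_ pS]; rewrite -row_free_unit -kermx_eq0; apply/rowV0P => v /sub_kermxP vS.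
have [//|v0] := eqVneq v 0.
have : v^T != 0 by rewrite -trmx0 (inj_eq trmx_inj).
by move/pS; rewrite /qform trmxK vS mul0mx mxE ltxx.
Qed.

(** Scaling by the inverse square roots of the eigenvalues of [S0] whitens it. A further rotation
    diagonalizes the transformed S and leaves the identity alone. *)
Lemma simultaneous_diag n (S0 S : 'M[R]_n) : posdef S0 -> posdef S ->
  exists (A : 'M[R]_n) (d : 'rV[R]_n), [/\ A \in unitmx,
    forall i, 0 < d 0 i, A *m S0 *m A^T = 1%:M & A *m S *m A^T = diag_mx d].
Proof.
move=> [sym0 pos0] [symS posS].
have pos_diag m (M : 'M[R]_m) (Q : 'M[R]_m) (d : 'rV[R]_m) : (forall x, x != 0 -> 0 < qform M x) -> Q \in unitmx ->
    Q *m M *m Q^T = diag_mx d -> forall i, 0 < d 0 i.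
  move=> pM uQ QM i; have := pM (Q^T *m delta_mx i 0).
  rewrite -qform_ext QM qform_diag (bigD1 i)//= big1 ?addr0 => [|j ji]; last first.
    by rewrite !mxE (negbTE ji) expr0n mulr0.
  rewrite !mxE !eqxx expr1n mulr1; apply.
  apply/eqP => /(congr1 (mulmx (invmx Q^T))); rewrite mulKmx ?unitmx_tr// mulmx0.
  move/matrixP/(_ i 0); rewrite !mxE !eqxx => /eqP; by rewrite oner_eq0.
have ortho_unit m (Q : 'M[R]_m) : Q *m Q^T = 1%:M -> Q \in unitmx by case/mulmx1_unit.
have [Q0 [d0 [Q0o Q0d]]] := spectral_sym sym0.
have d0p := pos_diag _ _ _ _ pos0 (ortho_unit _ _ Q0o) Q0d.
pose D : 'M[R]_n := diag_mx (\row_i (Num.sqrt (d0 0 i))^-1).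
have DT : D^T = D by rewrite tr_diag_mx.
pose A0 := D *m Q0.
have A0S : A0 *m S0 *m A0^T = 1%:M.
  rewrite /A0 trmx_mul DT !mulmxA -2![D *m _ *m _]mulmxA Q0d !mulmx_diag -diag_const_mx.
  congr diag_mx; apply/rowP => i; rewrite !mxE.
  rewrite mulrAC -expr2 exprVn sqr_sqrtr ?ltW ?d0p// mulVf// gt_eqF// d0p//.
have A0u : A0 \in unitmx.
  by move/mulmx1_unit: A0S => [+ _]; rewrite unitmx_mul => /andP[].
move: A0 A0S A0u => A0 A0S A0u.
pose S1 := A0 *m S *m A0^T.
have symS1 : S1^T = S1 by rewrite /S1 !trmx_mul trmxK symS mulmxA.
move: (spectral_sym symS1) => [Q [d [Qo Qd]]].
have uQ := ortho_unit _ _ Qo.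
have AE M : (Q *m A0) *m M *m (Q *m A0)^T = Q *m (A0 *m M *m A0^T) *m Q^T.
  by rewrite trmx_mul !mulmxA.
exists (Q *m A0), d; split.
- by rewrite unitmx_mul uQ.
- apply: (pos_diag _ S (Q *m A0)) => //; first by rewrite unitmx_mul uQ.
  by rewrite AE.
- by rewrite AE A0S mulmx1 Qo.
- by rewrite AE.
Qed.

(** In the coordinates [A *m x] any comparison of two Gaussian laws reduces to the relative
    eigenvalues d; the later sections compare covariance matrices only in this form. *)
Lemma posdef_pair n (S0 S : 'M[R]_n) : posdef S0 -> posdef S ->
  exists (A : 'M[R]_n) (d : 'rV[R]_n), [/\ A \in unitmx,
    forall i, 0 < d 0 i & [/\ A *m S0 *m A^T = 1%:M,
    A *m S *m A^T = diag_mx d,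
    \det S = \det S0 * \prod_i d 0 i,
    forall x, qform (invmx S0) x = \sum_i (A *m x) i 0 ^+ 2 &
    forall x, qform (invmx S) x = \sum_i (d 0 i)^-1 * (A *m x) i 0 ^+ 2]].
Proof.
move=> pS0 pS; have [A [d [uA dp A0 AS]]] := simultaneous_diag pS0 pS.
have invE (M N : 'M[R]_n) : M \in unitmx -> A *m M *m A^T = N -> invmx M = A^T *m invmx N *m (A^T)^T.
  move=> uM EN.
  have uN : N \in unitmx by rewrite -EN !unitmx_mul uM uA unitmx_tr uA.
  have : A *m (M *m A^T *m invmx N) = 1%:M by rewrite !mulmxA EN mulmxV.
  move/(congr1 (mulmx (invmx A))); rewrite mulKmx// mulmx1 => h.
  by rewrite trmxK -[RHS](mulKmx uM) !(mulmxA M) h mulVmx// mulmx1.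
exists A, d; split => //; split => //.
- have := congr1 determinant AS; have := congr1 determinant A0.
  rewrite !det_mulmx det1 det_tr det_diag => e <-.
  by rewrite -[LHS]mulr1 -e; ring.
- by move=> x; rewrite (invE _ _ (posdef_unit pS0) A0) invmx1 qform_ext trmxK qform1.
- move=> x; rewrite (invE _ _ (posdef_unit pS) AS) qform_ext trmxK.
  have -> : invmx (diag_mx d) = diag_mx (\row_i (d 0 i)^-1).
    have dE : diag_mx d *m diag_mx (\row_i (d 0 i)^-1) = 1%:M.
      rewrite mulmx_diag -diag_const_mx; congr diag_mx.
      by apply/rowP => i; rewrite !mxE mulfV// gt_eqF.
    have [u _] := mulmx1_unit dE.
    by rewrite -[RHS](mulKmx u) dE mulmx1.
  by rewrite qform_diag; apply: eq_bigr => i _; rewrite mxE.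
Qed.

End spectral.

(** * Gaussian integrals *)

Section normal_integrals.
Context {R : realType}.
Notation mu := (@lebesgue_measure R).
Notation N01 := (@normal_prob R 0 1).

(** The Radon-Nikodym derivative and the explicit density have the same integral over every
    measurable set, hence agree almost everywhere. *)
Lemma ge0_integral_normal_prob (m s : R) (f : R -> \bar R) :
  measurable_fun setT f -> (forall x, 0 <= f x)%E ->
  (\int[normal_prob m s]_x f x = \int[mu]_x (f x * (normal_pdf m s x)%:E))%E.
Proof.
move=> mf f0.
pose nu : {finite_measure set _ -> \bar R} := normal_prob m s.
have dom : nu `<< mu by exact: normal_prob_dominates.
rewrite -(Radon_Nikodym_SigmaFinite.change_of_variables dom f0 measurableT mf).
have intRN := Radon_Nikodym_SigmaFinite.f_integrable dom.
apply: ae_eq_integral => //.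
- by apply: emeasurable_funM => //; exact: measurable_int intRN.
- apply: emeasurable_funM => //; apply/measurable_EFinP; exact: measurable_normal_pdf.
- have : ae_eq mu setT (Radon_Nikodym_SigmaFinite.f nu mu) (fun x => (normal_pdf m s x)%:E).
    apply: integral_ae_eq => //.
    + apply/measurable_EFinP; exact: measurable_normal_pdf.
    + by move=> E _ mE; rewrite -Radon_Nikodym_SigmaFinite.f_integral.
  by apply: filterS => x /= + _ => ->.
Qed.

Lemma normal_pdf1E (m x : R) : normal_pdf m 1 x =
  normal_peak 1 * expR (- (x - m) ^+ 2 / 2).
Proof. by rewrite normal_pdfE ?oner_eq0// /normal_fun expr1n. Qed.

Lemma integral_normal_prob_shift (m : R) (f : R -> R) :
  continuous f -> (forall x, 0 <= f x) ->
  (\int[normal_prob m 1]_x (f x)%:E = \int[N01]_x (f (x + m))%:E)%E.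
Proof.
move=> cf f0.
have cfm : continuous (fun x => f (x + m)).
  move=> x; apply: (@continuous_comp _ _ _ (fun x => x + m) f); last exact: cf.
  by apply: cvgD; [exact: cvg_id|exact: cvg_cst].
have mE (g : R -> R) : continuous g -> measurable_fun setT (EFin \o g).
  by move=> cg; apply/measurable_EFinP; exact: continuous_measurable_fun.
rewrite ge0_integral_normal_prob; [|exact: mE|by move=> x; rewrite lee_fin].
rewrite ge0_integral_normal_prob; [|exact: (mE _ cfm)|by move=> x; rewrite lee_fin].
have dE : (fun x : R => x + m)^`()%classic = cst 1.
  by apply/funext => x; rewrite derive1E deriveD// derive_id derive_cst addr0.
under eq_integral do rewrite -EFinM.
rewrite (@increasing_ge0_integration_by_substitutionT _ (fun x => x + m)).
- apply: eq_integral => x _; rewrite dE /= !fctE mulr1 -EFinM; congr (_ * _)%:E.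
  by rewrite !normal_pdf1E addrK subr0.
- by move=> x y; rewrite ltrD2r.
- by rewrite dE => ?; exact: cvg_cst.
- by rewrite dE; exact: is_cvg_cst.
- by rewrite dE; exact: is_cvg_cst.
- by [].
- exact: cvg_addrr_Ny.
- exact: cvg_addrr.
- move=> x; apply: cvgM; [exact: cf|exact: continuous_normal_pdf].
- by move=> x; rewrite mulr_ge0// normal_pdf_ge0.
Qed.

(** Completing the square: exp(s x) times the density of N(0, 1) is exp(s^2 / 2) times that of N(s,
    1). *)
Lemma integral_normal_prob_tilt (s : R) (f : R -> R) :
  measurable_fun setT f -> (forall x, 0 <= f x) ->
  (\int[N01]_x (expR (s * x) * f x)%:E =
   (expR (s ^+ 2 / 2))%:E * \int[normal_prob s 1]_x (f x)%:E)%E.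
Proof.
move=> mf f0.
have mes : measurable_fun setT (fun x : R => expR (s * x)).
  by apply: measurableT_comp => //; apply: measurable_funM.
rewrite ge0_integral_normal_prob; first last.
- by move=> x; rewrite lee_fin mulr_ge0// expR_ge0.
- by apply/measurable_EFinP; apply: measurable_funM.
rewrite ge0_integral_normal_prob; first last.
- by move=> x; rewrite lee_fin.
- exact/measurable_EFinP.
rewrite -ge0_integralZl//; first last.
- by move=> x _; rewrite -EFinM lee_fin mulr_ge0// normal_pdf_ge0.
- by apply: emeasurable_funM; apply/measurable_EFinP => //; exact: measurable_normal_pdf.
apply: eq_integral => x _; rewrite -!EFinM; congr EFin.
rewrite !normal_pdf1E subr0.
have -> : expR (- x ^+ 2 / 2) = expR (- (s * x)) * (expR (s ^+ 2 / 2) * expR (- (x - s) ^+ 2 / 2)).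
  by rewrite -!expRD; congr expR; field.
rewrite expRN; field; by rewrite gt_eqF// expR_gt0.
Qed.

Lemma normal_mgf (s : R) : (\int[N01]_x (expR (s * x))%:E = (expR (s ^+ 2 / 2))%:E)%E.
Proof.
transitivity (\int[N01]_x (expR (s * x) * cst 1 x)%:E)%E.
  by apply: eq_integral => x _; rewrite mulr1.
rewrite integral_normal_prob_tilt//= integral_cst// mul1e.
by rewrite [X in (_ * X)%E](_ : _ = 1%E) ?mule1//; exact: (probability_setT (normal_prob s 1)).
Qed.

Lemma integrable_expR_normal (s : R) : N01.-integrable setT (fun x => (expR (s * x))%:E).
Proof.
apply/integrableP; split.
  by apply/measurable_EFinP; apply: measurableT_comp => //; apply: measurable_funM.
under eq_integral do rewrite gee0_abs ?lee_fin ?expR_ge0//.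
by rewrite normal_mgf ltry.
Qed.

Lemma integrable_normal_le (f : R -> R) (s : R) : measurable_fun setT f ->
  (forall x, `|f x| <= expR (s * x) + expR (- s * x)) ->
  N01.-integrable setT (EFin \o f).
Proof.
move=> mf fb.
apply: (@le_integrable _ (measurableTypeR R) R N01 setT measurableT _ (fun x => ((expR (s * x))%:E + (expR (- s * x))%:E)%E)) => //.
- exact/measurable_EFinP.
- by move=> x _ /=; rewrite lee_fin (le_trans (fb x))// ler_norm.
- by apply: integrableD => //; exact: integrable_expR_normal.
Qed.

Let msin (t : R) : measurable_fun setT (fun x : R => sin (t * x)).
Proof.
apply: measurableT_comp; last exact: measurable_funM.
by apply: continuous_measurable_fun; exact: continuous_sin.
Qed.

Let mcos (t : R) : measurable_fun setT (fun x : R => cos (t * x)).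
Proof.
apply: measurableT_comp; last exact: measurable_funM.
by apply: continuous_measurable_fun; exact: continuous_cos.
Qed.

Let mexp (t : R) : measurable_fun setT (fun x : R => expR (t * x)).
Proof. by apply: measurableT_comp => //; exact: measurable_funM. Qed.

Let expR_norm_le (x : R) : expR `|x| <= expR x + expR (- x).
Proof.
have [x0|x0] := ger0P x.
- by rewrite lerDl expR_ge0.
- by rewrite lerDr expR_ge0.
Qed.

Let int_bounded (f : R -> R) : measurable_fun setT f -> (forall x, `|f x| <= 1) ->
  N01.-integrable setT (EFin \o f).
Proof.
move=> mf f1; apply: (@integrable_normal_le _ 0) => // x.
by rewrite oppr0 mul0r expR0 (le_trans (f1 x))// lerDl.
Qed.

Let int_expsin (s t : R) : N01.-integrable setT (EFin \o (fun x => expR (s * x) * sin (t * x))).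
Proof.
apply: (@integrable_normal_le _ s); first exact: measurable_funM.
move=> x; rewrite normrM ger0_norm ?expR_ge0// mulNr.
rewrite (le_trans (ler_piMr (expR_ge0 _) (sin_max _)))//.
by rewrite lerDl expR_ge0.
Qed.

Notation Nint f := (N01.-integrable setT (EFin \o f)).

Let ED (f g : R -> R) : Nint f -> Nint g ->
  \int[N01]_x (f x + g x) = \int[N01]_x f x + \int[N01]_x g x.
Proof. exact: RintegralD. Qed.

Let EZ (c : R) (f : R -> R) : Nint f ->
  \int[N01]_x (c * f x) = c * \int[N01]_x f x.
Proof. exact: RintegralZl. Qed.

Let iZ (c : R) (f : R -> R) : Nint f -> Nint (fun x => c * f x).
Proof. exact: (@integrableZl _ (measurableTypeR R) R N01 setT measurableT). Qed.

Let iD (f g : R -> R) : Nint f -> Nint g -> Nint (fun x => f x + g x).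
Proof. exact: (@integrableD _ (measurableTypeR R) R N01 setT measurableT). Qed.

Let Rint1 : \int[N01]_x (1 : R) = 1.
Proof.
rewrite Rintegral_cst// mul1r.
by rewrite [X in fine X](_ : _ = 1%E)//; exact: (probability_setT N01).
Qed.

(** The tilt turns the sine into sin(t (x + s)), which the addition formula expands. Differentiating
    in s at 0 will give Stein's identity. *)
Lemma normal_sin_tilt (s t : R) :
  \int[N01]_x (expR (s * x) * sin (t * x)) = expR (s ^+ 2 / 2) *
   (cos (t * s) * \int[N01]_x (sin (t * x)) + sin (t * s) * \int[N01]_x (cos (t * x))).
Proof.
have isin := int_bounded (msin t) (fun x => sin_max _).
have icos := int_bounded (mcos t) (fun x => cos_max _).
(* The tilt is stated for nonnegative integrands, so 1 is added to the sine and cancelled at the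
   end. *)
have csin : continuous (fun x : R => 1 + sin (t * x)).
  move=> x; apply: cvgD; first exact: cvg_cst.
  apply: (@continuous_comp _ _ _ (fun x => t * x) sin); last exact: continuous_sin.
  by apply: cvgM; [exact: cvg_cst|exact: cvg_id].
have h0 (x : R) : 0 <= 1 + sin (t * x).
  by have := sin_max (t * x); rewrite ler_norml => /andP[? _]; rewrite -lerBlDl sub0r.
have ish : N01.-integrable setT (EFin \o (fun x => 1 + sin (t * (x + s)))).
  apply: (@integrable_normal_le _ 0).
    apply: measurable_funD => //; apply: measurableT_comp.
      by apply: continuous_measurable_fun; exact: continuous_sin.
    by apply: measurable_funM => //; exact: measurable_funD.
  move=> x; rewrite oppr0 mul0r expR0 (le_trans (ler_normD _ _))// normr1 lerD2l.
  exact: sin_max.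
have := @integral_normal_prob_tilt s (fun x => 1 + sin (t * x)) (continuous_measurable_fun csin) h0.
rewrite integral_normal_prob_shift//.
move/(congr1 fine); rewrite fineM//; last exact: (integrable_fin_num measurableT ish).
have -> : fine (\int[N01]_x (expR (s * x) * (1 + sin (t * x)))%:E)%E =
    \int[N01]_x (expR (s * x)) + \int[N01]_x (expR (s * x) * sin (t * x)).
  rewrite -ED//; last exact: integrable_expR_normal.
  by congr fine; apply: eq_integral => x _; rewrite mulrDr mulr1.
have -> : \int[N01]_x expR (s * x) = expR (s ^+ 2 / 2) by rewrite /Rintegral normal_mgf.
have -> : fine (\int[N01]_x (1 + sin (t * (x + s)))%:E)%E = 1 +
    (cos (t * s) * \int[N01]_x (sin (t * x)) + sin (t * s) * \int[N01]_x (cos (t * x))).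
  rewrite -!EZ// -ED; [|exact: iZ|exact: iZ].
  rewrite -[X in X + _]Rint1 -ED; first last.
  - by apply: iD; exact: iZ.
  - by apply: int_bounded => // x; rewrite normr1.
  congr fine; apply: eq_integral => x _; rewrite mulrDr sinD; congr EFin; ring.
rewrite mulrDr mulr1 /=; exact: addrI.
Qed.

Let norm_exp_le (x s : R) : `|s| < 1 -> `|x * expR (s * x)| <= expR (2 * x) + expR (- 2 * x).
Proof.
move=> s1; rewrite normrM (ger0_norm (expR_ge0 _)).
have h1 : `|x| <= expR `|x| by rewrite (le_trans _ (expR_ge1Dx _))// lerDr.
have h2 : expR (s * x) <= expR `|x|.
  rewrite ler_expR (le_trans (ler_norm _))// normrM ler_piMl// ltW//.
rewrite (le_trans (ler_pM _ (expR_ge0 _) h1 h2))// -expRD.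
rewrite (_ : `|x| + `|x| = `|2 * x|); last by rewrite normrM ger0_norm//; ring.
by rewrite (le_trans (expR_norm_le _))// mulNr.
Qed.

Let dexp2 (x : R) : is_derive (x : R) (1 : R) (fun s => expR (s ^+ 2 / 2)) (x * expR (x ^+ 2 / 2)).
Proof.
apply: trigger_derive; rewrite /GRing.scale /=.
set e := expR _; set q := - 2 ^- 2; rewrite ?(mulr0, add0r, mulr1); by field.
Qed.

Let dtrig (t A B : R) : is_derive (0 : R) (1:R) (fun s => cos (t * s) * A + sin (t * s) * B) (t * B).
Proof.
apply: trigger_derive; rewrite /GRing.scale /=.
rewrite !mulr0 sin0 cos0; ring.
Qed.

Let dtilt (t A B : R) : is_derive (0 : R) (1:R)
  (fun s => expR (s ^+ 2 / 2) * (cos (t * s) * A + sin (t * s) * B)) (t * B).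
Proof.
apply: (is_derive_eq (is_deriveM (dexp2 0) (dtrig t A B))).
rewrite /GRing.scale /= !mulr0 mul0r sin0 cos0 expr0n mul0r expR0; ring.
Qed.

(** Stein's identity E[x f(x)] = E[f'(x)] for f(x) = sin(t x): both sides are the derivative at s =
    0 of [normal_sin_tilt], taken under the integral, so no integration by parts on the line is
    involved. *)
Lemma normal_stein_sin (t : R) :
  \int[N01]_x (x * sin (t * x)) = t * \int[N01]_x (cos (t * x)).
Proof.
pose f (s x : R) := expR (s * x) * sin (t * x).
have d1 (s x : R) : is_derive s (1 : R) (f ^~ x) (x * expR (s * x) * sin (t * x)).
  apply: trigger_derive; rewrite /GRing.scale /=. ring.
have d1f : partial1of2 f = fun s x => x * expR (s * x) * sin (t * x).
  apply/funext => s; apply/funext => x; rewrite partial1of2E.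
  by have ? := d1 s x; exact: derive_val.
pose G (x : R) := expR (2 * x) + expR (- 2 * x).
have I0 : (0 : R) \in `](-1), 1[ by rewrite in_itv/= ltr01 ltrN10.
have intf s : (s : R) \in `](-1), 1[ -> N01.-integrable setT (EFin \o f s) by move=> _; exact: int_expsin.
have iG : N01.-integrable setT (EFin \o G).
  apply: (@integrable_normal_le _ 2) => [|x]; first exact: measurable_funD.
  by rewrite ger0_norm// addr_ge0 ?expR_ge0.
have G0 x : 0 <= G x by rewrite addr_ge0 ?expR_ge0.
have Gub s x : `](-1), 1[%classic s -> setT x -> `|partial1of2 f s x| <= G x.
  rewrite /= in_itv/= -ltr_norml => s1 _; rewrite d1f normrM.
  by rewrite (le_trans (ler_piMr (normr_ge0 _) (sin_max _)))// norm_exp_le.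
have df s x : `](-1), 1[%classic s -> setT x -> derivable (f ^~ x) s 1.
  by move=> _ _; have ? := d1 s x; exact: ex_derive.
have dL := @differentiation_under_integral R _ (measurableTypeR R) N01 f setT measurableT 0 (-1) 1 I0 intf df G G0 iG Gub.
set A := \int[N01]_x (sin (t * x)); set B := \int[N01]_x (cos (t * x)).
have E1 : (fun s => \int[N01]_x f s x) = fun s => expR (s ^+ 2 / 2) * (cos (t * s) * A + sin (t * s) * B).
  by apply/funext => s; rewrite normal_sin_tilt.
move: dL; rewrite E1 derive1E (@derive_val _ _ _ _ _ _ _ (dtilt t A B)) => ->.
apply: eq_Rintegral => x _; by rewrite d1f mul0r expR0 mulr1.
Qed.

(** Differentiation under the integral and Stein's identity give the equation phi' = - t phi of the
    characteristic function. *)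
Lemma derive_normal_cos (t : R) : is_derive t (1 : R)
  (fun t => \int[N01]_x (cos (t * x))) (- t * \int[N01]_x (cos (t * x))).
Proof.
pose f (s x : R) := cos (s * x).
have d1 (s x : R) : is_derive s (1 : R) (f ^~ x) (- 1 * (x * sin (s * x))).
  by apply: trigger_derive; rewrite /GRing.scale /=; ring.
have d1f : partial1of2 f = fun s x => - 1 * (x * sin (s * x)).
  apply/funext => s; apply/funext => x; rewrite partial1of2E.
  by have ? := d1 s x; exact: derive_val.
pose G (x : R) := expR (1 * x) + expR (- 1 * x).
have I0 : t \in `](t - 1), (t + 1)[ by rewrite in_itv/= ltrBlDr ltrDl ltr01.
have intf s : (s : R) \in `](t - 1), (t + 1)[ -> N01.-integrable setT (EFin \o f s).
  by move=> _; apply: int_bounded => [|x]; [exact: mcos|exact: cos_max].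
have G0 x : 0 <= G x by rewrite addr_ge0 ?expR_ge0.
have iG : N01.-integrable setT (EFin \o G).
  apply: (@integrable_normal_le _ 1) => [|x]; first exact: measurable_funD.
  by rewrite ger0_norm.
have xsin s x : `|x * sin (s * x)| <= G x.
  rewrite normrM (le_trans (ler_piMr (normr_ge0 _) (sin_max _)))//.
  rewrite (le_trans _ (_ : expR `|x| <= _))//.
    by rewrite (le_trans _ (expR_ge1Dx _))// lerDr.
  by rewrite /G mulN1r mul1r expR_norm_le.
have Gub s x : `](t - 1), (t + 1)[%classic s -> setT x -> `|partial1of2 f s x| <= G x.
  by move=> _ _; rewrite d1f mulN1r normrN.
have df s x : `](t - 1), (t + 1)[%classic s -> setT x -> derivable (f ^~ x) s 1.
  by move=> _ _; have ? := d1 s x; exact: ex_derive.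
have dL := @differentiation_under_integral R _ (measurableTypeR R) N01 f setT measurableT t (t - 1) (t + 1) I0 intf df G G0 iG Gub.
have dL' := @derivable_under_integral R _ (measurableTypeR R) N01 f setT measurableT t (t - 1) (t + 1) I0 intf df G G0 iG Gub.
have -> : - t * \int[N01]_x (cos (t * x)) = (fun s => \int[N01]_x (f s x))^`()%classic t.
  rewrite dL d1f EZ ?normal_stein_sin; first by ring.
  apply: (@integrable_normal_le _ 1) => [|x]; first exact: measurable_funM.
  exact: xsin.
by apply: DeriveDef => //; rewrite derive1E.
Qed.

Lemma normal_cos (t : R) : \int[N01]_x (cos (t * x)) = expR (- (t ^+ 2 / 2)).
Proof.
pose F (t : R) := \int[N01]_x (cos (t * x)).
have : F t * expR (t ^+ 2 / 2) = F 0 * expR (0 ^+ 2 / 2).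
  apply: (@is_derive_0_is_cst _ (fun t => F t * expR (t ^+ 2 / 2))) => x.
  apply: (is_derive_eq (is_deriveM (derive_normal_cos x) (dexp2 x))).
  by rewrite /GRing.scale /=; ring.
rewrite {2}/F expr0n mul0r expR0 mulr1.
rewrite (_ : \int[N01]_x (cos (0 * x)) = 1); last first.
  by rewrite -[RHS]Rint1; apply: eq_Rintegral => x _; rewrite mul0r cos0.
have e0 : expR (t ^+ 2 / 2) != 0 by rewrite gt_eqF// expR_gt0.
by move=> h; apply: (mulIf e0); rewrite expRN mulVf.
Qed.

End normal_integrals.

Section normal_square.
Context {R : realType}.
Notation mu := (@lebesgue_measure R).
Notation N01 := (@normal_prob R 0 1).

(** The integrand against the density of N(0, 1) is s times the density of N(0, s^2), where s^2 = 1
    / (1 - c). *)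
Lemma normal_exp_square (c : R) : c < 1 ->
  (\int[N01]_x (expR (c / 2 * x ^+ 2))%:E = ((Num.sqrt (1 - c))^-1)%:E)%E.
Proof.
move=> c1; pose s := (Num.sqrt (1 - c))^-1.
have c0 : 0 < 1 - c by rewrite subr_gt0.
have s0 : 0 < s by rewrite invr_gt0 sqrtr_gt0.
have s2 : s ^+ 2 = (1 - c)^-1 by rewrite exprVn sqr_sqrtr// ltW.
have mf : measurable_fun setT (fun x : R => expR (c / 2 * x ^+ 2)).
  by apply: measurableT_comp => //; apply: measurable_funM => //; exact: measurable_funX.
rewrite ge0_integral_normal_prob; [|exact/measurable_EFinP|by move=> x; rewrite lee_fin expR_ge0].
transitivity (\int[mu]_x (s%:E * (normal_pdf 0 s x)%:E))%E; last first.
  rewrite ge0_integralZl ?lee_fin ?(ltW s0)//.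
  - by rewrite integral_normal_pdf mule1.
  - by apply/measurable_EFinP; exact: measurable_normal_pdf.
  - by move=> x _; rewrite lee_fin normal_pdf_ge0.
apply: eq_integral => x _; rewrite -!EFinM; congr EFin.
rewrite normal_pdf1E normal_pdfE ?gt_eqF// /normal_fun !subr0 s2.
have -> : normal_peak s = s^-1 * normal_peak 1.
  rewrite /normal_peak expr1n mul1r -mulrnAr sqrtrM ?sqr_ge0// sqrtr_sqr ger0_norm ?(ltW s0)//.
  by rewrite invfM.
rewrite mulrCA -expRD [RHS]mulrA [s * _]mulrA mulfV ?gt_eqF// mul1r.
congr (_ * expR _); rewrite -mulr_natr.
have c0' : 1 - c != 0 by rewrite gt_eqF.
by field; rewrite c0'.
Qed.

End normal_square.

Section measurable_sums.
Context {R : realType} d (T : measurableType d).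

Lemma measurable_lin n (y : 'I_n -> T -> R) (a : 'I_n -> R) :
  (forall i, measurable_fun setT (y i)) ->
  measurable_fun setT (fun w => \sum_i a i * y i w).
Proof.
move=> my; apply: measurable_sum => i; exact: measurable_funM.
Qed.

Lemma measurable_quad n (y : 'I_n -> T -> R) (s : seq 'I_n) (c : 'I_n -> R) :
  (forall i, measurable_fun setT (y i)) ->
  measurable_fun setT (fun w => \sum_(i <- s) c i * y i w ^+ 2).
Proof.
move=> my; apply: measurable_sum => i; apply: measurable_funM => //.
exact: measurable_funX.
Qed.

End measurable_sums.

(** * Exponential moments of quadratic forms in Gaussian variables *)

Section standard_gaussian.
Context {R : realType} d (T : measurableType d) (P : probability T R).
Notation N01 := (@normal_prob R 0 1).

(** A standard normal vector, described by its one-dimensional projections as in [gaussian_vector].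
    Nonnegative test functions spare integrability conditions; the cosine is later reached through 1
    + cos. *)
Definition std_gaussian n (y : 'I_n -> T -> R) : Prop :=
  (forall i, measurable_fun setT (y i)) /\
  forall (a : 'I_n -> R) (f : R -> R), continuous f -> (forall x, 0 <= f x) ->
    (\int[P]_w (f (\sum_i a i * y i w))%:E =
     \int[N01]_x (f (Num.sqrt (\sum_i a i ^+ 2) * x))%:E)%E.

Lemma std_gaussian_mgf n (y : 'I_n -> T -> R) (a : 'I_n -> R) : std_gaussian y ->
  (\int[P]_w (expR (\sum_i a i * y i w))%:E =
   (expR ((\sum_i a i ^+ 2) / 2))%:E)%E.
Proof.
move=> [_ ->]; [|exact: continuous_expR|by move=> x; exact: expR_ge0].
by rewrite normal_mgf sqr_sqrtr// sumr_ge0// => i _; exact: sqr_ge0.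
Qed.

Lemma integrable_bounded1 d' (T' : measurableType d') (Q : probability T' R) (f : T' -> R) (M : R) :
  measurable_fun setT f -> (forall x, `|f x| <= M) -> Q.-integrable setT (EFin \o f).
Proof.
move=> mf f1.
apply: (@le_integrable _ T' R Q setT measurableT _ (cst M%:E)) => //.
- exact/measurable_EFinP.
- by move=> x _; rewrite lee_fin (le_trans (f1 x))// ler_norm.
- exact: finite_measure_integrable_cst.
Qed.

Lemma Rintegral_prob1 d' (T' : measurableType d') (Q : probability T' R) :
  \int[Q]_x (1 : R) = 1.
Proof. by rewrite Rintegral_cst// mul1r [X in fine X](_ : _ = 1%E)//; exact: (probability_setT Q). Qed.

Lemma std_gaussian_cos n (y : 'I_n -> T -> R) (a : 'I_n -> R) : std_gaussian y ->
  \int[P]_w (cos (\sum_i a i * y i w)) = expR (- ((\sum_i a i ^+ 2) / 2)).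
Proof.
move=> [my hy]; set v := \sum_i a i ^+ 2.
have v0 : 0 <= v by rewrite sumr_ge0// => i _; exact: sqr_ge0.
have ccos : continuous (fun x : R => 1 + cos x).
  by move=> x; apply: cvgD; [exact: cvg_cst|exact: continuous_cos].
have c0 (x : R) : 0 <= 1 + cos x.
  by have := cos_max x; rewrite ler_norml => /andP[? _]; rewrite -lerBlDl sub0r.
have i1 : P.-integrable setT (EFin \o (fun w => cos (\sum_i a i * y i w))).
  apply: (@integrable_bounded1 _ _ _ _ 1) => [|x]; last exact: cos_max.
  apply: measurableT_comp; last exact: measurable_lin.
  by apply: continuous_measurable_fun; exact: continuous_cos.
have i2 : N01.-integrable setT (EFin \o (fun x => cos (Num.sqrt v * x))).
  apply: (@integrable_bounded1 _ _ (normal_prob 0 1) _ 1) => [|x]; last exact: cos_max.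
  apply: measurableT_comp; last exact: measurable_funM.
  by apply: continuous_measurable_fun; exact: continuous_cos.
have := hy a _ ccos c0; move/(congr1 fine).
rewrite [LHS](@RintegralD _ _ _ P setT (cst 1) (fun w => cos (\sum_i a i * y i w)))//; last exact: finite_measure_integrable_cst.
rewrite [RHS](@RintegralD _ _ _ (normal_prob 0 1) setT (cst 1) (fun x => cos (Num.sqrt v * x)))//; last first.
  exact: (@finite_measure_integrable_cst _ _ _ (normal_prob 0 1)).
rewrite (Rintegral_prob1 P) (Rintegral_prob1 (normal_prob 0 1)) => /addrI ->.
by rewrite normal_cos sqr_sqrtr.
Qed.

Lemma sum_sqr_update n (a : 'I_n -> R) (i : 'I_n) (b : R) : a i = 0 ->
  \sum_j (a j + b *+ (j == i)) ^+ 2 = \sum_j a j ^+ 2 + b ^+ 2.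
Proof.
move=> ai; rewrite (bigD1 i)//= [in RHS](bigD1 i)//= eqxx ai expr0n add0r addrC !add0r.
congr (_ + _); apply: eq_bigr => j /negbTE ->; by rewrite addr0.
Qed.

Lemma sum_lin_update n (y a : 'I_n -> R) (i : 'I_n) (b : R) :
  \sum_j (a j + b *+ (j == i)) * y j = \sum_j a j * y j + b * y i.
Proof.
under eq_bigr do rewrite mulrDl.
rewrite big_split/=; congr (_ + _); rewrite (bigD1 i)//= eqxx big1 ?addr0// => j /negbTE ->.
by rewrite mul0r.
Qed.

(* The Hubbard-Stratonovich identity exp (c y^2 / 2) = E exp (sqrt c x y), with
   x standard normal, turns the quadratic terms into linear ones one at a time;
   independence of the coordinates is never needed. *)
Lemma std_gaussian_exp_quad n (y : 'I_n -> T -> R) (c : 'I_n -> R) (s : seq 'I_n) :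
  std_gaussian y -> uniq s -> (forall i, i \in s -> 0 <= c i < 1) ->
  forall a : 'I_n -> R, (forall i, i \in s -> a i = 0) ->
  (\int[P]_w (expR (\sum_(i <- s) c i / 2 * y i w ^+ 2 + \sum_i a i * y i w))%:E =
   (\prod_(i <- s) (Num.sqrt (1 - c i))^-1 * expR ((\sum_i a i ^+ 2) / 2))%:E)%E.
Proof.
move=> hy; have [my _] := hy; elim: s => [|i s IH] /=.
  move=> _ _ a _; rewrite big_nil mul1r -(std_gaussian_mgf a hy).
  by apply: eq_integral => w _; rewrite big_nil add0r.
move=> /andP[si us] cs a as0.
have cs' j : j \in s -> 0 <= c j < 1 by move=> js; apply: cs; rewrite inE js orbT.
have /andP[ci0 ci1] := cs i (mem_head _ _).
have ai : a i = 0 by apply: as0; rewrite mem_head.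
pose r := Num.sqrt (c i).
pose h (z : T * R) := expR (\sum_(j <- s) c j / 2 * y j z.1 ^+ 2 +
  \sum_j a j * y j z.1 + r * z.2 * y i z.1).
have my1 j : measurable_fun setT (fun z : T * measurableTypeR R => y j z.1).
  exact: (measurableT_comp (my j) measurable_fst).
have mh : measurable_fun setT (EFin \o h : T * measurableTypeR R -> \bar R).
  apply/measurable_EFinP; apply: measurableT_comp => //.
  apply: measurable_funD; [apply: measurable_funD|].
  - exact: (measurable_quad s (fun j => c j / 2) my1).
  - exact: (measurable_lin a my1).
  - apply: measurable_funM; last exact: (my1 i).
    by apply: measurable_funM => //; exact: measurable_snd.
have h0 z : (0 <= (EFin \o h) z)%E by rewrite lee_fin expR_ge0.
have := @fubini_tonelli _ _ T (measurableTypeR R) R P (normal_prob 0 1) _ mh h0.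
have -> : (\int[P]_x \int[normal_prob 0 1]_x0 (EFin \o h) (x, x0) =
    \int[P]_w (expR (\sum_(j <- i :: s) c j / 2 * y j w ^+ 2 + \sum_j a j * y j w))%:E)%E.
  apply: eq_integral => w _; rewrite /= /h /=.
  under eq_integral do rewrite expRD EFinM.
  rewrite ge0_integralZl ?lee_fin ?expR_ge0//; first last.
  - by apply/measurable_EFinP; apply: measurableT_comp => //; apply: measurable_funM => //; exact: measurable_funM.
  under eq_integral do rewrite mulrAC.
  rewrite normal_mgf -EFinM -expRD big_cons exprMn sqr_sqrtr//; congr (expR _)%:E; ring.
have -> : (\int[normal_prob 0 1]_y0 \int[P]_x (EFin \o h) (x, y0) =
   \int[normal_prob 0 1]_x ((\prod_(j <- s) (Num.sqrt (1 - c j))^-1 * expR ((\sum_j a j ^+ 2) / 2))%:E * (expR (c i / 2 * x ^+ 2))%:E))%E.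
  apply: eq_integral => x _.
  have ha' j : j \in s -> a j + (r * x) *+ (j == i) = 0.
    move=> js; rewrite as0 ?inE ?js ?orbT// add0r; case: eqVneq => // ji.
    by move: si; rewrite -ji js.
  have := IH us cs' _ ha'; rewrite sum_sqr_update// => IH'.
  transitivity (\int[P]_w (expR (\sum_(j <- s) c j / 2 * y j w ^+ 2 +
      \sum_j (a j + (r * x) *+ (j == i)) * y j w))%:E)%E.
    by apply: eq_integral => w _; rewrite sum_lin_update addrA.
  rewrite IH' -EFinM; congr EFin; rewrite -[RHS]mulrA -expRD; congr (_ * expR _).
  rewrite exprMn sqr_sqrtr//; ring.
rewrite ge0_integralZl; first last.
- by rewrite lee_fin mulr_ge0 ?expR_ge0// prodr_ge0// => j _; rewrite invr_ge0 sqrtr_ge0.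
- by move=> x _; rewrite lee_fin expR_ge0.
- by apply/measurable_EFinP; apply: measurableT_comp => //; apply: measurable_funM => //; exact: measurable_funX.
- by [].
by rewrite normal_exp_square// => ->; rewrite -EFinM big_cons; congr EFin; ring.
Qed.

(** For nonpositive c the linearization is exp(c y^2 / 2) = E cos(sqrt(- c) x y). The integrand is
    now signed, so Fubini's theorem relies on the bound by 1, which holds because the exponentials
    have nonpositive exponents. *)
Lemma std_gaussian_cos_quad n (y : 'I_n -> T -> R) (c : 'I_n -> R) (s : seq 'I_n) :
  std_gaussian y -> uniq s -> (forall i, i \in s -> c i <= 0) ->
  forall a : 'I_n -> R, (forall i, i \in s -> a i = 0) ->
  \int[P]_w (expR (\sum_(i <- s) c i / 2 * y i w ^+ 2) * cos (\sum_i a i * y i w)) =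
   \prod_(i <- s) (Num.sqrt (1 - c i))^-1 * expR (- ((\sum_i a i ^+ 2) / 2)).
Proof.
move=> hy; have [my _] := hy; elim: s => [|i s IH] /=.
  move=> _ _ a _; rewrite big_nil mul1r -(std_gaussian_cos a hy).
  by apply: eq_Rintegral => w _; rewrite big_nil expR0 mul1r.
move=> /andP[si us] cs a as0.
have cs' j : j \in s -> c j <= 0 by move=> js; apply: cs; rewrite inE js orbT.
have ci0 := cs i (mem_head _ _).
have ai : a i = 0 by apply: as0; rewrite mem_head.
pose r := Num.sqrt (- c i).
have r2 : r ^+ 2 = - c i by rewrite sqr_sqrtr// oppr_ge0.
pose Q w := expR (\sum_(j <- s) c j / 2 * y j w ^+ 2).
have mQ : measurable_fun setT Q by apply: measurableT_comp => //; exact: measurable_quad.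
have Q1 w : 0 <= Q w <= 1.
  rewrite expR_ge0/= -expR0 ler_expR; rewrite big_seq sumr_le0// => j js.
  by rewrite mulr_le0_ge0 ?sqr_ge0// pmulr_lle0// cs'.
have mcos' : measurable_fun setT (cos : R -> R).
  by apply: continuous_measurable_fun; exact: continuous_cos.
have bd (q u v : R) : 0 <= q <= 1 -> `|q * (cos u * cos v)| <= 1.
  move=> /andP[q0 q1]; rewrite !normrM (ger0_norm q0).
  by rewrite mulr_ile1// ?mulr_ge0// mulr_ile1// cos_max.
pose h (z : T * R) := Q z.1 * (cos (\sum_j a j * y j z.1) * cos (r * y i z.1 * z.2)).
have my1 j : measurable_fun setT (fun z : T * measurableTypeR R => y j z.1).
  exact: (measurableT_comp (my j) measurable_fst).
have mh : measurable_fun setT (h : T * measurableTypeR R -> R).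
  apply: measurable_funM; last apply: measurable_funM.
  - by apply: measurableT_comp => //; exact: (measurable_quad s (fun j => c j / 2) my1).
  - by apply: measurableT_comp => //; exact: (measurable_lin a my1).
  - apply: measurableT_comp => //; apply: measurable_funM; last exact: measurable_snd.
    by apply: measurable_funM => //; exact: (my1 i).
have ih : (P \x (normal_prob 0 1))%E.-integrable setT (EFin \o h : T * measurableTypeR R -> \bar R).
  apply/integrable12ltyP; first exact/measurable_EFinP.
  apply: (@le_lt_trans _ _ (\int[P]_x \int[normal_prob 0 1]_(y in [set: measurableTypeR R]) 1)%E); last first.
    under eq_integral do rewrite integral_cst// mul1e.
    rewrite integral_cst//= [X in (X * _)%E](_ : _ = 1%E) ?mul1e.
      by rewrite [X in (X < _)%E](_ : _ = 1%E) ?ltry//; exact: (probability_setT P).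
    exact: (probability_setT (normal_prob 0 1)).
  have mah : measurable_fun setT (fun z : T * measurableTypeR R => `|(h z)%:E|%E).
    by apply: measurableT_comp => //; exact/measurable_EFinP.
  apply: ge0_le_integral => //.
  - by move=> x _; apply: integral_ge0 => z _; exact: abse_ge0.
  - exact: (@measurable_fun_fubini_tonelli_F _ _ T (measurableTypeR R) R (normal_prob 0 1) _ mah).
  - move=> x _; apply: ge0_le_integral => //.
    + by apply: measurableT_comp mah _; exact: measurable_pair1.
    + by move=> z _; rewrite lee_fin; apply: bd; exact: Q1.
have fineI d' (T' : measurableType d') (N : probability T' R) (f : T' -> R) :
    N.-integrable setT (EFin \o f) -> (\int[N]_x (f x)%:E = (\int[N]_x f x)%:E)%E.
  by move=> fi; rewrite /Rintegral fineK//; exact: integrable_fin_num.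
have := @Fubini _ _ T (measurableTypeR R) R P (normal_prob 0 1) _ ih.
move/(congr1 fine).
have -> : (\int[P]_x \int[normal_prob 0 1]_y0 (EFin \o h) (x, y0) =
    \int[P]_w (expR (\sum_(j <- i :: s) c j / 2 * y j w ^+ 2) * cos (\sum_j a j * y j w))%:E)%E.
  apply: eq_integral => w _.
  rewrite /= (@fineI _ (measurableTypeR R) (normal_prob 0 1) (fun x => h (w, x))); last first.
    apply: (@integrable_bounded1 _ (measurableTypeR R) (normal_prob 0 1) _ 1) => [|x].
      by apply: (measurableT_comp mh); exact: measurable_pair1.
    by apply: bd; exact: Q1.
  rewrite /h /=; congr EFin.
  under eq_Rintegral do rewrite mulrA.
  rewrite RintegralZl//; last first.
    apply: (@integrable_bounded1 _ (measurableTypeR R) (normal_prob 0 1) _ 1) => [|x]; last exact: cos_max.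
    by apply: measurableT_comp => //; exact: measurable_funM.
  rewrite normal_cos mulrAC big_cons expRD /Q; congr (_ * _); rewrite mulrC; congr (expR _ * _).
  rewrite exprMn r2; by field.
move=> fub; transitivity (fine (\int[normal_prob 0 1]_x ((\prod_(j <- s) (Num.sqrt (1 - c j))^-1 * expR (- ((\sum_j a j ^+ 2) / 2)))%:E * (expR (c i / 2 * x ^+ 2))%:E))%E); last first.
  rewrite ge0_integralZl; first last.
  - by rewrite lee_fin mulr_ge0 ?expR_ge0// prodr_ge0// => j _; rewrite invr_ge0 sqrtr_ge0.
  - by move=> x _; rewrite lee_fin expR_ge0.
  - by apply/measurable_EFinP; apply: measurableT_comp => //; apply: measurable_funM => //; exact: measurable_funX.
  - by [].
  rewrite normal_exp_square ?(le_lt_trans ci0)// -EFinM big_cons /=; ring.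
rewrite /Rintegral fub; congr fine.
  apply: eq_integral => x _.
  have IHb (b : R) : b ^+ 2 = (r * x) ^+ 2 ->
      \int[P]_w (Q w * cos (\sum_j a j * y j w + b * y i w)) =
      \prod_(j <- s) (Num.sqrt (1 - c j))^-1 * expR (- ((\sum_j a j ^+ 2 + (r * x) ^+ 2) / 2)).
    move=> b2; have ha' j : j \in s -> a j + b *+ (j == i) = 0.
      move=> js; rewrite as0 ?inE ?js ?orbT// add0r; case: eqVneq => // ji.
      by move: si; rewrite -ji js.
    have := IH us cs' _ ha'; rewrite sum_sqr_update// b2 => <-.
    by apply: eq_Rintegral => w _; rewrite sum_lin_update.
  have iQ (b : R) : P.-integrable setT (EFin \o (fun w => Q w * cos (\sum_j a j * y j w + b * y i w))).
    apply: (@integrable_bounded1 _ _ _ _ 1) => [|w].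
      apply: measurable_funM => //; apply: measurableT_comp => //.
      apply: measurable_funD; [exact: measurable_lin|exact: measurable_funM].
    by have := bd (Q w) (\sum_j a j * y j w + b * y i w) 0 (Q1 w); rewrite cos0 mulr1.
  rewrite /= (@fineI _ T P (fun w => h (w, x))); last first.
    apply: (@integrable_bounded1 _ _ _ _ 1) => [|w].
      by apply: (measurableT_comp mh); exact: measurable_pair2.
    by apply: bd; exact: Q1.
  (* The product formula for two cosines gives back single cosines of linear forms, to which the
     induction hypothesis applies with both signs of the new coefficient. *)
  transitivity ((\int[P]_w (2^-1 * (Q w * cos (\sum_j a j * y j w + (r * x) * y i w) +
      Q w * cos (\sum_j a j * y j w + (- (r * x)) * y i w))))%:E).
    congr EFin; apply: eq_Rintegral => w _; rewrite /h /=.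
    by rewrite mulNr mulrAC cosD cosB; field.
  rewrite RintegralZl//; last exact: (@integrableD _ T R P setT measurableT _ _ (iQ (r * x)) (iQ (- (r * x)))).
  rewrite RintegralD// !IHb ?sqrrN// -EFinM; congr EFin.
  rewrite -[RHS]mulrA -expRD exprMn r2 (_ : - _ + _ = - ((\sum_j a j ^+ 2 + - c i * x ^+ 2) / 2)); last by field.
  by field.
Qed.

End standard_gaussian.

(** * Tails of Gaussian linear and quadratic forms *)

Section gaussian_tails.
Context {R : realType} d (T : measurableType d) (P : probability T R).

Lemma measurable_gt_cst (g : T -> R) (s : R) : measurable_fun setT g ->
  measurable [set w | s < g w].
Proof.
move=> mg; have := mg measurableT `]s, +oo[%classic (measurable_itv _).
by rewrite setTI (_ : _ @^-1` _ = [set w | s < g w])//; apply/seteqP; split => w /=; rewrite in_itv/= andbT.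
Qed.

Lemma measurable_lt_cst (g : T -> R) (s : R) : measurable_fun setT g ->
  measurable [set w | g w < s].
Proof.
move=> mg; have := mg measurableT `]-oo, s[%classic (measurable_itv _).
by rewrite setTI (_ : _ @^-1` _ = [set w | g w < s])//; apply/seteqP; split => w /=; rewrite in_itv.
Qed.

Lemma ln_sqrtr (x : R) : 0 < x -> ln (Num.sqrt x) = ln x / 2.
Proof.
move=> x0; rewrite -{2}(@sqr_sqrtr _ x) ?ltW// lnXn ?sqrtr_gt0//.
by rewrite mulr2n; field.
Qed.

Lemma ln_prod (I : Type) (s : seq I) (f : I -> R) : (forall i, 0 < f i) ->
  ln (\prod_(i <- s) f i) = \sum_(i <- s) ln (f i).
Proof.
move=> f0; rewrite -[RHS]expRK expR_sum; congr ln; apply: eq_bigr => i _.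
by rewrite lnK// posrE.
Qed.

Lemma markov_expR (g : T -> R) (K s : R) : measurable_fun setT g ->
  (\int[P]_w (expR (g w))%:E <= K%:E)%E ->
  (P [set w | (s < g w)%R] <= (K * expR (- s))%:E)%E.
Proof.
move=> mg gK; set A := [set w | s < g w].
have mA : measurable A.
  exact: measurable_gt_cst.
have mexpg : measurable_fun setT (fun w => (expR (g w))%:E).
  by apply/measurable_EFinP; exact: measurableT_comp.
have : ((expR s)%:E * P A <= K%:E)%E.
  apply: le_trans gK.
  rewrite -integral_cst//.
  apply: (@le_trans _ _ (\int[P]_(w in A) (expR (g w))%:E)%E).
    apply: ge0_le_integral => //.
    - by move=> w _; rewrite lee_fin expR_ge0.
    - exact: measurable_funTS.
    - by move=> w; rewrite lee_fin ler_expR => /ltW.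
  apply: ge0_subset_integral => //.
have PAf : P A \is a fin_num by exact: fin_num_measure.
rewrite -(fineK PAf) -EFinM !lee_fin expRN ler_pdivlMr ?expR_gt0//.
by rewrite [in X in _ -> X]mulrC.
Qed.

(** Markov's inequality at the fixed exponent 1, for both signs. The resulting exponential tail
    already beats the polynomial union bounds made from it. *)
Lemma std_gaussian_tail n (y : 'I_n -> T -> R) (a : 'I_n -> R) (s : R) :
  std_gaussian P y -> \sum_i a i ^+ 2 <= 1 ->
  (P [set w | (s < `|\sum_i a i * y i w|)%R] <= (2 * expR (2^-1 - s))%:E)%E.
Proof.
move=> hy a1; have [my _] := hy.
have half (b : 'I_n -> R) : \sum_i b i ^+ 2 <= 1 ->
    (P [set w | (s < \sum_i b i * y i w)%R] <= (expR (2^-1 - s))%:E)%E.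
  move=> b1; rewrite expRD; apply: markov_expR; first exact: measurable_lin.
  by rewrite std_gaussian_mgf// lee_fin ler_expR; lra.
have mb (b : 'I_n -> R) : measurable [set w | (s < \sum_i b i * y i w)%R].
  by apply: measurable_gt_cst; exact: measurable_lin.
have h2 := half (fun i => - a i); have h1 := half a a1.
apply: (@le_trans _ _ (P ([set w | (s < \sum_i a i * y i w)%R] `|`
    [set w | (s < \sum_i (- a i) * y i w)%R]))).
  apply: le_measure; rewrite ?inE.
  - apply: measurable_gt_cst.
    by apply: measurableT_comp => //; exact: measurable_lin.
  - by apply: measurableU; exact: mb.
  move=> w /=; under [in X in _ \/ X]eq_bigr do rewrite mulNr.
  by rewrite sumrN lter_normr => /orP[]; [left|right].
apply: (le_trans (measureU2 _ (mb _) (mb _))).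
rewrite mulrDl mul1r EFinD leeD//; apply: h2.
by under eq_bigr do rewrite sqrrN.
Qed.

Lemma std_gaussian_exp_neg_quad n (y : 'I_n -> T -> R) (c : 'I_n -> R) (s : seq 'I_n) :
  std_gaussian P y -> uniq s -> (forall i, i \in s -> c i <= 0) ->
  (\int[P]_w (expR (\sum_(i <- s) c i / 2 * y i w ^+ 2))%:E =
   (\prod_(i <- s) (Num.sqrt (1 - c i))^-1)%:E)%E.
Proof.
move=> hy us cs; have [my _] := hy.
have := @std_gaussian_cos_quad _ _ _ P n y c s hy us cs (fun=> 0) (fun _ _ => erefl).
rewrite [X in expR X](_ : _ = 0) ?expR0 ?mulr1; last first.
  by rewrite big1 ?mul0r ?oppr0// => i _; rewrite expr0n.
move=> <-; rewrite /Rintegral fineK.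
  apply: eq_integral => w _; rewrite (_ : \sum_i 0 * y i w = 0) ?cos0 ?mulr1//.
  by rewrite big1// => i _; rewrite mul0r.
apply: integrable_fin_num => //.
apply: (@integrable_bounded1 _ _ _ _ _ 1) => [|w].
  apply: measurable_funM.
    by apply: measurableT_comp => //; exact: measurable_quad.
  apply: measurableT_comp; last exact: measurable_lin.
  by apply: continuous_measurable_fun; exact: continuous_cos.
rewrite normrM mulr_ile1 ?cos_max// ger0_norm ?expR_ge0//.
rewrite -expR0 ler_expR big_seq sumr_le0// => j js.
by rewrite mulr_le0_ge0 ?sqr_ge0// pmulr_lle0// cs.
Qed.

(** The sum is - 2 times a log likelihood ratio, with l the relative eigenvalues: each exp(- F i /
    2) is a ratio of normal densities. If the sum is below - t, one of its two parts by sign is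
    below - t / 2, and halving the exponent leaves t / 4. *)
Lemma std_gaussian_quad_tail n (y : 'I_n -> T -> R) (l : 'I_n -> R) (t : R) :
  std_gaussian P y -> (forall i, 0 < l i) ->
  (P [set w | (\sum_i (ln (l i) + ((l i)^-1 - 1) * y i w ^+ 2) < - t)%R] <=
    (2 * expR (- (t / 4)))%:E)%E.
Proof.
move=> hy l0; have [my _] := hy.
pose c i := 1 - (l i)^-1.
pose F i w := ln (l i) + ((l i)^-1 - 1) * y i w ^+ 2.
have mF i : measurable_fun setT (F i).
  by apply: measurable_funD => //; apply: measurable_funM => //; exact: measurable_funX.
have [sp [sn [eqs [us [un [hp hn]]]]]] : exists sp sn : seq 'I_n,
    (forall G : 'I_n -> R, \sum_i G i = \sum_(i <- sp) G i + \sum_(i <- sn) G i) /\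
    (uniq sp /\ uniq sn /\ (forall i, i \in sp -> 0 <= c i < 1) /\ forall i, i \in sn -> c i <= 0).
  exists [seq i <- enum 'I_n | 0 <= c i], [seq i <- enum 'I_n | ~~ (0 <= c i)].
  split; first by move=> G; rewrite !big_filter !big_enum_cond [LHS](bigID (fun i => 0 <= c i)).
  do 2 (split; first by rewrite filter_uniq// enum_uniq); split => i; rewrite mem_filter => /andP[ci _].
    by rewrite ci /c ltrBlDr ltrDl invr_gt0 l0.
  by rewrite ltW// ltNge.
have half s : (\int[P]_w (expR (\sum_(i <- s) c i / 2 * y i w ^+ 2))%:E =
   (\prod_(i <- s) (Num.sqrt (1 - c i))^-1)%:E)%E ->
   (P [set w | (t / 4 < \sum_(i <- s) (- 2^-1) * F i w)%R] <= (expR (- (t / 4)))%:E)%E.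
  move=> hs; rewrite -[expR _]mul1r; apply: markov_expR.
    by apply: measurable_sum => i; exact: measurable_funM.
  rewrite le_eqVlt; apply/orP; left; apply/eqP.
  transitivity (\int[P]_w ((\prod_(i <- s) (Num.sqrt (l i))^-1)%:E * (expR (\sum_(i <- s) c i / 2 * y i w ^+ 2))%:E))%E.
    apply: eq_integral => w _; rewrite -EFinM; congr EFin.
    elim: s {hs} => [|i s IH]; first by rewrite !big_nil mul1r.
    rewrite !big_cons !expRD IH [RHS]mulrACA; congr (_ * _).
    rewrite -[Num.sqrt _]lnK ?posrE ?sqrtr_gt0// -expRN -expRD; congr expR.
    rewrite /F /c ln_sqrtr//; field; by rewrite gt_eqF ?l0.
  rewrite ge0_integralZl ?lee_fin//; first last.
  - by rewrite prodr_ge0// => i _; rewrite invr_ge0.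
  - by apply/measurable_EFinP; apply: measurableT_comp => //; exact: measurable_quad.
  rewrite hs -EFinM -big_split/= big1// => i _.
  rewrite /c opprB addrC subrK sqrtrV ?ltW// invrK mulVf// gt_eqF// sqrtr_gt0//.
have hP := half sp; have hN := half sn.
have mb s : measurable [set w | (t / 4 < \sum_(i <- s) (- 2^-1) * F i w)%R].
  by apply: measurable_gt_cst; apply: measurable_sum => i; exact: measurable_funM.
apply: (@le_trans _ _ (P ([set w | (t / 4 < \sum_(i <- sp) (- 2^-1) * F i w)%R] `|`
    [set w | (t / 4 < \sum_(i <- sn) (- 2^-1) * F i w)%R]))).
  apply: le_measure; rewrite ?inE.
  - by apply: measurable_lt_cst; apply: measurable_sum => i; exact: mF.
  - by apply: measurableU; exact: mb.
  move=> w /=; rewrite (eqs (F ^~ w)) -!mulr_sumr => h.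
  have [h1|h1] := ltP (t / 4) (- 2^-1 * \sum_(i <- sp) F i w); first by left.
  by right; lra.
apply: (le_trans (measureU2 _ (mb _) (mb _))).
rewrite mulrDl mul1r EFinD leeD//.
- apply: hP.
  have := @std_gaussian_exp_quad _ _ _ P n y c sp hy us hp (fun=> 0) (fun _ _ => erefl).
  rewrite [X in _ * expR X](_ : _ = 0) ?expR0 ?mulr1; last first.
    by rewrite big1 ?mul0r// => i _; rewrite expr0n.
  move=> <-; apply: eq_integral => w _.
  by rewrite [X in _ + X]big1 ?addr0// => i _; rewrite mul0r.
- by apply: hN; exact: std_gaussian_exp_neg_quad.
Qed.

End gaussian_tails.

Section gaussian_vector_tails.
Context {R : realType} d (T : measurableType d) (P : probability T R).

Lemma measurable_mulmx n (Z : T -> 'cV[R]_n) (m : 'cV[R]_n) (A : 'M[R]_n) i :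
  (forall i, measurable_fun setT (fun w => Z w i 0)) ->
  measurable_fun setT (fun w => (A *m (Z w - m)) i 0).
Proof.
move=> mZ; rewrite (_ : (fun w => _) = fun w => \sum_j A i j * (Z w j 0 - m j 0)).
  by apply: measurable_sum => j; apply: measurable_funM => //; exact: measurable_funB.
by apply/funext => w; rewrite mxE; apply: eq_bigr => j _; rewrite !mxE.
Qed.

(** Each direction is rescaled to variance 1, so that [normal_law] becomes [normal_prob] with
    standard deviation 1. The zero direction, which cannot be rescaled, gives the constant f 0 on
    both sides. *)
Lemma gaussian_vector_std n (Z : T -> 'cV[R]_n) (m : 'cV[R]_n) (S A : 'M[R]_n) :
  gaussian_vector P Z m S -> A *m S *m A^T = 1%:M ->
  std_gaussian P (fun i w => (A *m (Z w - m)) i 0).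
Proof.
move=> [mZ hZ] AS; split; first by move=> i; exact: measurable_mulmx.
move=> a f cf f0; set v := \sum_i a i ^+ 2.
have v0 : 0 <= v by rewrite sumr_ge0// => i _; exact: sqr_ge0.
pose ac : 'cV[R]_n := \col_i a i.
have aE w : \sum_i a i * (A *m (Z w - m)) i 0 = ((A^T *m ac)^T *m (Z w - m)) 0 0.
  rewrite trmx_mul trmxK -mulmxA [RHS]mxE; apply: eq_bigr => i _.
  by rewrite [ac^T _ _]mxE [ac _ _]mxE.
have [v00|vn0] := eqVneq v 0.
  have a0 i : a i = 0.
    apply/eqP; rewrite -sqrf_eq0; move/eqP: v00; rewrite psumr_eq0 => [/allP h|j _]; last exact: sqr_ge0.
    by have := h i; rewrite mem_index_enum; apply.
  rewrite v00 sqrtr0.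
  transitivity (\int[P]_w (f 0)%:E)%E.
    by apply: eq_integral => w _; rewrite big1// => i _; rewrite a0 mul0r.
  transitivity (\int[normal_prob 0 1]_x (f 0)%:E)%E; last first.
    by apply: eq_integral => x _; rewrite mul0r.
  rewrite !integral_cst//; congr (_ * _)%E.
  transitivity (1%E : \bar R); first exact: (probability_setT P).
  by apply/esym; exact: (probability_setT (normal_prob 0 1)).
have vp : 0 < v by rewrite lt_def vn0.
have sv0 : Num.sqrt v != 0 by rewrite gt_eqF// sqrtr_gt0.
pose b := (Num.sqrt v)^-1 *: (A^T *m ac).
have bT : b^T = (Num.sqrt v)^-1 *: (A^T *m ac)^T by rewrite /b linearZ.
have bS : (b^T *m S *m b) 0 0 = 1.
  rewrite bT /b -!scalemxAl -scalemxAr scalerA trmx_mul trmxK.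
  rewrite -!mulmxA [S *m _]mulmxA [A *m _]mulmxA [A *m _]mulmxA AS mul1mx !mxE -expr2 exprVn sqr_sqrtr//.
  rewrite (_ : \sum_i _ = v) ?mulVf//; apply: eq_bigr => i _; by rewrite !mxE expr2.
pose phi w := (b^T *m Z w) 0 0.
have mphi : measurable_fun setT phi.
  rewrite (_ : phi = fun w => \sum_j b j 0 * Z w j 0).
    by apply: measurable_sum => j; apply: measurable_funM.
  by apply/funext => w; rewrite /phi mxE; apply: eq_bigr => j _; rewrite !mxE.
pose mu0 := (b^T *m m) 0 0.
pose F x := f (Num.sqrt v * (x - mu0)).
have cF : continuous F.
  move=> x; apply: (@continuous_comp _ _ _ (fun x => Num.sqrt v * (x - mu0)) f); last exact: cf.
  by apply: cvgM; [exact: cvg_cst|apply: cvgB; [exact: cvg_id|exact: cvg_cst]].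
transitivity (\int[P]_w (F (phi w))%:E)%E.
  apply: eq_integral => w _; rewrite aE /F /phi /mu0; congr (f _)%:E.
  rewrite (_ : _ - _ = (b^T *m (Z w - m)) 0 0); last by rewrite mulmxBr [RHS]mxE; congr (_ + _); rewrite [RHS]mxE.
  by rewrite bT -scalemxAl [X in _ = _ * X]mxE mulrA mulfV// mul1r.
have mF : measurable_fun setT (EFin \o F).
  by apply/measurable_EFinP; exact: continuous_measurable_fun.
have F0 : {in [set: measurableTypeR R], forall x, (0 <= (EFin \o F) x)%E}.
  by move=> x _; rewrite lee_fin; exact: f0.
rewrite -[LHS](@ge0_integral_pushforward _ _ T (measurableTypeR R) R phi mphi P setT (EFin \o F) measurableT mF F0).
transitivity (\int[normal_prob mu0 1]_x (F x)%:E)%E.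
  apply: eq_measure_integral => B mB _.
  by have := hZ b B mB; rewrite /normal_law bS oner_eq0 sqrtr1.
rewrite integral_normal_prob_shift//; last by move=> x; exact: f0.
by apply: eq_integral => x _; rewrite /F addrK.
Qed.

Lemma gaussian_vector_tail n (Z : T -> 'cV[R]_n) (m a : 'cV[R]_n) (S : 'M[R]_n) (V s : R) :
  gaussian_vector P Z m S -> posdef S -> 0 < V -> qform S a <= V ->
  (P [set w | (s * Num.sqrt V < `|(a^T *m (Z w - m)) 0 0|)%R] <= (2 * expR (2^-1 - s))%:E)%E.
Proof.
move=> hZ pS V0 aV.
(* Pairing S with itself is a way to obtain a whitening matrix. *)
have [A [l [uA _ [AS _ _ _ _]]]] := posdef_pair pS pS.
have hy := gaussian_vector_std hZ AS.
have sV : 0 < Num.sqrt V by rewrite sqrtr_gt0.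
pose b : 'cV[R]_n := (Num.sqrt V)^-1 *: ((invmx A)^T *m a).
have SE : S = invmx A *m (invmx A)^T.
  rewrite -[LHS](mulKmx uA) -[A *m S](mulmxK (_ : A^T \in unitmx)) ?unitmx_tr//.
  by rewrite AS mul1mx trmx_inv.
have bb : \sum_i b i 0 ^+ 2 <= 1.
  rewrite -qform1 /qform mulmx1.
  have bT : b^T = (Num.sqrt V)^-1 *: (a^T *m invmx A) by rewrite /b linearZ /= trmx_mul trmxK.
  rewrite bT /b -scalemxAl -scalemxAr scalerA mulmxA -[a^T *m invmx A *m _]mulmxA -SE mxE.
  rewrite -expr2 exprVn sqr_sqrtr; last exact: ltW.
  by rewrite ler_pdivrMl ?mulr1.
have := std_gaussian_tail s hy bb.
rewrite (_ : [set w | s < _] = [set w | s * Num.sqrt V < `|(a^T *m (Z w - m)) 0 0|])//.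
apply/seteqP; suff E w : (s < `|\sum_i b i 0 * (A *m (Z w - m)) i 0|) =
  (s * Num.sqrt V < `|(a^T *m (Z w - m)) 0 0|) by split => w /=; rewrite E.
rewrite (_ : \sum_i _ = (Num.sqrt V)^-1 * (a^T *m (Z w - m)) 0 0).
  by rewrite normrM ger0_norm ?invr_ge0 ?ltW// ltr_pdivlMl// mulrC.
transitivity ((b^T *m (A *m (Z w - m))) 0 0).
  by rewrite [RHS]mxE; apply: eq_bigr => i _; rewrite [b^T _ _]mxE.
have -> : b^T = (Num.sqrt V)^-1 *: (a^T *m invmx A) by rewrite /b linearZ /= trmx_mul trmxK.
by rewrite mulmxA -scalemxAl -mulmxA mulVmx// mulmx1 -scalemxAl mxE.
Qed.

Lemma gaussian_vector_loglik_tail n (Z : T -> 'cV[R]_n) (m : 'cV[R]_n) (S0 S : 'M[R]_n) (t : R) :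
  gaussian_vector P Z m S0 -> posdef S0 -> posdef S -> 0 < \det S0 ->
  (P [set w | (ln (\det S) - ln (\det S0) + qform (invmx S) (Z w - m)
       - qform (invmx S0) (Z w - m) < - t)%R] <= (2 * expR (- (t / 4)))%:E)%E.
Proof.
move=> hZ p0 pS d0.
have [A [l [uA lp [AS AS' dE q0 qS]]]] := posdef_pair p0 pS.
have hy := gaussian_vector_std hZ AS.
have := std_gaussian_quad_tail t hy lp.
suff E w : ln (\det S) - ln (\det S0) + qform (invmx S) (Z w - m) - qform (invmx S0) (Z w - m)
  = \sum_i (ln (l 0 i) + ((l 0 i)^-1 - 1) * (A *m (Z w - m)) i 0 ^+ 2).
  by under [in X in _ -> (P X <= _)%E]eq_set do rewrite E.
rewrite dE q0 qS lnM ?posrE//; last by apply: prodr_gt0.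
rewrite [ln (\det S0) + _]addrC addrK -addrA -sumrB.
rewrite ln_prod// -big_split/=; apply: eq_bigr => i _; ring.
Qed.

End gaussian_vector_tails.

(** * Perturbation of the likelihood *)

Section posdef_comparison.
Context {R : realType}.

Lemma posdef1 n : posdef (1%:M : 'M[R]_n).
Proof.
split; first exact: trmx1.
move=> x x0; rewrite qform1 lt_def sumr_ge0 => [|i _]; last exact: sqr_ge0.
rewrite andbT; apply: contra x0; rewrite psumr_eq0 => [/allP h|i _]; last exact: sqr_ge0.
apply/eqP/colP => i; rewrite [RHS]mxE; apply/eqP.
by move: (h i); rewrite mem_index_enum sqrf_eq0; apply.
Qed.

Lemma posdef_det_gt0 n (S : 'M[R]_n) : posdef S -> 0 < \det S.
Proof.
move=> pS; have [A [l [_ l0 [_ _ -> _ _]]]] := posdef_pair (posdef1 n) pS.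
by rewrite det1 mul1r prodr_gt0.
Qed.

(** These test vectors read off the relative eigenvalues, so an inequality between quadratic forms
    becomes one between numbers, where inversion is elementary. *)
Lemma qform_delta n (S S0 A : 'M[R]_n) (l : 'rV[R]_n) i :
  A *m S0 *m A^T = 1%:M -> A *m S *m A^T = diag_mx l ->
  qform S0 (A^T *m delta_mx i 0) = 1 /\ qform S (A^T *m delta_mx i 0) = l 0 i.
Proof.
move=> A0 AS; rewrite -!qform_ext A0 AS qform1 qform_diag.
by split; rewrite (bigD1 i)//= big1 ?addr0 ?mxE ?eqxx ?expr1n ?mulr1// => j ji;
  rewrite mxE (negbTE ji) expr0n ?mulr0.
Qed.

Lemma qform_inv_ge n (S0 S : 'M[R]_n) (c : R) : posdef S0 -> posdef S -> 0 < c ->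
  (forall x, qform S x <= c * qform S0 x) ->
  forall x, c^-1 * qform (invmx S0) x <= qform (invmx S) x.
Proof.
move=> p0 pS c0 h x; have [A [l [_ l0 [A0 AS _ q0 qS]]]] := posdef_pair p0 pS.
rewrite q0 qS mulr_sumr; apply: ler_sum => i _; apply: ler_wpM2r; first exact: sqr_ge0.
have [e0 eS] := qform_delta i A0 AS.
by rewrite lef_pV2 ?posrE//; have := h (A^T *m delta_mx i 0); rewrite e0 eS mulr1.
Qed.

Lemma qform_inv_le n (S0 S : 'M[R]_n) (c : R) : posdef S0 -> posdef S -> 0 < c ->
  (forall x, c * qform S0 x <= qform S x) ->
  forall x, qform (invmx S) x <= c^-1 * qform (invmx S0) x.
Proof.
move=> p0 pS c0 h x; have [A [l [_ l0 [A0 AS _ q0 qS]]]] := posdef_pair p0 pS.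
rewrite q0 qS mulr_sumr; apply: ler_sum => i _; apply: ler_wpM2r; first exact: sqr_ge0.
have [e0 eS] := qform_delta i A0 AS.
by rewrite lef_pV2 ?posrE//; have := h (A^T *m delta_mx i 0); rewrite e0 eS mulr1.
Qed.

(** The relative eigenvalues lie within eta of 1, so ln l >= - 2 eta, where eta <= 1/2 is used, and
    1 / l >= 1 - eta. *)
Lemma loglik_perturb n (S0 S : 'M[R]_n) (eta : R) (e : 'cV[R]_n) :
  posdef S0 -> posdef S -> 0 <= eta <= 2^-1 ->
  (forall x, `|qform S x - qform S0 x| <= eta * qform S0 x) ->
  ln (\det S0) + qform (invmx S0) e - n%:R * (2 * eta) - eta * qform (invmx S0) e <=
  ln (\det S) + qform (invmx S) e.
Proof.
move=> p0 pS /andP[eta0 eta2] h.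
have [A [l [_ l0 [A0 AS dE q0 qS]]]] := posdef_pair p0 pS.
have lb i : 1 - eta <= l 0 i <= 1 + eta.
  have [e0 eS] := qform_delta i A0 AS.
  by have := h (A^T *m delta_mx i 0); rewrite e0 eS mulr1 ler_distlC; lra.
rewrite dE lnM ?posrE ?posdef_det_gt0 ?prodr_gt0// ln_prod//.
have h1 : - (n%:R * (2 * eta)) <= \sum_i ln (l 0 i).
  rewrite (_ : - _ = \sum_(i < n) - (2 * eta)); last by rewrite sumr_const card_ord mulr_natl mulNrn.
  apply: ler_sum => i _.
  have /andP[li _] := lb i; have li0 := l0 i.
  have : ln (l 0 i)^-1 <= (l 0 i)^-1 - 1.
    by rewrite -[X in ln X](subrK 1) addrC; apply: le_ln1Dx; rewrite ltrBDl subrr invr_gt0.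
  rewrite lnV ?posrE// => h2.
  suff : (l 0 i)^-1 <= 1 + 2 * eta by lra.
  rewrite -[_^-1]mul1r ler_pdivrMr//.
  have : (1 + 2 * eta) * (1 - eta) <= (1 + 2 * eta) * l 0 i by apply: ler_wpM2l => //; lra.
  nra.
have h2 : qform (invmx S0) e - eta * qform (invmx S0) e <= qform (invmx S) e.
  rewrite q0 qS -{1}[\sum_i _]mul1r -mulrBl mulr_sumr; apply: ler_sum => i _.
  apply: ler_wpM2r; first exact: sqr_ge0.
  have /andP[_ li] := lb i.
  rewrite -[leRHS]mul1r ler_pdivlMr//.
  have : (1 - eta) * l 0 i <= (1 - eta) * (1 + eta) by apply: ler_wpM2l => //; lra.
  nra.
lra.
Qed.

End posdef_comparison.

(** * The correlation matrix of a first-order autoregression *)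

Section autoregressive.
Context {R : realType}.
Variables (n : nat) (rho : R).
Hypotheses (r0 : 0 < rho) (r1 : rho < 1).

(** Truncated subtraction makes one of the two terms 0, so this is |i - j|. *)
Definition ndist (i j : nat) : nat := ((i - j) + (j - i))%N.

Definition ar_mx : 'M[R]_n := \matrix_(i, j) rho ^+ ndist i j.

Lemma ar_row_sum (i : nat) : (1 - rho) * (\sum_(j < n) rho ^+ ndist i j) <= 2.
Proof.
(* The induction on the number of terms needs the geometric remainder: as long as i is not reached
   the sum is a piece of one geometric series, and past i a second, decreasing one is added. *)
suff : (1 - rho) * (\sum_(j < n) rho ^+ ndist i j) <=
    if (n <= i)%N then rho ^+ (i.+1 - n) else 2 - rho ^+ (n - i).
  move/le_trans; apply; case: ifP => _.
    by rewrite (le_trans (exprn_ile1 _ (ltW r0) (ltW r1)))// ler1n.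
  by rewrite gerBl exprn_ge0// ltW.
elim: (n) => [|k IH]; first by rewrite big_ord0 mulr0 leq0n exprn_ge0// ltW.
rewrite big_ord_recr/= mulrDr; case: (ltnP k i) => ki.
  rewrite (ltnW ki) in IH; rewrite (le_trans (lerD IH (lexx _)))//.
  rewrite /ndist (_ : (k - i = 0)%N) ?addn0; last by lia.
  rewrite (_ : (i.+1 - k = (i - k).+1)%N); last by lia.
  rewrite (_ : (i.+1 - k.+1 = i - k)%N); last by lia.
  by rewrite exprS; lra.
rewrite /ndist (_ : (i - k = 0)%N) ?add0n; last by lia.
rewrite (_ : (k.+1 - i = (k - i).+1)%N); last by lia.
move: IH; case: (leqP k i) => ki' IH.
  have -> : (k - i = 0)%N by lia.
  rewrite (le_trans (lerD IH (lexx _)))// (_ : (i.+1 - k = 1)%N); last by lia.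
  by rewrite !expr1 expr0 mulr1 addrC subrK lerBrDr -natr1 lerD2l ltW.
by rewrite (le_trans (lerD IH (lexx _)))// exprS; lra.
Qed.

Lemma ar_mx_sym : ar_mx^T = ar_mx.
Proof. by apply/matrixP => i j; rewrite !mxE /ndist addnC. Qed.

Lemma qform_arE (x : 'cV[R]_n) :
  qform ar_mx x = \sum_(i < n) \sum_(j < n) rho ^+ ndist i j * (x i 0 * x j 0).
Proof.
rewrite /qform -mulmxA mxE; apply: eq_bigr => i _; rewrite !mxE mulr_sumr.
by apply: eq_bigr => j _; rewrite !mxE; ring.
Qed.

(** Schur's test: with x_i x_j <= (x_i^2 + x_j^2) / 2, the largest row sum bounds the quadratic
    form. *)
Lemma qform_ar_le (x : 'cV[R]_n) :
  qform ar_mx x <= 2 / (1 - rho) * \sum_i x i 0 ^+ 2.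
Proof.
rewrite qform_arE.
have h : \sum_(i < n) \sum_(j < n) rho ^+ ndist i j * (x i 0 * x j 0) <=
    \sum_(i < n) \sum_(j < n) rho ^+ ndist i j * ((x i 0 ^+ 2 + x j 0 ^+ 2) / 2).
  apply: ler_sum => i _; apply: ler_sum => j _.
  apply: ler_wpM2l; first by rewrite exprn_ge0 ?ltW.
  by have := sqr_ge0 (x i 0 - x j 0); nra.
apply: le_trans h _.
have -> : \sum_(i < n) \sum_(j < n) rho ^+ ndist i j * ((x i 0 ^+ 2 + x j 0 ^+ 2) / 2) =
   \sum_(i < n) (\sum_(j < n) rho ^+ ndist i j) * x i 0 ^+ 2.
  transitivity (2^-1 * (\sum_(i < n) \sum_(j < n) rho ^+ ndist i j * x i 0 ^+ 2) +
     2^-1 * (\sum_(i < n) \sum_(j < n) rho ^+ ndist i j * x j 0 ^+ 2)).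
    rewrite -mulrDr -big_split mulr_sumr; apply: eq_bigr => i _ /=.
    rewrite -big_split mulr_sumr; apply: eq_bigr => j _ /=; ring.
  rewrite [X in _ + _ * X]exchange_big /=.
  have E : \sum_(j < n) \sum_(i < n) rho ^+ ndist i j * x j 0 ^+ 2 =
           \sum_(i < n) \sum_(j < n) rho ^+ ndist i j * x i 0 ^+ 2.
    by apply: eq_bigr => i _; apply: eq_bigr => j _; rewrite /ndist addnC.
  rewrite E -mulrDl (_ : 2^-1 + 2^-1 = 1 :> R) ?mul1r; last by field.
  apply: eq_bigr => i _; by rewrite mulr_suml.
rewrite mulr_sumr; apply: ler_sum => i _; apply: ler_wpM2r; first exact: sqr_ge0.
by rewrite ler_pdivlMr ?subr_gt0// mulrC ar_row_sum.
Qed.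

(** The innovations form of the autoregression: the first innovation has variance 1 and the others 1
    - rho^2. This factorization shows that the matrix is positive semidefinite. *)
Lemma ar_gram (i j : nat) : (i < n)%N -> (j < n)%N -> rho ^+ ndist i j =
  \sum_(k < n) (if k == 0%N :> nat then 1 else 1 - rho ^+ 2) *
    ((if (k <= i)%N then rho ^+ (i - k) else 0) * (if (k <= j)%N then rho ^+ (j - k) else 0)).
Proof.
wlog ij : i j / (i <= j)%N.
  move=> hw; case: (leqP i j) => [|/ltnW] ij ni nj; first exact: hw.
  rewrite /ndist addnC -/(ndist j i) hw//.
  by apply: eq_bigr => k _; rewrite [X in _ * X]mulrC.
move=> ni nj; rewrite /ndist (_ : (i - j = 0)%N) ?add0n; last by lia.
rewrite -(big_mkord xpredT (fun k => (if k == 0%N then 1 else 1 - rho ^+ 2) *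
  ((if (k <= i)%N then rho ^+ (i - k) else 0) * (if (k <= j)%N then rho ^+ (j - k) else 0)))).
rewrite (big_cat_nat (n := i.+1))//= [X in _ + X]big_nat_cond [X in _ + X]big1 ?addr0; last first.
  by move=> k /andP[/andP[ik _] _]; rewrite leqNgt ik/= mul0r mulr0.
have -> : \sum_(0 <= k < i.+1) (if k == 0%N then 1 else 1 - rho ^+ 2) *
  ((if (k <= i)%N then rho ^+ (i - k) else 0) * (if (k <= j)%N then rho ^+ (j - k) else 0)) =
  rho ^+ (j - i) * \sum_(0 <= k < i.+1) (if k == 0%N then 1 else 1 - rho ^+ 2) * (rho ^+ 2) ^+ (i - k).
  rewrite mulr_sumr; apply: eq_big_nat => k /andP[_ ki].
  rewrite ltnS in ki; rewrite ki (leq_trans ki ij).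
  rewrite (_ : (j - k = (j - i) + (i - k))%N); last by lia.
  by rewrite exprD -exprM mulnC exprM expr2; ring.
suff -> : \sum_(0 <= k < i.+1) (if k == 0%N then 1 else 1 - rho ^+ 2) * (rho ^+ 2) ^+ (i - k) = 1 by rewrite mulr1.
elim: (i) => [|m IH]; first by rewrite big_nat1 eqxx mul1r expr0.
rewrite big_nat_recr//= subnn expr0 mulr1.
rewrite (_ : \sum_(0 <= k < m.+1) _ = rho ^+ 2 * 1); first by ring.
rewrite -[X in _ = _ * X]IH mulr_sumr; apply: eq_big_nat => k /andP[_ km].
by rewrite subSn// (exprS (rho ^+ 2)) mulrCA.
Qed.

Lemma qform_ar_ge0 (x : 'cV[R]_n) : 0 <= qform ar_mx x.
Proof.
rewrite qform_arE.
pose c (k : nat) : R := if k == 0%N then 1 else 1 - rho ^+ 2.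
pose u (k i : nat) : R := if (k <= i)%N then rho ^+ (i - k) else 0.
rewrite (_ : \sum_i _ = \sum_(k < n) c k * (\sum_(i < n) u k i * x i 0) ^+ 2).
  apply: sumr_ge0 => k _; rewrite mulr_ge0 ?sqr_ge0// /c.
  by case: ifP => // _; rewrite subr_ge0 (exprn_ile1 _ (ltW r0) (ltW r1)).
transitivity (\sum_(i < n) \sum_(j < n) \sum_(k < n) c k * ((u k i * x i 0) * (u k j * x j 0))).
  apply: eq_bigr => i _; apply: eq_bigr => j _.
  rewrite (ar_gram (ltn_ord i) (ltn_ord j)) mulr_suml; apply: eq_bigr => k _.
  by rewrite /c /u; ring.
under eq_bigr do rewrite exchange_big/=.
rewrite exchange_big; apply: eq_bigr => k _ /=.
rewrite expr2 mulr_suml mulr_sumr; apply: eq_bigr => i _.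
rewrite mulr_sumr mulr_sumr; apply: eq_bigr => j _; ring.
Qed.

End autoregressive.

(** * The tridiagonal inverse and the shape of the scores *)

Section tridiagonal.
Context {R : realType}.
Variables (n : nat) (rho : R).
Hypotheses (r0 : 0 < rho) (r1 : rho < 1).

(* (1 - rho^2) times the inverse of [ar_mx n rho], for n > 1. *)
Definition tri_mx : 'M[R]_n := \matrix_(i, k)
  ((1 + rho ^+ 2 *+ ((0 < i) && (i.+1 < n))%N) *+ (i == k :> nat)
   - rho *+ (k.+1 == i :> nat) - rho *+ (k == i.+1 :> nat)).

Lemma tri_mx_sum (g : nat -> R) (i : 'I_n) :
  \sum_k tri_mx i k * g k = (1 + rho ^+ 2 *+ ((0 < i) && (i.+1 < n))%N) * g i
    - (rho * g i.-1) *+ (0 < i)%N - (rho * g i.+1) *+ (i.+1 < n)%N.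
Proof.
have pick (c : R) (h : nat) : \sum_(k < n) c *+ (k == h :> nat) * g k = (c * g h) *+ (h < n)%N.
  case: ltnP => hn.
    rewrite (bigD1 (Ordinal hn))//= eqxx big1 ?addr0// => k kh.
    by rewrite (_ : (k == h :> nat) = false) ?mul0r//; apply: contraNF kh => /eqP kh; apply/eqP/val_inj.
  by rewrite big1// => k _; rewrite (_ : (k == h :> nat) = false) ?mul0r//; have := ltn_ord k; lia.
transitivity (\sum_(k < n) (1 + rho ^+ 2 *+ ((0 < i) && (i.+1 < n))%N) *+ (k == i :> nat) * g k
   - \sum_(k < n) rho *+ (k.+1 == i :> nat) * g k - \sum_(k < n) rho *+ (k == i.+1 :> nat) * g k).
  rewrite -!sumrB; apply: eq_bigr => k _; rewrite mxE !mulrBl.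
  by rewrite [(i == k :> nat)]eq_sym.
rewrite !pick ltn_ord mulr1n; congr (_ - _ - _).
case: (posnP i) => [i0|i0].
  by rewrite big1// => k _; rewrite i0 mul0r.
have := pick rho i.-1; rewrite (_ : (i.-1 < n)%N) ?mulr1n; last by have := ltn_ord i; lia.
move=> <-; apply: eq_bigr => k _; congr (_ *+ (nat_of_bool _) * _).
by apply/eqP/eqP; lia.
Qed.

Lemma tri_mx_sym : tri_mx^T = tri_mx.
Proof.
apply/matrixP => i k; rewrite !mxE [(k == i :> nat)]eq_sym [(i.+1 == k :> nat)]eq_sym [(i == k.+1 :> nat)]eq_sym.
rewrite addrAC; congr (_ - _ - _).
by case: (i =P k :> nat) => [->|]//; rewrite !mulr0n.
Qed.

Lemma tri_mx_ar : (1 < n)%N -> tri_mx *m ar_mx n rho = (1 - rho ^+ 2)%:M.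
Proof.
move=> n1; apply/matrixP => i j; rewrite mxE.
under eq_bigr do rewrite [ar_mx _ _ _ _]mxE.
rewrite (tri_mx_sum (fun k => rho ^+ ndist k j)) mxE /ndist.
have [ij|ij|/val_inj ij] := ltngtP i j.
- rewrite (_ : (i == j) = false); last by apply/eqP => e; move: ij; rewrite e ltnn.
  have i1n : (i.+1 < n)%N by have := ltn_ord j; lia.
  rewrite i1n andbT mulr1n mulr0n.
  rewrite (_ : ((i - j) + (j - i) = (j - i.+1).+1)%N); last by lia.
  rewrite (_ : ((i.+1 - j) + (j - i.+1) = (j - i.+1))%N); last by lia.
  case: posnP => [_|i0]; rewrite ?mulr0n ?mulr1n.
    by rewrite addr0 subr0 mul1r exprS subrr.
  rewrite (_ : ((i.-1 - j) + (j - i.-1) = (j - i.+1).+2)%N); last by lia.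
  rewrite !exprS; ring.
- rewrite (_ : (i == j) = false); last by apply/eqP => e; move: ij; rewrite e ltnn.
  have i0 : (0 < i)%N by lia.
  rewrite i0 andTb mulr1n mulr0n.
  rewrite (_ : ((i - j) + (j - i) = (i - j.+1).+1)%N); last by lia.
  rewrite (_ : ((i.-1 - j) + (j - i.-1) = (i - j.+1))%N); last by lia.
  case: ltnP => [_|i1n]; rewrite ?mulr0n ?mulr1n.
    rewrite (_ : ((i.+1 - j) + (j - i.+1) = (i - j.+1).+2)%N); last by lia.
    rewrite !exprS; ring.
  by rewrite addr0 subr0 mul1r exprS subrr.
rewrite -ij eqxx mulr1n subnn addn0 expr0 mulr1.
rewrite (_ : ((i.+1 - i) + (i - i.+1) = 1)%N) ?expr1; last by lia.
case: (posnP i) => [i0|i0].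
  by rewrite i0 n1 /= mulr0n mulr1n addr0 subr0 expr2.
rewrite (_ : ((i.-1 - i) + (i - i.-1) = 1)%N) ?expr1; last by lia.
case: ltnP => _; rewrite ?mulr0n ?mulr1n expr2; ring.
Qed.

(** Off-diagonal entries are nonpositive, so replacing e by its absolute value can only lower the
    sum; what remains is a combination of the column sums, which are (1 - rho)^2 inside and larger
    at the ends. This is the accretivity in l^1 that lets [ar_score] bound the remainder in that
    norm. *)
Lemma tri_mx_accretive (e : 'cV[R]_n) :
  0 <= \sum_i Num.sg (e i 0) * (tri_mx *m e) i 0.
Proof.
have -> : \sum_i Num.sg (e i 0) * (tri_mx *m e) i 0 =
   \sum_i \sum_k Num.sg (e i 0) * (tri_mx i k * e k 0).
  by apply: eq_bigr => i _; rewrite mxE mulr_sumr.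
apply: (@le_trans _ _ (\sum_i \sum_k tri_mx i k * `|e k 0|)).
  rewrite exchange_big; apply: sumr_ge0 => k _ /=.
  rewrite -mulr_suml mulr_ge0//.
  have -> : \sum_i tri_mx i k = \sum_i tri_mx k i * 1.
    by apply: eq_bigr => i _; rewrite -[in LHS]tri_mx_sym mxE mulr1.
  rewrite (tri_mx_sum (fun=> 1)) !mulr1.
  case: posnP => _; case: ltnP => _; rewrite /= ?mulr0n ?mulr1n ?addr0 ?subr0 ?ler01 ?subr_ge0 ?(ltW r1)//.
  by have := sqr_ge0 (1 - rho); rewrite !expr2; nra.
apply: ler_sum => i _; apply: ler_sum => k _.
have [->|ik] := eqVneq i k.
  by rewrite mulrCA -normrEsg lexx.
have t0 : tri_mx i k <= 0.
  rewrite mxE (_ : (i == k :> nat) = false); last exact: (negbTE ik).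
  by rewrite mulr0n add0r -opprD oppr_le0 addr_ge0// mulrn_wge0// ltW.
have : `|Num.sg (e i 0) * e k 0| <= `|e k 0|.
  by rewrite normrM ler_piMl// normr_sg; case: (_ == 0); rewrite ?ler01.
rewrite ler_norml => /andP[_ h].
by rewrite mulrCA; apply: ler_wnM2l.
Qed.

(** How far x is from an eigenvector of [tri_mx] for the eigenvalue (1 - rho)^2. In the interior it
    equals - rho times the second difference of x. *)
Definition tri_defect (x : nat -> R) (i : nat) : R :=
  (1 + rho ^+ 2 *+ ((0 < i) && (i.+1 < n))%N) * x i
    - (rho * x i.-1) *+ (0 < i)%N - (rho * x i.+1) *+ (i.+1 < n)%N - (1 - rho) ^+ 2 * x i.

(* Away from the boundary the constants are eigenvectors of [tri_mx], so a slowly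
   varying x is mapped by the inverse of s2 K + v2 I to a multiple of itself, up
   to an error carried by the boundary and by second differences of x. *)
Lemma ar_score (s2 v2 : R) (x : nat -> R) (u : 'cV[R]_n) (B : R) :
  (1 < n)%N -> 0 < s2 -> 0 < v2 ->
  (s2 *: ar_mx n rho + v2%:M) *m u = \col_i x i ->
  \sum_(i < n) `|tri_defect x i| <= B ->
  exists (t : R) (e : 'cV[R]_n), [/\ u = t *: (\col_i x i) + e,
    0 <= t <= (1 - rho) / s2 & \sum_i `|e i 0| <= B / (s2 * (1 - rho))].
Proof.
move=> n1 s20 v20 Su xB.
pose r2 := 1 - rho ^+ 2; pose a := (1 - rho) ^+ 2.
have r20 : 0 < r2 by rewrite subr_gt0 exprn_ilt1 // ltW.
have a0 : 0 < a by rewrite exprn_gt0// subr_gt0.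
pose D := s2 * r2 + v2 * a.
have sr0 : 0 < s2 * r2 by rewrite mulr_gt0.
have va0 : 0 < v2 * a by rewrite mulr_gt0.
have D0 : 0 < D by rewrite addr_gt0.
(* Multiplying the equation by [tri_mx] gives (s2 r2 + v2 L) u = L x with L = [tri_mx]. If L x were
   exactly a x, the solution would be u = (a / D) x. *)
pose t := a / D; pose xc : 'cV[R]_n := \col_i x i.
pose e := u - t *: xc.
have rle : 1 - rho <= r2 by rewrite /r2 lerD2l lerN2 expr2 ler_piMl ?ltW.
have r10 : 0 < 1 - rho by rewrite subr_gt0.
exists t, e; split; first by rewrite /e addrC subrK.
  rewrite /t divr_ge0 ?(ltW a0) ?(ltW D0)//= ler_pdivrMr// mulrAC ler_pdivlMr//.
  rewrite /a expr2 -mulrA; apply: ler_wpM2l; first exact: ltW.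
  rewrite (le_trans (_ : _ <= s2 * r2))//; last by rewrite lerDl ltW.
  by rewrite mulrC ler_wpM2l// ltW.
have Lu : (s2 * r2) *: u + v2 *: (tri_mx *m u) = tri_mx *m xc.
  rewrite /xc -Su mulmxA mulmxDr -scalemxAr tri_mx_ar// mulmxDl -scalemxAl mul_scalar_mx scalerA.
  by rewrite mul_mx_scalar -scalemxAl.
have Le : (s2 * r2) *: e + v2 *: (tri_mx *m e) = (s2 * r2 / D) *: (tri_mx *m xc - a *: xc).
  rewrite /e mulmxBr -scalemxAr !scalerBr !scalerA.
  have -> : (s2 * r2) *: u - (s2 * r2 * t) *: xc + (v2 *: (tri_mx *m u) - (v2 * t) *: (tri_mx *m xc)) =
     ((s2 * r2) *: u + v2 *: (tri_mx *m u)) - (s2 * r2 * t) *: xc - (v2 * t) *: (tri_mx *m xc).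
    by rewrite addrACA addrA.
  rewrite Lu -{1}[tri_mx *m xc]scale1r addrAC -scalerBl; congr (_ *: _ - _ *: _).
    by rewrite /t; rewrite /D in D0 *; field; rewrite gt_eqF.
  by rewrite /t; ring.
have defE i : (tri_mx *m xc - a *: xc) i 0 = tri_defect x i.
  rewrite !mxE /tri_defect -(tri_mx_sum x); congr (_ - _ * _).
  by apply: eq_bigr => k _; rewrite [xc _ _]mxE.
have Lei i : s2 * r2 * e i 0 + v2 * (tri_mx *m e) i 0 = s2 * r2 / D * tri_defect x i.
  rewrite -defE.
  transitivity (((s2 * r2) *: e + v2 *: (tri_mx *m e)) i 0).
    by rewrite [RHS]mxE; congr (_ + _); rewrite [RHS]mxE.
  by rewrite Le [LHS]mxE.
(* The equation for e is tested against the signs of e: the first term yields the l^1 norm and the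
   second is nonnegative by accretivity. *)
have h1 : s2 * r2 * \sum_i `|e i 0| <= \sum_i Num.sg (e i 0) * ((s2 * r2 / D) * tri_defect x i).
  have -> : \sum_i Num.sg (e i 0) * ((s2 * r2 / D) * tri_defect x i) =
     s2 * r2 * \sum_i `|e i 0| + v2 * \sum_i Num.sg (e i 0) * (tri_mx *m e) i 0.
    rewrite !mulr_sumr -big_split; apply: eq_bigr => i _ /=.
    by rewrite -Lei normrEsg; ring.
  by rewrite lerDl mulr_ge0 ?(ltW v20)// tri_mx_accretive.
have h2 : \sum_i Num.sg (e i 0) * ((s2 * r2 / D) * tri_defect x i) <= (s2 * r2 / D) * B.
  apply: (@le_trans _ _ (\sum_(i < n) (s2 * r2 / D) * `|tri_defect x i|)).
    apply: ler_sum => i _; rewrite mulrCA; apply: ler_wpM2l; first by rewrite divr_ge0 ?ltW.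
    rewrite (le_trans (ler_norm _))// normrM ler_piMl// normr_sg.
    by case: (_ == 0); rewrite ?ler01.
  by rewrite -mulr_sumr; apply: ler_wpM2l => //; rewrite divr_ge0 ?ltW.
have B0 : 0 <= B by apply: le_trans xB; apply: sumr_ge0.
have h3 : \sum_i `|e i 0| <= B / D.
  rewrite -(ler_pM2l sr0) (le_trans h1)// (le_trans h2)//.
  by rewrite mulrA [_ * B / D]mulrAC.
rewrite (le_trans h3)//; apply: ler_wpM2l => //.
rewrite lef_pV2 ?posrE ?mulr_gt0//.
rewrite (le_trans (_ : _ <= s2 * r2))//; last by rewrite lerDl ltW.
by apply: ler_wpM2l => //; exact: ltW.
Qed.

End tridiagonal.

(** * Monomials on the grid *)

Section monomials.
Context {R : realType}.

Lemma exprD_convex (t s : R) j : 0 <= s <= t -> 2 * t ^+ j <= (t + s) ^+ j + (t - s) ^+ j.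
Proof.
move=> /andP[s0 st]; have t0 : 0 <= t := le_trans s0 st.
elim: j => [|j IH]; first by rewrite !expr0; lra.
rewrite !exprS.
have h : (t - s) ^+ j <= (t + s) ^+ j by rewrite lerXn2r// ?nnegrE; lra.
have h1 : t * (2 * t ^+ j) <= t * ((t + s) ^+ j + (t - s) ^+ j) by apply: ler_wpM2l.
have h2 : 0 <= s * ((t + s) ^+ j - (t - s) ^+ j) by rewrite mulr_ge0// subr_ge0.
lra.
Qed.

(** The bound 2 on the argument leaves room for (n + 1) / n, the point just beyond the grid. *)
Lemma exprD_incr (t s : R) j : 0 <= t -> 0 <= s -> t + s <= 2 ->
  0 <= (t + s) ^+ j - t ^+ j <= j%:R * 2 ^+ j * s.
Proof.
move=> t0 s0 ts2; rewrite subr_ge0; apply/andP; split.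
  by rewrite lerXn2r// ?nnegrE//; lra.
elim: j => [|j IH]; first by rewrite !expr0 mul0r mul0r subrr.
have p2 : t ^+ j <= 2 ^+ j by rewrite lerXn2r// ?nnegrE; lra.
have h1 : (t + s) * ((t + s) ^+ j - t ^+ j) <= 2 * (j%:R * 2 ^+ j * s).
  have d0 : 0 <= (t + s) ^+ j - t ^+ j by rewrite subr_ge0 lerXn2r// ?nnegrE//; lra.
  apply: (@le_trans _ _ (2 * ((t + s) ^+ j - t ^+ j))); first exact: ler_wpM2r.
  by apply: ler_wpM2l.
have h2 : s * t ^+ j <= s * 2 ^+ j by apply: ler_wpM2l.
have h3 : 0 <= s * 2 ^+ j by rewrite mulr_ge0// exprn_ge0.
rewrite !exprS -natr1; lra.
Qed.

Definition grid_pow (n j i : nat) : R := (i.+1%:R / n%:R) ^+ j.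

Lemma grid_powS n j i : (0 < n)%N -> (i < n)%N ->
  0 <= grid_pow n j i.+1 - grid_pow n j i <= j%:R * 2 ^+ j / n%:R.
Proof.
move=> n0 i_n; rewrite /grid_pow.
have n0' : 0 < n%:R :> R by rewrite ltr0n.
have -> : i.+2%:R / n%:R = i.+1%:R / n%:R + n%:R^-1 :> R by rewrite -natr1 mulrDl mul1r.
apply: exprD_incr.
- by rewrite divr_ge0.
- by rewrite invr_ge0.
- rewrite -[X in _ + X]mul1r -mulrDl ler_pdivrMr// natr1 -natrM ler_nat; lia.
Qed.

Lemma grid_pow01 n j i : (i < n)%N -> 0 <= grid_pow n j i <= 1.
Proof.
move=> i_n; have n0' : 0 < n%:R :> R by rewrite ltr0n; lia.
rewrite exprn_ge0 ?divr_ge0//= exprn_ile1// ?divr_ge0//.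
by rewrite ler_pdivrMr// mul1r ler_nat.
Qed.

Lemma grid_pow_convex n j i : (0 < i)%N -> (0 < n)%N ->
  0 <= (grid_pow n j i.+1 - grid_pow n j i) - (grid_pow n j i - grid_pow n j i.-1).
Proof.
move=> i0 n0; rewrite /grid_pow prednK//.
have n0' : 0 < n%:R :> R by rewrite ltr0n.
have -> : i.+2%:R / n%:R = i.+1%:R / n%:R + n%:R^-1 :> R by rewrite -natr1 mulrDl mul1r.
have -> : i%:R / n%:R = i.+1%:R / n%:R - n%:R^-1 :> R by rewrite -natr1 mulrDl mul1r addrK.
have := @exprD_convex (i.+1%:R / n%:R) n%:R^-1 j.
rewrite invr_ge0 ler0n/= -[X in X <= _ -> _]mul1r ler_pM2r ?invr_gt0// ler1n => /(_ isT).
lra.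
Qed.

(** By convexity the second differences are nonnegative, so their sum telescopes to one last
    increment. That increment and the two boundary rows give the factor 3; the boundary rows alone
    give 2 (1 - rho). *)
Lemma grid_pow_defect n (rho : R) j : 0 < rho -> rho < 1 -> (1 < n)%N ->
  \sum_(i < n) `|tri_defect n rho (grid_pow n j) i| <=
    3 * (j%:R * 2 ^+ j / n%:R) + 2 * (1 - rho).
Proof.
move=> r0 r1 n1; set x := grid_pow n j; set b := j%:R * 2 ^+ j / n%:R.
have n0 : (0 < n)%N by lia.
have b0 : 0 <= b by rewrite /b divr_ge0// mulr_ge0// exprn_ge0.
pose E := b + (1 - rho).
have E0 : 0 <= E by rewrite /E addr_ge0// subr_ge0 ltW.
have rr : 0 <= rho * (1 - rho) <= 1 - rho.
  by rewrite mulr_ge0 ?subr_ge0 ?(ltW r0) ?(ltW r1)//= ler_piMl ?subr_ge0 ?(ltW r1).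
have edge (d y : R) : 0 <= d <= b -> 0 <= y <= 1 ->
    `|rho * d + rho * (1 - rho) * y| <= E /\ `|- (rho * d) + rho * (1 - rho) * y| <= E.
  move=> /andP[d0 db] /andP[y0 y1].
  have h1 : 0 <= rho * d by rewrite mulr_ge0// ltW.
  have h2 : rho * d <= d by rewrite ler_piMl// ltW.
  have h3 : 0 <= rho * (1 - rho) * y by case/andP: rr => rr _; rewrite mulr_ge0.
  have h4 : rho * (1 - rho) * y <= 1 - rho.
    by case/andP: rr => rr1 rr2; rewrite (le_trans _ rr2)// ler_piMr.
  by rewrite /E; split; rewrite ler_norml; lra.
(* At i = 0 the predecessor is 0 as well, so the second difference degenerates to the first
   increment, which is nonnegative. *)
have pt (i : 'I_n) : `|tri_defect n rho x i| <=
    ((x i.+1 - x i) - (x i - x i.-1)) + E *+ (i == 0%N :> nat) + E *+ (i.+1 == n :> nat).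
  have x01 := grid_pow01 j (ltn_ord i).
  have inc := grid_powS j n0 (ltn_ord i).
  rewrite /tri_defect; case: (posnP i) => [i0|i0].
    have -> : (i.+1 == n :> nat) = false by rewrite i0 ltn_eqF.
    rewrite i0 n1 /= ?eqxx ?mulr0n ?mulr1n !addr0 ?subr0 ?mul1r ?subrr ?subr0.
    rewrite i0 in x01 inc; have [_] := edge _ _ inc x01; rewrite -/x.
    rewrite (_ : - _ + _ = x 0%N - rho * x 1%N - (1 - rho) ^+ 2 * x 0%N); last by rewrite expr2; ring.
    by case/andP: inc => inc _ /le_trans; apply; rewrite lerDr.
  have cv := grid_pow_convex j i0 n0; rewrite -/x in cv.
  have [i1n|i1n] := ltnP i.+1 n.
    have -> : (i.+1 == n :> nat) = false by rewrite ltn_eqF.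
    rewrite !mulr1n !mulr0n !addr0.
    rewrite (_ : _ - _ - _ - _ = - (rho * ((x i.+1 - x i) - (x i - x i.-1)))); last by rewrite !expr2; ring.
    by rewrite normrN ger0_norm ?mulr_ge0 ?(ltW r0)// ler_piMl// ltW.
  have -> : (i.+1 == n :> nat) = true by rewrite eqn_leq i1n ltn_ord.
  rewrite /= !mulr0n !mulr1n !addr0 mul1r subr0.
  have i1 : (i.-1 < n)%N by rewrite (leq_ltn_trans (leq_pred _)).
  have inc' := grid_powS j n0 i1; rewrite prednK// in inc'.
  have [] := edge _ _ inc' x01.
  rewrite -/x (_ : rho * _ + _ = x i - rho * x i.-1 - (1 - rho) ^+ 2 * x i); last by rewrite expr2; ring.
  by move=> /le_trans + _; apply; rewrite lerDr.
apply: (le_trans (ler_sum _ (fun i _ => pt i))).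
rewrite big_split big_split sumrB /=.
have -> : \sum_(i < n) (x i.+1 - x i) = x n - x 0%N.
  by rewrite -(big_mkord xpredT (fun i => x i.+1 - x i)) telescope_sumr.
have -> : \sum_(i < n) (x i - x i.-1) = x n.-1 - x 0%N.
  rewrite -(big_mkord xpredT (fun i => x i - x i.-1)) big_ltn// subrr add0r.
  by rewrite big_add1 /= telescope_sumr//; lia.
have one (h : nat) : \sum_(i < n) E *+ (i == h :> nat) <= E.
  case: (ltnP h n) => hn.
    rewrite (bigD1 (Ordinal hn))//= eqxx big1 ?addr0// => k kh.
    by rewrite (_ : (k == h :> nat) = false)//; apply: contraNF kh => /eqP kh; apply/eqP/val_inj.
  by rewrite big1// => k _; rewrite (_ : (k == h :> nat) = false)//; have := ltn_ord k; lia.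
have e1 := one 0%N.
have e2 : \sum_(i < n) E *+ (i.+1 == n :> nat) <= E.
  apply: le_trans (one n.-1); rewrite le_eqVlt; apply/orP; left; apply/eqP.
  by apply: eq_bigr => i _; congr (_ *+ nat_of_bool _); apply/eqP/eqP; lia.
have i1 : (n.-1 < n)%N by rewrite prednK.
have := grid_powS j n0 i1; rewrite prednK// -/x -/b => /andP[_ i2].
rewrite /E in e1 e2 *; lra.
Qed.

End monomials.

(** * A discrete Gram bound by finite differences *)

Section finite_differences.
Context {R : realType}.

Definition fdiff (s : nat) (f : nat -> R) (i : nat) : R := f (i + s)%N - f i.

Lemma fdiff_sqr (s N : nat) (f : nat -> R) :
  \sum_(i < N - s) fdiff s f i ^+ 2 <= 4 * \sum_(i < N) f i ^+ 2.
Proof.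
have sub (M : nat) : (M <= N)%N -> \sum_(0 <= i < M) f i ^+ 2 <= \sum_(0 <= i < N) f i ^+ 2.
  move=> MN; rewrite [leRHS](big_cat_nat (n := M))//= lerDl.
  by apply: sumr_ge0 => i _; exact: sqr_ge0.
rewrite -(big_mkord xpredT (fun i => fdiff s f i ^+ 2)) -(big_mkord xpredT (fun i => f i ^+ 2)).
apply: (@le_trans _ _ (\sum_(0 <= i < N - s) (2 * f (i + s)%N ^+ 2 + 2 * f i ^+ 2))).
  apply: ler_sum => i _; rewrite /fdiff.
  by have := sqr_ge0 (f (i + s)%N + f i); rewrite !expr2; lra.
rewrite big_split/= -!mulr_sumr.
have h1 : \sum_(0 <= i < N - s) f i ^+ 2 <= \sum_(0 <= i < N) f i ^+ 2 by apply: sub; rewrite leq_subr.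
have h2 : \sum_(0 <= i < N - s) f (i + s)%N ^+ 2 <= \sum_(0 <= i < N) f i ^+ 2.
  have [sN|sN] := leqP s N; last first.
    rewrite [leLHS]big_geq; last by lia.
    by apply: sumr_ge0 => i _; exact: sqr_ge0.
  rewrite -{1}[s]add0n -(big_addn 0 N s xpredT (fun i => f i ^+ 2)) add0n.
  rewrite [leRHS](big_cat_nat (n := s))//= lerDr.
  by apply: sumr_ge0 => i _; exact: sqr_ge0.
lra.
Qed.

Lemma iter_fdiff_sqr (s N m : nat) (f : nat -> R) :
  \sum_(i < N - m * s) iter m (fdiff s) f i ^+ 2 <= 4 ^+ m * \sum_(i < N) f i ^+ 2.
Proof.
elim: m => [|m IH]; first by rewrite mul0n subn0 expr0 mul1r.
rewrite mulSn addnC subnDA exprS -mulrA /=.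
apply: le_trans (fdiff_sqr _ _ _) _; exact: ler_wpM2l.
Qed.

Definition pdiff (c : R) (q : {poly R}) : {poly R} := q \Po ('X + c%:P) - q.

Lemma pdiff_size c m (q : {poly R}) : (size q <= m.+2)%N ->
  (size (pdiff c q) <= m.+1)%N /\ (pdiff c q)`_m = m.+1%:R * c * q`_m.+1.
Proof.
elim: m q => [|m IH] q sq.
  have qE : q = q`_1 *: 'X + (q`_0)%:P.
    apply/polyP => i; rewrite coefD coefZ coefX coefC.
    case: i => [|[|i]] /=; rewrite ?mulr0 ?mulr1 ?add0r ?addr0//.
    by rewrite nth_default// (leq_trans sq).
  have dE : pdiff c q = (c * q`_1)%:P.
    rewrite /pdiff {1 2}qE comp_polyD comp_polyZ comp_polyX comp_polyC opprD.
    by rewrite scalerDr addrACA addrC -!addrA; rewrite polyCM mulrC mul_polyC; ring.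
  by rewrite dE size_polyC leq_b1 coefC eqxx mul1r.
pose p : {poly R} := \poly_(i < m.+2) q`_i.+1.
have qE : q = p * 'X + (q`_0)%:P.
  apply/polyP => i; rewrite coefD coefMX coefC coef_poly.
  case: i => [|i] /=; rewrite ?add0r ?addr0//.
  by case: ltnP => // im; rewrite nth_default// (leq_trans sq).
have sp : (size p <= m.+2)%N by exact: size_poly.
have [IH1 IH2] := IH _ sp.
have dE : pdiff c q = pdiff c p * ('X + c%:P) + c *: p.
  rewrite /pdiff {1 2}qE comp_polyD comp_polyM comp_polyX comp_polyC -mul_polyC; ring.
split.
  rewrite dE (leq_trans (size_polyD _ _))// geq_max; apply/andP; split.
    rewrite (leq_trans (size_polyMleq _ _))// size_XaddC; lia.
  by rewrite (leq_trans (size_scale_leq _ _)).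
rewrite dE mulrDr !coefD coefMX coefMC coefZ /= IH2.
rewrite (nth_default _ IH1) mul0r addr0 !coef_poly ltnSn -[m.+2%:R]natr1; ring.
Qed.

Lemma iter_pdiff c m (q : {poly R}) : (size q <= m.+1)%N ->
  iter m (pdiff c) q = (m`!%:R * c ^+ m * q`_m)%:P.
Proof.
elim: m q => [|m IH] q sq.
  by rewrite /= fact0 expr0 !mul1r {1}[q]size1_polyC.
have [s1 c1] := pdiff_size c sq.
rewrite iterSr IH// c1 factS natrM exprS; congr (_%:P); ring.
Qed.

Lemma iter_fdiff_horner (n s m : nat) (q : {poly R}) :
  iter m (fdiff s) (fun i => q.[i.+1%:R / n%:R]) =
  fun i => (iter m (pdiff (s%:R / n%:R)) q).[i.+1%:R / n%:R].
Proof.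
elim: m => [//|m IH] /=; rewrite IH; apply/funext => i.
rewrite /fdiff /pdiff !hornerE horner_comp !hornerE -mulrDl -natrD addSn.
by [].
Qed.

(** The m-th difference with step s of a polynomial of degree m is the constant m! (s / n)^m q_m,
    while differencing costs at most 4^m in the sum of squares. A step s of about n / (m + 1) keeps
    s / n away from 0 and leaves at least s sample points; w bounds n / s, and its exponent counts 2
    m for the power of s / n and 1 for the number of points. *)
Lemma lead_coef_sum_sqr (m n : nat) (q : {poly R}) : (m < n)%N -> (size q <= m.+1)%N ->
  q`_m ^+ 2 <= 4 ^+ m * (2 * m.+1%:R) ^+ m.*2.+1 / n%:R *
    \sum_(i < n) q.[i.+1%:R / n%:R] ^+ 2.
Proof.
move=> mn sq; pose s := (n %/ m.+1)%N; pose w : R := 2 * m.+1%:R.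
have n0 : 0 < n%:R :> R by rewrite ltr0n; lia.
have s0 : (0 < s)%N by rewrite divn_gt0.
have w0 : 0 < w by rewrite mulr_gt0.
have nsw : n%:R <= s%:R * w :> R.
  rewrite /w mulrCA -!natrM ler_nat.
  have := ltn_ceil n (ltn0Sn m); rewrite -/s; nia.
have ms : (m.+1 * s <= n)%N by rewrite mulnC leq_trunc_div.
set S := \sum_(i < n) _.
have := iter_fdiff_sqr s n m (fun i => q.[i.+1%:R / n%:R]); rewrite -/S.
rewrite iter_fdiff_horner iter_pdiff//.
under eq_bigr do rewrite hornerC.
rewrite sumr_const card_ord => h.
have sub : (s <= n - m * s)%N by move: ms; rewrite mulSn; lia.
have q2 := sqr_ge0 q`_m.
have key : s%:R * (s%:R / n%:R) ^+ m.*2 * q`_m ^+ 2 <= 4 ^+ m * S.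
  apply: le_trans h; rewrite -[leRHS]mulr_natl.
  apply: (@le_trans _ _ (s%:R * (m`!%:R * (s%:R / n%:R) ^+ m * q`_m) ^+ 2)).
    rewrite -[leLHS]mulrA; apply: ler_wpM2l => //.
    rewrite -muln2 exprM -exprMn -[m`!%:R * _ * _]mulrA [leRHS]exprMn.
    by rewrite ler_peMl ?sqr_ge0// exprn_ege1// ler1n fact_gt0.
  by apply: ler_wpM2r; [exact: sqr_ge0|rewrite ler_nat].
have inv : w ^- m.*2.+1 * n%:R <= s%:R * (s%:R / n%:R) ^+ m.*2.
  have c1 : w^-1 <= s%:R / n%:R by rewrite ler_pdivlMr// mulrC ler_pdivrMr.
  have c2 : w ^- m.*2 <= (s%:R / n%:R) ^+ m.*2.
    by rewrite -exprVn lerXn2r// ?nnegrE ?divr_ge0 ?invr_ge0// ltW.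
  have c3 : w^-1 * n%:R <= s%:R by rewrite mulrC ler_pdivrMr.
  rewrite exprS invfM mulrAC; apply: ler_pM => //.
    by rewrite mulr_ge0 ?invr_ge0// ltW.
  by rewrite invr_ge0 exprn_ge0// ltW.
have wp : 0 < w ^+ m.*2.+1 by rewrite exprn_gt0.
have : w ^- m.*2.+1 * n%:R * q`_m ^+ 2 <= 4 ^+ m * S.
  by apply: le_trans key; apply: ler_wpM2r.
rewrite -mulrA ler_pdivrMl// => h'.
rewrite -/w -[leRHS]mulrA mulrAC mulrCA [_ * S]mulrC mulrA.
by rewrite -(ler_pM2l n0) (le_trans h')// le_eqVlt; apply/orP; left; apply/eqP; field; rewrite gt_eqF.
Qed.

(** The leading coefficient is bounded first and its monomial subtracted, which lowers the degree.
    The outcome is a bound, uniform in n, in place of the positive definiteness of the Hilbert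
    matrix, the limit of X'X / n. *)
Lemma coef_sum_sqr (p : nat) : exists2 C : R, 0 < C &
  forall (n : nat) (q : {poly R}) (j : nat), (p < n)%N -> (size q <= p.+1)%N ->
    q`_j ^+ 2 <= C / n%:R * \sum_(i < n) q.[i.+1%:R / n%:R] ^+ 2.
Proof.
elim: p => [|p [C C0 IH]].
  exists (4 ^+ 0 * (2 * 1) ^+ 1) => [|n q j n0 sq]; first by rewrite !mulr_gt0// exprn_gt0.
  case: j => [|j]; first exact: (@lead_coef_sum_sqr 0).
  rewrite nth_default ?(leq_trans sq)// expr0n; apply: mulr_ge0; last by apply: sumr_ge0 => i _; exact: sqr_ge0.
  by rewrite divr_ge0// !mulr_ge0// exprn_ge0.
pose C1 : R := 4 ^+ p.+1 * (2 * p.+2%:R) ^+ p.+1.*2.+1.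
have C10 : 0 < C1 by rewrite mulr_gt0 ?exprn_gt0// mulr_gt0.
exists (C * (2 + 2 * C1) + C1) => [|n q j pn sq].
  by rewrite addr_gt0// mulr_gt0// addr_gt0// mulr_gt0.
have n0 : 0 < n%:R :> R by rewrite ltr0n; lia.
set S := \sum_(i < n) _.
have S0 : 0 <= S by apply: sumr_ge0 => i _; exact: sqr_ge0.
have lead := lead_coef_sum_sqr pn sq; rewrite -/S -/C1 in lead.
have [jp|jp] := ltnP p.+1 j.
  rewrite nth_default ?(leq_trans sq)// expr0n mulr_ge0// divr_ge0 ?(ltW n0)//.
  by rewrite addr_ge0 ?(ltW C10)// mulr_ge0 ?(ltW C0)// addr_ge0// mulr_ge0// ltW.
rewrite mulrDl mulrDl.
have [->|jp'] := eqVneq j p.+1.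
  rewrite (le_trans lead)// lerDr mulr_ge0// divr_ge0 ?(ltW n0)// mulr_ge0 ?(ltW C0)//.
  by rewrite addr_ge0// mulr_ge0// ltW.
pose q' := q - q`_p.+1 *: 'X^(p.+1).
have sq' : (size q' <= p.+1)%N.
  apply/leq_sizeP => i; rewrite coefB coefZ coefXn leq_eqVlt => /orP[/eqP <-|pi].
    by rewrite eqxx mulr1 subrr.
  by rewrite (gtn_eqF pi) mulr0 subr0 nth_default// (leq_trans sq).
have q'j : q'`_j = q`_j by rewrite coefB coefZ coefXn (negbTE jp') mulr0 subr0.
have := IH n q' j (ltnW pn) sq'; rewrite q'j => h.
have S' : \sum_(i < n) q'.[i.+1%:R / n%:R] ^+ 2 <= (2 + 2 * C1) * S.
  apply: (@le_trans _ _ (\sum_(i < n) (2 * q.[i.+1%:R / n%:R] ^+ 2 + 2 * q`_p.+1 ^+ 2))).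
    apply: ler_sum => i _; rewrite /q' hornerD hornerN hornerZ hornerXn.
    set a := q.[_]; set b := q`_p.+1; set x := (i.+1%:R / n%:R) ^+ p.+1.
    have /andP[x0 x1] : 0 <= x <= 1 := grid_pow01 p.+1 (ltn_ord i).
    have h1 : (b * x) ^+ 2 <= b ^+ 2.
      by rewrite exprMn ler_piMr ?sqr_ge0// exprn_ile1.
    by have := sqr_ge0 (a + b * x); rewrite !expr2 in h1 *; lra.
  rewrite big_split/= -mulr_sumr sumr_const card_ord -/S -[_ *+ n]mulr_natr.
  have : q`_p.+1 ^+ 2 * n%:R <= C1 * S.
    by rewrite -ler_pdivlMr// mulrAC.
  lra.
rewrite (le_trans h)// (le_trans (_ : _ <= C * (2 + 2 * C1) / n%:R * S))//.
  rewrite (_ : C * _ / _ * S = C / n%:R * ((2 + 2 * C1) * S)); last by ring.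
  by apply: ler_wpM2l => //; rewrite divr_ge0// ltW.
by rewrite lerDl mulr_ge0// divr_ge0 ?(ltW n0)// ltW.
Qed.

End finite_differences.

(** * The exponential covariance matrix *)

Section covariance.
Context {R : realType}.
Variable delta : R.
Hypothesis delta01 : 0 < delta < 1.

Definition mesh (n : nat) : R := n%:R `^ (- (1 - delta)).

Lemma mesh_gt0 n : (0 < n)%N -> 0 < mesh n.
Proof. by move=> n0; rewrite powR_gt0// ltr0n. Qed.

Lemma mesh_le1 n : (0 < n)%N -> mesh n <= 1.
Proof.
move=> n0; rewrite /mesh -[leRHS](powRr0 n%:R); apply: ler_powR; first by rewrite ler1n.
by case/andP: delta01 => _ d1; rewrite oppr_le0 subr_ge0 ltW.
Qed.

Lemma natr_mesh n : (0 < n)%N -> n%:R * mesh n = n%:R `^ delta.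
Proof.
move=> n0; have n0' : 0 < n%:R :> R by rewrite ltr0n.
rewrite /mesh -{1}[n%:R]powRr1 ?ltW// -powRD; last by apply/implyP => _; rewrite gt_eqF.
by congr (_ `^ _); ring.
Qed.

Lemma invn_le_mesh n : (0 < n)%N -> n%:R^-1 <= mesh n.
Proof.
move=> n0; rewrite -powR_inv1// /mesh; apply: ler_powR; first by rewrite ler1n.
by case/andP: delta01 => d0 _; lra.
Qed.

Lemma Sigma_ar n th : Sigma delta n th =
  sigma2 th *: ar_mx n (expR (- (kappa th * mesh n))) + (v2 th)%:M.
Proof.
congr (_ + _); apply/matrixP => i j; rewrite !mxE; congr (_ * _).
rewrite -expRM_natl; congr expR.
have -> : `|site delta i - site delta j| = (ndist i j)%:R * mesh n.
  rewrite /site -mulrBl normrM (ger0_norm (ltW (mesh_gt0 _))); last by have := ltn_ord i; lia.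
  congr (_ * _); rewrite /ndist; case: (leqP i j) => ij.
    have -> : (i - j)%N = 0%N by apply/eqP; rewrite subn_eq0.
    by rewrite distrC ger0_norm ?subr_ge0 ?ler_nat// -natrB// subSS.
  have ji := ltnW ij; have -> : (j - i)%N = 0%N by apply/eqP; rewrite subn_eq0.
  by rewrite ger0_norm ?subr_ge0 ?ler_nat// -natrB// subSS addn0.
by rewrite -mulr_natl; ring.
Qed.

Lemma designE n p (i : 'I_n) (j : 'I_p.+1) : design delta n p i j = grid_pow n j i.
Proof.
have n0 : (0 < n)%N by have := ltn_ord i; lia.
have n0' : 0 < n%:R :> R by rewrite ltr0n.
rewrite mxE /grid_pow; case: eqP => [->|_]; first by rewrite expr0.
have e1 : n%:R `^ (- (delta * j%:R)) = (n%:R `^ (- delta)) ^+ j.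
  by rewrite -mulNr powRrM powR_mulrn// powR_ge0.
have e2 : n%:R `^ (- delta) * mesh n = n%:R^-1.
  rewrite -powRD; last by apply/implyP => _; rewrite gt_eqF.
  by rewrite -powR_inv1//; congr (_ `^ _); ring.
rewrite /regressor e1 -exprMn /site -/(mesh n) mulrCA e2.
by [].
Qed.

Definition in_box (m M : R) (th : R * R * R) : Prop :=
  [/\ m <= v2 th <= M, m <= sigma2 th <= M & m <= kappa th <= M].

Section box.
Variables (m M : R) (m0 : 0 < m).

Lemma rho_bounds n th : (0 < n)%N -> in_box m M th ->
  let rho := expR (- (kappa th * mesh n)) in
  [/\ 0 < rho, rho < 1, m / (1 + M) * mesh n <= 1 - rho & 1 - rho <= M * mesh n].
Proof.
move=> n0 [_ _ /andP[mk kM]] /=; have h0 := mesh_gt0 n0; have h1 := mesh_le1 n0.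
have k0 : 0 < kappa th by rewrite (lt_le_trans m0).
have kh : 0 < kappa th * mesh n by rewrite mulr_gt0.
split.
- exact: expR_gt0.
- by rewrite expR_lt1 oppr_lt0.
- have e1 : 1 + kappa th * mesh n <= expR (kappa th * mesh n) by exact: expR_ge1Dx.
  have e0 : 0 < 1 + kappa th * mesh n by lra.
  have : expR (- (kappa th * mesh n)) <= (1 + kappa th * mesh n)^-1.
    by rewrite expRN lef_pV2 ?posrE ?expR_gt0.
  have : m / (1 + M) * mesh n <= 1 - (1 + kappa th * mesh n)^-1.
    have -> : 1 - (1 + kappa th * mesh n)^-1 = (kappa th * mesh n) / (1 + kappa th * mesh n).
      by field; rewrite gt_eqF.
    rewrite mulrAC; apply: ler_pM => //.
    + by rewrite mulr_ge0// ltW.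
    + by rewrite invr_ge0; lra.
    + by apply: ler_wpM2r => //; exact: ltW.
    + rewrite lef_pV2 ?posrE//; last by lra.
      rewrite lerD2l (le_trans _ kM)// ler_piMr// ltW//.
  lra.
- have e1 : 1 + - (kappa th * mesh n) <= expR (- (kappa th * mesh n)) by exact: expR_ge1Dx.
  have : kappa th * mesh n <= M * mesh n by apply: ler_wpM2r => //; exact: ltW.
  lra.
Qed.

Lemma qform_Sigma n th (x : 'cV[R]_n) : qform (Sigma delta n th) x =
  sigma2 th * qform (ar_mx n (expR (- (kappa th * mesh n)))) x + v2 th * \sum_i x i 0 ^+ 2.
Proof.
rewrite Sigma_ar /qform mulmxDr mulmxDl mxE -scalemxAr -scalemxAl mxE; congr (_ + _).
by rewrite mul_mx_scalar -scalemxAl mxE -qform1 /qform mulmx1.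
Qed.

Lemma qform_Sigma_ge n th (x : 'cV[R]_n) : (0 < n)%N -> in_box m M th ->
  m * \sum_i x i 0 ^+ 2 <= qform (Sigma delta n th) x.
Proof.
move=> n0 hb; have [/andP[mv _] /andP[ms _] _] := hb.
have [r0 r1 _ _] := rho_bounds n0 hb.
rewrite qform_Sigma (le_trans (_ : _ <= v2 th * \sum_i x i 0 ^+ 2))//.
  by apply: ler_wpM2r => //; apply: sumr_ge0 => i _; exact: sqr_ge0.
by rewrite lerDr mulr_ge0 ?qform_ar_ge0// (le_trans _ ms)// ltW.
Qed.

Lemma Sigma_posdef n th : (0 < n)%N -> in_box m M th -> posdef (Sigma delta n th).
Proof.
move=> n0 hb; split.
  rewrite Sigma_ar linearD linearZ /= ar_mx_sym tr_scalar_mx//.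
move=> x x0; apply: lt_le_trans (qform_Sigma_ge x n0 hb).
by rewrite mulr_gt0// -qform1; apply: (posdef1 n).2.
Qed.

(** Divided by the mesh it bounds the spectrum of Sigma: M for the nugget, and the rest for M times
    the row sum bound 2 / (1 - rho), since 1 - rho is at least m / (1 + M) times the mesh. *)
Definition Sigma_ub : R := M + 2 * M * ((1 + M) / m).

Lemma qform_Sigma_le n th (x : 'cV[R]_n) : (0 < n)%N -> in_box m M th ->
  qform (Sigma delta n th) x <= Sigma_ub / mesh n * \sum_i x i 0 ^+ 2.
Proof.
move=> n0 hb; have [/andP[mv vM] /andP[ms sM] _] := hb.
have [r0 r1 rl _] := rho_bounds n0 hb.
have h0 := mesh_gt0 n0; have h1 := mesh_le1 n0.
have M0 : 0 < M := lt_le_trans (lt_le_trans m0 mv) vM.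
have S0 : 0 <= \sum_i x i 0 ^+ 2 by apply: sumr_ge0 => i _; exact: sqr_ge0.
rewrite qform_Sigma /Sigma_ub mulrDl addrC mulrDl; apply: lerD.
  apply: ler_wpM2r => //; rewrite (le_trans vM)// ler_peMr ?(ltW M0)//.
  by rewrite invf_ge1.
have := qform_ar_le r0 r1 x; set q := qform _ _ => hq.
apply: (@le_trans _ _ (M * q)).
  by apply: ler_wpM2r => //; exact: qform_ar_ge0.
apply: (@le_trans _ _ (M * (2 / (1 - expR (- (kappa th * mesh n))) * \sum_i x i 0 ^+ 2))).
  by apply: ler_wpM2l => //; exact: ltW.
rewrite [leLHS]mulrA; apply: ler_wpM2r => //.
rewrite [leLHS]mulrA -[leRHS]mulrA [2 * M]mulrC; apply: ler_wpM2l; first by rewrite mulr_ge0// ltW.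
rewrite (_ : (1 + M) / m / mesh n = (m / (1 + M) * mesh n)^-1) ; last by rewrite invfM invf_div.
rewrite lef_pV2 ?posrE ?subr_gt0//.
by rewrite mulr_gt0// divr_gt0//; lra.
Qed.

End box.

End covariance.

(** * Scores of the monomials and dependence of Sigma on the parameter *)

Section score.
Context {R : realType}.
Variable delta : R.
Hypothesis delta01 : 0 < delta < 1.
Variables (m M : R) (m0 : 0 < m).

(** The bound of [grid_pow_defect] divided by s2 (1 - rho). It is free of n because 1 / n is at most
    the mesh, hence at most a multiple of 1 - rho. *)
Definition score_bound (p : nat) : R :=
  (3 * (p%:R * 2 ^+ p) / (m / (1 + M)) + 2) / m.

Lemma Sigma_score n p j th (u : 'cV[R]_n) : (1 < n)%N -> (j <= p)%N -> in_box m M th ->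
  Sigma delta n th *m u = \col_i grid_pow n j i ->
  exists (t : R) (e : 'cV[R]_n), [/\ u = t *: (\col_i grid_pow n j i) + e,
    0 <= t <= M / m * mesh delta n & \sum_i `|e i 0| <= score_bound p].
Proof.
move=> n1 jp hb Su; have n0 : (0 < n)%N := ltnW n1.
have [/andP[mv vM] /andP[ms sM] _] := hb.
have [r0 r1 rl ru] := rho_bounds delta01 m0 n0 hb.
have v0 : 0 < v2 th := lt_le_trans m0 mv.
have s0 : 0 < sigma2 th := lt_le_trans m0 ms.
rewrite Sigma_ar// in Su.
have [t [e [ue /andP[t0 tu] eb]]] := ar_score r0 r1 n1 s0 v0 Su (grid_pow_defect j r0 r1 n1).
set rho := expR _ in r0 r1 rl ru tu eb.
have r10 : 0 < 1 - rho by rewrite subr_gt0.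
exists t, e; split=> //.
  rewrite t0/= (le_trans tu)// mulrAC; apply: ler_pM => //; first exact: ltW.
    by rewrite invr_ge0 ltW.
  by rewrite lef_pV2.
apply: (le_trans eb).
rewrite invfM mulrCA mulrC /score_bound; apply: ler_pM.
- by rewrite mulr_ge0 ?invr_ge0 ?(ltW r10)// addr_ge0 ?mulr_ge0 ?invr_ge0 ?exprn_ge0 ?(ltW r10)//.
- by rewrite invr_ge0 ltW.
- have c0 : 0 < m / (1 + M) by rewrite divr_gt0//; lra.
  have nh : n%:R^-1 <= mesh delta n := invn_le_mesh delta01 n0.
  have c1 : m / (1 + M) * n%:R^-1 <= 1 - rho by apply: le_trans rl; apply: ler_wpM2l => //; exact: ltW.
  rewrite ler_pdivrMr// [leRHS]mulrDl; apply: lerD => //.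
  have jj : j%:R * 2 ^+ j <= p%:R * 2 ^+ p :> R.
    by rewrite -!natrX -!natrM ler_nat leq_mul// leq_pexp2l.
  have nn : n%:R^-1 <= (m / (1 + M))^-1 * (1 - rho) by rewrite ler_pdivlMl.
  have n0' : 0 <= n%:R^-1 :> R by rewrite invr_ge0.
  rewrite -[leRHS]mulrA -[leRHS]mulrA; apply: ler_wpM2l => //.
  exact: ler_pM.
- by rewrite lef_pV2.
Qed.

Lemma expR_dist_le (x y : R) : 0 <= x -> 0 <= y -> `|expR (- x) - expR (- y)| <= `|x - y|.
Proof.
wlog xy : x y / x <= y.
  move=> hw x0 y0; case: (leP x y) => [|/ltW] xy; first exact: hw.
  by rewrite distrC [leRHS]distrC hw.
move=> x0 y0; rewrite ger0_norm ?subr_ge0 ?ler_expR ?lerN2//.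
rewrite distrC ger0_norm ?subr_ge0//.
have e1 : expR (- x) * expR (- (y - x)) = expR (- y) by rewrite -expRD; congr expR; ring.
have e2 : 1 + - (y - x) <= expR (- (y - x)) by exact: expR_ge1Dx.
have e3 : expR (- x) <= 1 by rewrite -expR0 ler_expR oppr_le0.
have : expR (- x) * (1 + - (y - x)) <= expR (- y) by rewrite -e1; apply: ler_wpM2l.
have : expR (- x) * (y - x) <= 1 * (y - x) by apply: ler_wpM2r => //; rewrite subr_ge0.
lra.
Qed.

Lemma site_dist_le n (i j : 'I_n) : `|site delta i - site delta j| <= n%:R.
Proof.
have n0 : (0 < n)%N by rewrite (leq_ltn_trans _ (ltn_ord i)).
have h0 := mesh_gt0 delta n0; have h1 := mesh_le1 delta01 n0.
have sb (k : 'I_n) : 0 <= site delta k <= n%:R.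
  rewrite /site -/(mesh delta n) mulr_ge0 ?(ltW h0)//=.
  by rewrite (le_trans (ler_piMr _ h1))// ler_nat.
by rewrite ler_norml; have := sb i; have := sb j; lra.
Qed.

(** Entries are Lipschitz in the parameter with a constant of order n, because sites are at most n
    apart, and the passage to the quadratic form costs another n. A polynomial loss is harmless, as
    the grid step will be a smaller power of n. *)
Lemma qform_Sigma_perturb n th th' (x : 'cV[R]_n) (r : R) :
  (0 < n)%N -> 0 <= r -> in_box m M th -> in_box m M th' ->
  [/\ `|v2 th - v2 th'| <= r, `|sigma2 th - sigma2 th'| <= r & `|kappa th - kappa th'| <= r] ->
  `|qform (Sigma delta n th) x - qform (Sigma delta n th') x| <=
    (2 + M) * n%:R ^+ 2 * r * \sum_i x i 0 ^+ 2.
Proof.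
move=> n0 rr hb hb' [hv hs hk].
have [/andP[mv vM] /andP[ms sM] /andP[mk kM]] := hb.
have [/andP[mv' vM'] /andP[ms' sM'] /andP[mk' kM']] := hb'.
have n1 : 1 <= n%:R :> R by rewrite ler1n.
have S0 : 0 <= \sum_i x i 0 ^+ 2 by apply: sumr_ge0 => i _; exact: sqr_ge0.
pose E (t : R * R * R) (i j : 'I_n) := sigma2 t * expR (- kappa t * `|site delta i - site delta j|).
have qE t : qform (Sigma delta n t) x =
    \sum_(i < n) \sum_(j < n) E t i j * (x i 0 * x j 0) + v2 t * \sum_i x i 0 ^+ 2.
  rewrite /Sigma /qform mulmxDr mulmxDl mxE; congr (_ + _).
    rewrite -mulmxA mxE; apply: eq_bigr => i _; rewrite !mxE mulr_sumr.
    by apply: eq_bigr => j _; rewrite !mxE /E; ring.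
  by rewrite mul_mx_scalar -scalemxAl mxE -qform1 /qform mulmx1.
have Ed i j : `|E th i j - E th' i j| <= (1 + M) * n%:R * r.
  rewrite /E; set D := `|site _ i - _|.
  have D0 : 0 <= D by exact: normr_ge0.
  have Dn : D <= n%:R := site_dist_le i j.
  have -> : sigma2 th * expR (- kappa th * D) - sigma2 th' * expR (- kappa th' * D) =
     (sigma2 th - sigma2 th') * expR (- kappa th * D) +
     sigma2 th' * (expR (- kappa th * D) - expR (- kappa th' * D)) by ring.
  have k0 : 0 <= kappa th by rewrite (le_trans _ mk)// ltW.
  have k0' : 0 <= kappa th' by rewrite (le_trans _ mk')// ltW.
  have s0' : 0 <= sigma2 th' by rewrite (le_trans _ ms')// ltW.
  have a1 : `|(sigma2 th - sigma2 th') * expR (- kappa th * D)| <= r.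
    rewrite normrM (ger0_norm (expR_ge0 _)) (le_trans (ler_piMr (normr_ge0 _) _))//.
    by rewrite -expR0 ler_expR mulNr oppr_le0 mulr_ge0.
  have a2 : `|sigma2 th' * (expR (- kappa th * D) - expR (- kappa th' * D))| <= M * (r * n%:R).
    rewrite normrM (ger0_norm s0'); apply: ler_pM => //.
    rewrite !mulNr (le_trans (expR_dist_le _ _)) ?mulr_ge0// -mulrBl normrM (ger0_norm D0).
    by apply: ler_pM.
  rewrite (le_trans (ler_normD _ _))// (le_trans (lerD a1 a2))//.
  have : r * 1 <= r * n%:R by apply: ler_wpM2l.
  lra.
rewrite !qE opprD addrACA -sumrB -mulrBl.
rewrite (le_trans (ler_normD _ _))//.
have b1 : `|(v2 th - v2 th') * \sum_i x i 0 ^+ 2| <= r * \sum_i x i 0 ^+ 2.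
  by rewrite normrM (ger0_norm S0); apply: ler_wpM2r.
have b2 : `|\sum_(i < n) (\sum_(j < n) E th i j * (x i 0 * x j 0) - \sum_(j < n) E th' i j * (x i 0 * x j 0))|
   <= (1 + M) * n%:R * r * (n%:R * \sum_i x i 0 ^+ 2).
  apply: (@le_trans _ _ (\sum_(i < n) \sum_(j < n) (1 + M) * n%:R * r * ((x i 0 ^+ 2 + x j 0 ^+ 2) / 2))).
    rewrite (le_trans (ler_norm_sum _ _ _))//; apply: ler_sum => i _.
    rewrite -sumrB (le_trans (ler_norm_sum _ _ _))//; apply: ler_sum => j _.
    rewrite -[X in `|X|]mulrBl normrM; apply: ler_pM; [exact: normr_ge0|exact: normr_ge0|exact: Ed|].
    rewrite normrM -(real_normK (num_real (x i 0))) -(real_normK (num_real (x j 0))).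
    by have := sqr_ge0 (`|x i 0| - `|x j 0|); rewrite !expr2; lra.
  rewrite le_eqVlt; apply/orP; left; apply/eqP.
  under eq_bigr do rewrite -mulr_sumr.
  rewrite -mulr_sumr; congr (_ * _).
  transitivity (\sum_(i < n) ((n%:R * x i 0 ^+ 2) / 2 + (\sum_(j < n) x j 0 ^+ 2) / 2)).
    apply: eq_bigr => i _; rewrite -mulr_suml big_split/= sumr_const card_ord -[_ *+ n]mulr_natl mulrDl//.
  rewrite big_split/= -!mulr_suml -mulr_sumr sumr_const card_ord -[_ *+ n]mulr_natl; by field.
have n2 : 1 <= n%:R ^+ 2 :> R by rewrite exprn_ege1.
have : r * (\sum_i x i 0 ^+ 2) * 1 <= r * (\sum_i x i 0 ^+ 2) * n%:R ^+ 2.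
  by apply: ler_wpM2l => //; rewrite mulr_ge0.
move: b1 b2; rewrite expr2; lra.
Qed.

End score.

(** * Generalized least squares and model selection *)

Section generalized_least_squares.
Context {R : realType}.

Lemma posdef_inv n (S : 'M[R]_n) : posdef S -> posdef (invmx S).
Proof.
move=> pS; have uS := posdef_unit pS; have [symS pos] := pS.
have sW : (invmx S)^T = invmx S by rewrite trmx_inv symS.
split=> // x x0.
have -> : qform (invmx S) x = qform S (invmx S *m x).
  by rewrite /qform trmx_mul sW -!mulmxA mulKVmx.
apply: pos; apply: contra_neq x0 => h.
by rewrite -[x](mulKVmx uS) h mulmx0.
Qed.

Lemma qformD n (W : 'M[R]_n) (x y : 'cV[R]_n) : W^T = W ->
  qform W (x + y) = qform W x + 2 * (y^T *m W *m x) 0 0 + qform W y.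
Proof.
move=> sW; have xyT : (x + y)^T = x^T + y^T by rewrite linearD.
rewrite /qform xyT !mulmxDl !mulmxDr.
rewrite [LHS]mxE [X in X + _]mxE [X in _ + X]mxE.
have -> : (x^T *m W *m y) 0 0 = (y^T *m W *m x) 0 0.
  by rewrite -[in LHS](trmxK (x^T *m W *m y)) mxE !trmx_mul trmxK sW mulmxA.
ring.
Qed.

(** Pythagoras in the metric W: by the normal equations the residual is W-orthogonal to the columns
    of X, whose injectivity makes the Gram matrix invertible. *)
Lemma gls_min n q (S : 'M[R]_n) (X : 'M[R]_(n, q)) (z : 'cV[R]_n) :
  posdef S -> (forall b : 'cV[R]_q, X *m b = 0 -> b = 0) ->
  let W := invmx S in
  forall b : 'cV[R]_q,
  qform W (z - X *m invmx (X^T *m W *m X) *m X^T *m W *m z) <= qform W (z - X *m b).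
Proof.
move=> pS inj W b; have [sW pW] := posdef_inv pS; rewrite -/W in sW pW.
set G := X^T *m W *m X.
have qG c : qform G c = qform W (X *m c) by rewrite /qform trmx_mul !mulmxA.
have pG : posdef G.
  split; first by rewrite /G !trmx_mul trmxK sW mulmxA.
  move=> c c0; rewrite qG; apply: pW; apply: contra_neq c0; exact: inj.
have uG := posdef_unit pG.
set bh := invmx G *m X^T *m W *m z.
have -> : X *m invmx G *m X^T *m W *m z = X *m bh by rewrite /bh !mulmxA.
set r := z - X *m bh.
have Xr : X^T *m W *m r = 0.
  by rewrite /r mulmxBr mulmxA -/G /bh !mulmxA mulmxV// mul1mx subrr.
have -> : z - X *m b = r + X *m (bh - b) by rewrite /r mulmxBr addrA subrK.
rewrite qformD// trmx_mul -!mulmxA [X^T *m _]mulmxA Xr mulmx0 mxE mulr0 addr0 lerDl.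
have [->|h] := eqVneq (X *m (bh - b)) 0; last exact/ltW/pW.
by rewrite /qform mulmx0 mxE.
Qed.

End generalized_least_squares.

(** * Submodels as coefficient vectors of the full design *)

Section submodels.
Context {R : realType}.
Variable delta : R.
Hypothesis delta01 : 0 < delta < 1.

Lemma design_gram p : exists2 C : R, 0 < C & forall (n : nat) (b : 'cV[R]_p.+1), (p < n)%N ->
  \sum_j b j 0 ^+ 2 <= C / n%:R * \sum_i (design delta n p *m b) i 0 ^+ 2.
Proof.
have [C C0 hC] := @coef_sum_sqr R p.
exists (p.+1%:R * C) => [|n b pn]; first by rewrite mulr_gt0.
pose q : {poly R} := \poly_(j < p.+1) b (inord j) 0.
have qb (j : 'I_p.+1) : q`_j = b j 0 by rewrite coef_poly ltn_ord inord_val.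
have qX (i : 'I_n) : (design delta n p *m b) i 0 = q.[i.+1%:R / n%:R].
  rewrite horner_poly mxE; apply: eq_bigr => j _.
  by rewrite designE// inord_val mulrC.
under [X in _ <= _ * X]eq_bigr do rewrite qX.
set S := \sum_(i < n) _.
rewrite (_ : _ * S = \sum_(j < p.+1) C / n%:R * S); last first.
  by rewrite sumr_const card_ord -[RHS]mulr_natl !mulrA.
by apply: ler_sum => j _; rewrite -qb; apply: hC => //; exact: size_poly.
Qed.

Variables (n p : nat) (a : {set 'I_p}).

Definition model_col (i : 'I_(1 + #|a|)) : 'I_p.+1 :=
  match fintype.split i with inl _ => ord0 | inr k => lift ord0 (enum_val k) end.

Lemma model_col_inj : injective model_col.
Proof.
move=> i j; rewrite /model_col -{2}[i]fintype.splitK -{2}[j]fintype.splitK.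
case: (fintype.split i) => [i0|i1]; case: (fintype.split j) => [j0|j1] //=.
- by rewrite (ord1 i0) (ord1 j0).
- by move/lift_inj/enum_val_inj ->.
Qed.

Lemma submodel_designE :
  submodel_design delta n a = colsub model_col (design delta n p).
Proof.
apply/matrixP => i j; rewrite !mxE /model_col.
by case: (fintype.split j) => k; rewrite !mxE.
Qed.

(** Extension by zero of the coefficients of a submodel. *)
Definition model_embed (b : 'cV[R]_(1 + #|a|)) : 'cV[R]_p.+1 :=
  \col_j \sum_i b i 0 *+ (model_col i == j).

Lemma model_embedE b : submodel_design delta n a *m b = design delta n p *m model_embed b.
Proof.
rewrite submodel_designE; apply/matrixP => i j; rewrite !ord1 !mxE {j}.
under [RHS]eq_bigr do rewrite [model_embed _ _ _]mxE mulr_sumr.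
rewrite exchange_big /=; apply: eq_bigr => j _.
rewrite (bigD1 (model_col j))//= eqxx big1 ?addr0 => [|k /negbTE kj].
  by rewrite [colsub _ _ _ _]mxE.
by rewrite eq_sym kj mulr0n mulr0.
Qed.

Lemma model_embed_col b i : model_embed b (model_col i) 0 = b i 0.
Proof.
rewrite mxE (bigD1 i)//= eqxx big1 ?addr0// => k ki.
by rewrite (inj_eq model_col_inj) (negbTE ki).
Qed.

Lemma model_embed_out b (j : 'I_p) : j \notin a -> model_embed b (lift ord0 j) 0 = 0.
Proof.
move=> ja; rewrite mxE big1// => i _; rewrite /model_col.
case: (fintype.split i) => k; rewrite ?(negbTE (neq_lift _ _))//.
rewrite (inj_eq lift_inj) (_ : (enum_val k == j) = false)//.
by apply: contraNF ja => /eqP <-; exact: enum_valP.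
Qed.

Lemma submodel_design_inj (b : 'cV[R]_(1 + #|a|)) : (p < n)%N ->
  submodel_design delta n a *m b = 0 -> b = 0.
Proof.
move=> pn; rewrite model_embedE => h; have [C C0 hC] := design_gram p.
have := hC n (model_embed b) pn; rewrite h [X in _ <= _ * X]big1 ?mulr0 => [|i _]; last first.
  by rewrite mxE expr0n.
move=> le0; apply/colP => i; rewrite [RHS]mxE -model_embed_col; apply/eqP.
rewrite -sqrf_eq0 eq_le sqr_ge0 andbT (le_trans _ le0)//.
rewrite (bigD1 (model_col i))//= lerDl.
by apply: sumr_ge0 => j _; exact: sqr_ge0.
Qed.

Lemma correct_model_mean (beta0 : 'cV[R]_p.+1) : (0 < n)%N -> correct_model delta n beta0 a ->
  exists b, submodel_design delta n a *m b = design delta n p *m beta0.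
Proof.
move=> n0 [b0 [b hb]].
exists (\col_i match fintype.split i with inl _ => b0 | inr k => b (enum_val k) end).
apply/matrixP => i j; rewrite !ord1 {j} submodel_designE.
have si : 0 <= site delta i <= n%:R `^ delta.
  have h0 := mesh_gt0 delta n0.
  rewrite /site -/(mesh delta n) mulr_ge0 ?(ltW h0)//= -(natr_mesh delta n0).
  by apply: ler_wpM2r; [exact: ltW|rewrite ler_nat].
have designR k : design delta n p i (lift ord0 k) = regressor delta n k.+1 (site delta i).
  by rewrite mxE.
have := hb _ si.
have -> : true_mean delta n beta0 (site delta i) = (design delta n p *m beta0) i 0.
  rewrite mxE big_ord_recl [design _ _ _ _ _]mxE eqxx mul1r /true_mean; congr (_ + _).
  by apply: eq_bigr => k _; rewrite designR mulrC.
move=> ->; rewrite mxE big_split_ord /= big_ord1; congr (_ + _).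
  by rewrite !mxE /model_col (fintype.unsplitK (inl _ : 'I_1 + 'I_#|a|)) mul1r.
rewrite [RHS]big_enum_val; apply: eq_bigr => k _.
rewrite mxE [(\col_ _ _) _ _]mxE /model_col (fintype.unsplitK (inr k : 'I_1 + 'I_#|a|)).
by rewrite designR mulrC.
Qed.

Lemma correct_model_coef (beta0 : 'cV[R]_p.+1) :
  (forall j, j \notin a -> beta0 (lift ord0 j) 0 = 0) -> correct_model delta n beta0 a.
Proof.
move=> h; exists (beta0 ord0 0), (fun j => beta0 (lift ord0 j) 0) => s _.
rewrite /true_mean; congr (_ + _).
rewrite (bigID (mem a)) /= [X in _ + X]big1 ?addr0// => j ja.
by rewrite h// mul0r.
Qed.

End submodels.

(** * The deterministic part of the selection argument *)

Section selection.
Context {R : realType}.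
Variables (delta : R) (n p : nat).
Hypotheses (delta01 : 0 < delta < 1) (pn : (p < n)%N).

Definition profile (a : {set 'I_p}) (z : 'cV[R]_n) (th : R * R * R) : R :=
  ln (\det (Sigma delta n th)) + qform (invmx (Sigma delta n th)) (z - mu_hat delta a th z).

Lemma loglikE a z th : - 2 * loglik delta a z th = n%:R * ln (2 * pi) + profile a z th.
Proof. by rewrite /loglik /profile /qform; field. Qed.

Lemma is_MLE_le (Theta : set (R * R * R)) a z th th' :
  is_MLE delta Theta a z th -> Theta th' -> profile a z th <= profile a z th'.
Proof.
move=> [_ h] th'T.
have : ((loglik delta a z th')%:E <= (loglik delta a z th)%:E)%E.
  by rewrite h; apply: ereal_sup_ubound; exists th'.
by rewrite lee_fin => l; have := loglikE a z th; have := loglikE a z th'; lra.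
Qed.

Lemma profile_le (a : {set 'I_p}) z th b : posdef (Sigma delta n th) ->
  profile a z th <= ln (\det (Sigma delta n th)) +
    qform (invmx (Sigma delta n th)) (z - submodel_design delta n a *m b).
Proof.
move=> pS; rewrite /profile lerD2l; apply: gls_min => // c.
exact: (submodel_design_inj delta01 pn).
Qed.

Lemma mu_hatE (a : {set 'I_p}) th (z : 'cV[R]_n) : exists b : 'cV[R]_(1 + #|a|), mu_hat delta a th z = design delta n p *m model_embed b.
Proof.
by eexists; rewrite -model_embedE /mu_hat -!mulmxA.
Qed.

(* Completing the square in each coordinate of b. *)
Lemma qform_shift_ge th (e : 'cV[R]_n) (b : 'cV[R]_p.+1) (K s : R) :
  let W := invmx (Sigma delta n th) in
  posdef (Sigma delta n th) -> 0 < K ->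
  K * (\sum_j b j 0 ^+ 2) <= qform W (design delta n p *m b) ->
  (forall j, `|((col j (design delta n p))^T *m W *m e) 0 0| <= s) ->
  qform W e + K / 2 * (\sum_j b j 0 ^+ 2) - 2 * p.+1%:R * s ^+ 2 / K <=
  qform W (e + design delta n p *m b).
Proof.
move=> W pS K0 hK hs; have [sW _] := posdef_inv pS; rewrite -/W in sW.
rewrite qformD//.
set X := design delta n p in hK hs *.
have XE : ((X *m b)^T *m W *m e) 0 0 = \sum_j b j 0 * ((col j X)^T *m W *m e) 0 0.
  rewrite trmx_mul -!mulmxA mxE; apply: eq_bigr => j _; rewrite [b^T _ _]mxE; congr (_ * _).
  rewrite -[in RHS]mulmxA [LHS]mxE [RHS]mxE; apply: eq_bigr => i _.
  by congr (_ * _); rewrite !mxE.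
rewrite XE.
have h : - (2 * p.+1%:R * s ^+ 2 / K) <= \sum_j (2 * (b j 0 * ((col j X)^T *m W *m e) 0 0) + K / 2 * b j 0 ^+ 2).
  rewrite (_ : - _ = \sum_(j < p.+1) - (2 * s ^+ 2 / K)); last first.
    by rewrite sumr_const card_ord -[RHS]mulr_natl; ring.
  apply: ler_sum => j _; set u := b j 0; set v := (_ *m _) 0 0.
  have hv : v ^+ 2 <= s ^+ 2.
    have s0 : 0 <= s := le_trans (normr_ge0 _) (hs j).
    by rewrite -(real_normK (num_real v)) lerXn2r ?nnegrE ?normr_ge0// hs.
  have e1 : 2 * (u * v) + K / 2 * u ^+ 2 + 2 * v ^+ 2 / K = (K * u + 2 * v) ^+ 2 / (2 * K).
    by field; rewrite gt_eqF.
  have e2 : 0 <= (K * u + 2 * v) ^+ 2 / (2 * K) by rewrite divr_ge0 ?sqr_ge0// mulr_ge0// ltW.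
  have e3 : 2 * v ^+ 2 / K <= 2 * s ^+ 2 / K.
    by apply: ler_wpM2r; [rewrite invr_ge0 ltW|apply: ler_wpM2l].
  lra.
rewrite big_split/= -!mulr_sumr in h.
lra.
Qed.

(** The two final comparisons in plain real variables: P and Q stand for the profiles of the
    selected and of the smallest correct model, U and V for log det S + e'S^-1 e at the estimate of
    the selected model and at theta0. *)
Let arith_under (L P Q U V Kb Km c tk tk' tp g : R) :
  U + Kb - c <= P -> L + P + tk <= L + Q + tk' -> Q <= V -> V - g <= U ->
  Km <= Kb -> tk' <= tp -> 0 <= tk -> g + c + tp < Km -> False.
Proof. lra. Qed.

Let arith_over (L P Q U Kb c tk tk' t : R) :
  U + Kb - c <= P -> L + P + tk <= L + Q + tk' -> Q <= U -> 0 <= Kb ->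
  tk' + t <= tk -> c < t -> False.
Proof. lra. Qed.

Section correct_selection.
Variables (Theta : set (R * R * R)) (th0 : R * R * R) (beta0 : 'cV[R]_p.+1)
  (z : 'cV[R]_n) (a0 : {set 'I_p}) (thetahat : {set 'I_p} -> R * R * R)
  (tau K s g bm : R).
Let X := design delta n p.
Let e := z - X *m beta0.
Let W th := invmx (Sigma delta n th).
Hypotheses (hth0 : Theta th0) (posS : forall th, Theta th -> posdef (Sigma delta n th))
  (ha0 : smallest_correct_model delta n beta0 a0)
  (hMLE : forall a, nested_models a -> is_MLE delta Theta a z (thetahat a))
  (K0 : 0 < K)
  (hK : forall th (b : 'cV[R]_p.+1), Theta th -> K * (\sum_j b j 0 ^+ 2) <= qform (W th) (X *m b))
  (hs : forall th j, Theta th -> `|((col j X)^T *m W th *m e) 0 0| <= s)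
  (hg : forall th, Theta th -> ln (\det (Sigma delta n th0)) + qform (W th0) e - g <=
     ln (\det (Sigma delta n th)) + qform (W th) e)
  (hbm : forall j, beta0 j 0 != 0 -> bm <= beta0 j 0 ^+ 2)
  (tau0 : 0 < tau)
  (over : 2 * p.+1%:R * s ^+ 2 / K < tau)
  (under : g + 2 * p.+1%:R * s ^+ 2 / K + tau * p%:R < K / 2 * bm).

Let card_nested k : (k <= p)%N -> #|[set j : 'I_p | (j < k)%N]%SET| = k.
Proof.
move=> kp; have winj : injective (widen_ord kp) by move=> i j h; apply: val_inj; exact: (congr1 val h).
rewrite cardsE -[RHS]card_ord -(card_codom winj).
apply: eq_card => j; apply/idP/codomP => [jk|[i ->]]; last exact: (ltn_ord i).
by exists (Ordinal (jk : (j < k)%N)); exact: val_inj.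
Qed.

(** No probability is left here: the section hypotheses describe a good outcome. Models are nested,
    so a wrong choice is either too small, and then misses a nonzero coefficient, or too large, and
    then pays at least one more tau. *)
Lemma GIC_selects (a : {set 'I_p}) :
  is_argmin (@nested_models p) (GIC delta tau z thetahat) a -> a = a0.
Proof.
move=> [na amin]; have [[na0 ca0] min0] := ha0.
have := amin _ na0; rewrite /GIC !loglikE => le0.
have [bt hbt] := mu_hatE a (thetahat a) z.
have thT : Theta (thetahat a) := (hMLE na).1.
pose b := beta0 - model_embed bt.
have rE : z - mu_hat delta a (thetahat a) z = e + X *m b.
  by rewrite hbt /b mulmxBr /e addrA subrK.
have lb : ln (\det (Sigma delta n (thetahat a))) + qform (W (thetahat a)) e +
    K / 2 * (\sum_j b j 0 ^+ 2) - 2 * p.+1%:R * s ^+ 2 / K <= profile a z (thetahat a).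
  rewrite /profile rE -!addrA lerD2l !addrA.
  by apply: qform_shift_ge => [|//||j]; [exact: posS|exact: hK|exact: hs].
have [bc hbc] := correct_model_mean (leq_ltn_trans (leq0n p) pn) ca0.
have ub th : Theta th -> profile a0 z (thetahat a0) <=
    ln (\det (Sigma delta n th)) + qform (W th) e.
  move=> hth; apply: le_trans (is_MLE_le (hMLE na0) hth) _.
  by have := profile_le z bc (posS hth); rewrite hbc.
have b2 : 0 <= \sum_j b j 0 ^+ 2 by apply: sumr_ge0 => j _; exact: sqr_ge0.
have Kb : 0 <= K / 2 * (\sum_j b j 0 ^+ 2) by rewrite mulr_ge0// divr_ge0// ltW.
have [k kp ak] := na; have [k0 k0p a0k] := na0.
have ca : #|a| = k by rewrite ak card_nested.
have ca0' : #|a0| = k0 by rewrite a0k card_nested.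
rewrite ca ca0' in le0.
have [kk|kk|kk] := ltngtP k k0; last by rewrite ak a0k kk.
(* A model smaller than [a0] cannot be correct, by minimality, so a nonzero coefficient lies outside
   it; its square survives in b since the fitted vector vanishes there. *)
- have [j ja bj] : exists2 j : 'I_p, j \notin a & beta0 (lift ord0 j) 0 != 0.
    apply: contrapT => hno.
    suff /min0 : (@nested_models p `&` correct_model delta n beta0) a.
      by rewrite ca ca0' leEnat leqNgt kk.
    split=> //; apply: correct_model_coef => j ja; apply/eqP/negP => bj.
    by apply: hno; exists j => //; exact/negP.
  have bj2 : bm <= \sum_j b j 0 ^+ 2.
    apply: (le_trans (hbm bj)); rewrite (bigD1 (lift ord0 j))//= /b.
    have -> : (beta0 - model_embed bt) (lift ord0 j) 0 = beta0 (lift ord0 j) 0.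
      rewrite [LHS]mxE -[RHS]addr0; congr (_ + _).
      by rewrite [LHS]mxE model_embed_out ?oppr0.
    rewrite lerDl.
    by apply: sumr_ge0 => i _; exact: sqr_ge0.
  have h1 : K / 2 * bm <= K / 2 * (\sum_j b j 0 ^+ 2).
    by apply: ler_wpM2l => //; rewrite divr_ge0// ltW.
  have h2 : tau * k0%:R <= tau * p%:R by apply: ler_wpM2l; [exact: ltW|rewrite ler_nat].
  have h3 : 0 <= tau * k%:R by rewrite mulr_ge0// ltW.
  have h4 := ub _ hth0; have h5 := hg thT.
  by case: (arith_under lb le0 h4 h5 h1 h2 h3 under).
have h1 : tau * k0%:R + tau <= tau * k%:R.
  by rewrite -{2}[tau]mulr1 -mulrDr natr1; apply: ler_wpM2l; [exact: ltW|rewrite ler_nat].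
(* The smallest correct model is evaluated at the estimate of the selected model, so that the
   likelihood terms on the two sides are identical. *)
have h2 := ub _ thT.
by case: (arith_over lb le0 h2 Kb h1 over).
Qed.

End correct_selection.

End selection.

(** * A finite grid of parameters *)

Section parameter_box.
Context {R : realType}.

Lemma compact_positive_box (Theta : set (R * R * R)) (th0 : R * R * R) :
  compact Theta -> Theta th0 ->
  (forall th, Theta th -> [/\ 0 < v2 th, 0 < sigma2 th & 0 < kappa th]) ->
  exists m M : R, 0 < m /\ forall th, Theta th -> in_box m M th.
Proof.
move=> cT T0 pos.
have T0' : Theta !=set0 by exists th0.
have box (f : R * R * R -> R) : continuous f -> (forall th, Theta th -> 0 < f th) ->
    exists m M : R, 0 < m /\ forall th, Theta th -> m <= f th <= M.
  move=> cf fp.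
  have cfT : {within Theta, continuous f} by exact: continuous_subspaceT.
  have [a aT ha] := compact_EVT_min T0' cT cfT.
  have [b bT hb] := compact_EVT_max T0' cT cfT.
  exists (f a), (f b); split; first by apply: fp; rewrite inE in aT.
  by move=> th thT; rewrite ha ?inE// hb ?inE.
have c1 : continuous (@v2 R).
  move=> x; apply: (@continuous_comp _ _ _ (fun x : R * R * R => x.1) (fun y => y.1)); exact: cvg_fst.
have c2 : continuous (@sigma2 R).
  move=> x; apply: (@continuous_comp _ _ _ (fun x : R * R * R => x.1) (fun y => y.2)); [exact: cvg_fst|exact: cvg_snd].
have c3 : continuous (@kappa R) by move=> x; exact: cvg_snd.
have [m1 [M1 [p1 h1]]] := box _ c1 (fun th h => let: And3 a _ _ := pos th h in a).
have [m2 [M2 [p2 h2]]] := box _ c2 (fun th h => let: And3 _ a _ := pos th h in a).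
have [m3 [M3 [p3 h3]]] := box _ c3 (fun th h => let: And3 _ _ a := pos th h in a).
exists (Num.min m1 (Num.min m2 m3)), (Num.max M1 (Num.max M2 M3)); split.
  by rewrite !lt_min p1 p2 p3.
move=> th hth; have := h1 _ hth; have := h2 _ hth; have := h3 _ hth.
move=> /andP[a3 b3] /andP[a2 b2] /andP[a1 b1].
split; rewrite !ge_min !le_max ?a1 ?a2 ?a3 ?b1 ?b2 ?b3 ?orbT//.
Qed.

Definition grid_point (q : nat) (i : nat * nat * nat) : R * R * R :=
  (i.1.1.+1%:R / q%:R, i.1.2.+1%:R / q%:R, i.2.+1%:R / q%:R).

(** Each coordinate is rounded up to a multiple of 1 / q: the lower bound m is kept, and M is
    exceeded by at most 1 / q <= 1, whence the box up to M + 1. *)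
Lemma grid_point_near (m M : R) (q G : nat) (th : R * R * R) :
  0 < m -> (0 < q)%N -> M * q%:R < G%:R -> in_box m M th ->
  exists i : 'I_G * 'I_G * 'I_G, let th' := grid_point q (i.1.1 : nat, i.1.2 : nat, i.2 : nat) in
    in_box m (M + 1) th' /\
    [/\ `|v2 th - v2 th'| <= q%:R^-1, `|sigma2 th - sigma2 th'| <= q%:R^-1 &
        `|kappa th - kappa th'| <= q%:R^-1].
Proof.
move=> m0 q0 MG [hv hs hk].
have q0' : 0 < q%:R :> R by rewrite ltr0n.
have q1 : q%:R^-1 <= 1 :> R by rewrite invf_le1// ler1n.
have near1 (x : R) : m <= x <= M -> exists i : 'I_G,
    m <= (i.+1%:R : R) / q%:R <= M + 1 /\ `|x - i.+1%:R / q%:R| <= q%:R^-1.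
  move=> /andP[mx xM]; have x0 : 0 <= x * q%:R by rewrite mulr_ge0// (le_trans _ mx)// ltW.
  have /andP[t1 t2] := truncn_itv x0.
  have tG : (Num.truncn (x * q%:R) < G)%N.
    rewrite -(ltr_nat R) (le_lt_trans t1)// (le_lt_trans _ MG)//.
    by apply: ler_wpM2r => //; exact: ltW.
  exists (Ordinal tG) => /=; set T := _.+1%:R in t2 *.
  have a1 : x <= T / q%:R by rewrite ler_pdivlMr// ltW.
  have a2 : T / q%:R <= x + q%:R^-1.
    rewrite ler_pdivrMr// mulrDl mulVf ?gt_eqF// /T -natr1 lerD2r//.
  split; first by apply/andP; split; [exact: le_trans a1|lra].
  by rewrite distrC ger0_norm ?subr_ge0// lerBlDl.
have [i1 [b1 d1]] := near1 _ hv; have [i2 [b2 d2]] := near1 _ hs; have [i3 [b3 d3]] := near1 _ hk.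
by exists (i1, i2, i3); split.
Qed.

End parameter_box.

(** * Spectral and score bounds uniform over the parameter box *)

Section box_estimates.
Context {R : realType}.
Variables (delta m M : R).
Hypotheses (delta01 : 0 < delta < 1) (m0 : 0 < m) (mM : m <= M).

Lemma Sigma_ub_gt0 : 0 < Sigma_ub m M.
Proof.
have M0 : 0 < M := lt_le_trans m0 mM.
by rewrite /Sigma_ub addr_gt0// !mulr_gt0// ?invr_gt0//; lra.
Qed.

Lemma qform_invSigma_ge n th (x : 'cV[R]_n) : (0 < n)%N -> in_box m M th ->
  (Sigma_ub m M)^-1 * mesh delta n * (\sum_i x i 0 ^+ 2) <= qform (invmx (Sigma delta n th)) x.
Proof.
move=> n0 hb; have h0 := mesh_gt0 delta n0.
have h (y : 'cV[R]_n) : qform (Sigma delta n th) y <= Sigma_ub m M / mesh delta n * qform 1%:M y.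
  by rewrite qform1; exact: qform_Sigma_le.
have := qform_inv_ge (posdef1 n) (Sigma_posdef delta01 m0 n0 hb) (divr_gt0 Sigma_ub_gt0 h0) h x.
by rewrite invmx1 qform1 invf_div [mesh _ _ / _]mulrC.
Qed.

Lemma qform_invSigma_le n th (x : 'cV[R]_n) : (0 < n)%N -> in_box m M th ->
  qform (invmx (Sigma delta n th)) x <= m^-1 * \sum_i x i 0 ^+ 2.
Proof.
move=> n0 hb.
have h (y : 'cV[R]_n) : m * qform 1%:M y <= qform (Sigma delta n th) y.
  by rewrite qform1; exact: (qform_Sigma_ge delta01 m0 y n0 hb).
have := qform_inv_le (posdef1 n) (Sigma_posdef delta01 m0 n0 hb) m0 h x.
by rewrite invmx1 qform1.
Qed.

(** [Sigma_score] writes S^-1 x as t x + r. The first part meets x'e, and Hoelder's inequality pairs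
    the l^1 norm of r with the largest entry of e. *)
Lemma score_le n p (j : 'I_p.+1) th (e : 'cV[R]_n) (a b : R) :
  (1 < n)%N -> in_box m M th -> 0 <= b ->
  `|((col j (design delta n p))^T *m e) 0 0| <= a -> (forall i, `|e i 0| <= b) ->
  `|((col j (design delta n p))^T *m invmx (Sigma delta n th) *m e) 0 0| <=
    M / m * mesh delta n * a + score_bound m M p * b.
Proof.
move=> n1 hb b0 ha he; have n0 : (0 < n)%N := ltnW n1.
have pS := Sigma_posdef delta01 m0 n0 hb; have [sW _] := posdef_inv pS.
set W := invmx _ in sW *; set x := col j _ in ha *.
have xE : x = \col_i grid_pow n j i.
  by apply/colP => i; rewrite [LHS]mxE designE// [RHS]mxE.
have Sx : Sigma delta n th *m (W *m x) = \col_i grid_pow n j i.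
  by rewrite mulKVmx ?posdef_unit.
have [t [r [ue /andP[t0 tb] rb]]] := Sigma_score delta01 m0 n1 (ltn_ord j : j <= p)%N hb Sx.
have -> : (x^T *m W *m e) 0 0 = t * (x^T *m e) 0 0 + \sum_i r i 0 * e i 0.
  have -> : x^T *m W = (W *m x)^T by rewrite trmx_mul sW.
  rewrite ue -xE linearD linearZ /= mulmxDl mxE -scalemxAl mxE; congr (_ + _).
  by rewrite mxE; apply: eq_bigr => i _; rewrite mxE.
rewrite (le_trans (ler_normD _ _))//; apply: lerD.
  by rewrite normrM (ger0_norm t0); apply: ler_pM.
rewrite (le_trans (ler_norm_sum _ _ _))//.
apply: (@le_trans _ _ (\sum_i `|r i 0| * b)).
  by apply: ler_sum => i _; rewrite normrM; apply: ler_wpM2l.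
by rewrite -mulr_suml; apply: ler_wpM2r.
Qed.

Lemma qform_design_le n p (j : 'I_p.+1) th : (0 < n)%N -> in_box m M th ->
  qform (Sigma delta n th) (col j (design delta n p)) <= Sigma_ub m M / mesh delta n * n%:R.
Proof.
move=> n0 hb; apply: le_trans (qform_Sigma_le delta01 m0 _ n0 hb) _.
apply: ler_wpM2l; first by rewrite divr_ge0 ?ltW// ?Sigma_ub_gt0// mesh_gt0.
apply: (@le_trans _ _ (\sum_(i < n) 1)); last by rewrite sumr_const card_ord.
apply: ler_sum => i _; rewrite [col _ _ _ _]mxE designE//.
by have /andP[g0 g1] := @grid_pow01 R n j i (ltn_ord i); rewrite exprn_ile1.
Qed.

Lemma qform_delta_le n th (i : 'I_n) : in_box m M th ->
  qform (Sigma delta n th) (delta_mx i 0) <= 2 * M.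
Proof.
move=> [/andP[_ vM] /andP[_ sM] _].
rewrite /qform trmx_delta -rowE -colE !mxE subrr normr0 mulr0 expR0 eqxx mulr1 mulr1n; lra.
Qed.

End box_estimates.

(** * Limits of the error terms *)

Section limits.
Context {R : realType}.

(** The exponential dominates the term of degree l + 1 of its series, and l is chosen with a (l + 1)
    >= k + 1, so a factor 1 / n remains. *)
Lemma cvg_natX_expR (k : nat) (a c : R) : 0 < a -> 0 < c ->
  (n%:R ^+ k * expR (- (c * n%:R `^ a))) @[n --> \oo] --> (0 : R).
Proof.
move=> a0 c0.
pose l := Num.truncn ((k.+1)%:R / a).
have la : k.+1%:R <= a * l.+1%:R.
  have := @truncn_itv R (k.+1%:R / a); rewrite divr_ge0 ?(ltW a0)// => /(_ isT)/andP[_].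
  by rewrite ltr_pdivrMr// mulrC => /ltW.
pose C : R := l.+1`!%:R / c ^+ l.+1.
have C0 : 0 < C by rewrite divr_gt0// ?exprn_gt0// ltr0n fact_gt0.
have hC : (fun n : nat => C * n.+1%:R^-1) @ \oo --> (0 : R).
  by rewrite -[X in _ --> X](mulr0 C); apply: cvgM; [exact: cvg_cst|exact: cvg_harmonic].
rewrite -(cvg_shiftS (fun n => n%:R ^+ k * expR (- (c * n%:R `^ a)))).
apply: (@squeeze_cvgr _ _ _ _ (fun _ => 0) (fun n : nat => C * n.+1%:R^-1)) => //; last exact: cvg_cst.
apply: nearW => n; rewrite mulr_ge0 ?expR_ge0 ?exprn_ge0//=.
set N : R := n.+1%:R; have N0 : 0 < N by rewrite ltr0n.
have N1 : 1 <= N by rewrite ler1n.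
have x0 : 0 <= c * N `^ a by rewrite mulr_ge0 ?powR_ge0// ltW.
have e1 : (c * N `^ a) ^+ l.+1 / l.+1`!%:R <= expR (c * N `^ a).
  by rewrite (le_trans _ (expR_ge1Dxn l x0))// lerDr.
have e2 : N ^+ k.+1 <= (N `^ a) ^+ l.+1.
  rewrite -!powR_mulrn ?powR_ge0 ?(ltW N0)// -powRrM.
  exact: ler_powR.
have e3 : N ^+ k.+1 / C <= expR (c * N `^ a).
  apply: le_trans e1; rewrite /C invf_div exprMn.
  rewrite [leRHS](_ : _ = (N `^ a) ^+ l.+1 * (c ^+ l.+1 / l.+1`!%:R)); last by rewrite mulrCA mulrA mulrC.
  by apply: ler_wpM2r => //; rewrite divr_ge0// exprn_ge0// ltW.
rewrite ler_pdivrMr// in e3.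
by rewrite expRN ler_pdivrMr ?expR_gt0// mulrAC ler_pdivlMr// -exprSr [leRHS]mulrC.
Qed.

Lemma cvg_expR_sqrt (tau : nat -> R) (c : R) : 0 < c -> tau @ \oo --> +oo ->
  expR (- (c * Num.sqrt (tau n))) @[n --> \oo] --> (0 : R).
Proof.
move=> c0 htau.
apply/cvgrPdist_lt => e e0.
move/cvgryPge: htau => /(_ ((`|ln e| + 1) ^+ 2 / c ^+ 2)) h.
near=> n; rewrite sub0r normrN ger0_norm ?expR_ge0//.
rewrite -[ltRHS]lnK ?posrE// ltr_expR.
have h1 : (`|ln e| + 1) / c <= Num.sqrt (tau n).
  rewrite -[leLHS]ger0_norm; last by rewrite divr_ge0 ?addr_ge0// ltW.
  rewrite -sqrtr_sqr; apply: ler_wsqrtr; rewrite expr_div_n.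
  by near: n.
have h2 : `|ln e| + 1 <= c * Num.sqrt (tau n) by rewrite mulrC -ler_pdivrMr.
have := ler_norm (- ln e); rewrite normrN; lra.
Unshelve. all: by end_near. Qed.

End limits.

Section union_bounds.
Context {R : realType} d (T : measurableType d) (P : probability T R).

Lemma prob_exists_le (I : finType) (F : I -> set T) (b : R) :
  (forall i, measurable (F i)) -> (forall i, (P (F i) <= b%:E)%E) ->
  measurable [set w | exists i, F i w] /\
  (P [set w | exists i, F i w] <= (#|I|%:R * b)%:E)%E.
Proof.
move=> mF Fb.
have E : [set w | exists i, F i w] = \big[setU/set0]_(i <- enum I) F i.
  rewrite -bigcup_seq; apply/seteqP; split => w [i]; last by exists i.
  by move=> Fw; exists i => //=; rewrite mem_enum.
rewrite E cardE; elim: (enum I) => [|i s [mIH IH]].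
  by rewrite big_nil mul0r measure0; split.
rewrite big_cons; split; first exact: measurableU.
rewrite (le_trans (measureU2 _ _ _))//= -natr1 mulrDl mul1r EFinD addeC.
exact: leeD.
Qed.

Lemma prob_ge_of_cover (A B : set T) (b : R) : measurable A -> measurable B ->
  ~` B `<=` A -> (P B <= b%:E)%E -> ((1 - b)%:E <= P A)%E.
Proof.
move=> mA mB BA Bb.
have : (P setT <= P A + P B)%E.
  apply: le_trans (measureU2 _ mA mB).
  apply: le_measure; rewrite ?inE//; first exact: measurableU.
  by move=> w _; have [Bw|/BA] := pselect (B w); [right|left].
rewrite probability_setT => h.
have fA := fin_num_measure P _ mA; have fB := fin_num_measure P _ mB.
move: h Bb; rewrite -(fineK fA) -(fineK fB) -EFinD !lee_fin; lra.
Qed.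

End union_bounds.

(** * From the grid to all parameters *)

Section events.
Context {R : realType}.
Variables (delta m M : R).
Hypotheses (delta01 : 0 < delta < 1) (m0 : 0 < m) (mM : m <= M).

Lemma in_boxW th : in_box m M th -> in_box m (M + 1) th.
Proof. by move=> [/andP[a1 a2] /andP[b1 b2] /andP[c1 c2]]; split; lra. Qed.

(* A grid step n^-6 perturbs Sigma by a relative error of order n^-4, which makes
   up for |e|^2 <= n^3 B. *)
Lemma loglik_grid_le n th th' (e : 'cV[R]_n) (B : R) : (0 < n)%N ->
  in_box m M th -> in_box m (M + 1) th' ->
  [/\ `|v2 th - v2 th'| <= (n ^ 6)%:R^-1, `|sigma2 th - sigma2 th'| <= (n ^ 6)%:R^-1 &
      `|kappa th - kappa th'| <= (n ^ 6)%:R^-1] ->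
  \sum_i e i 0 ^+ 2 <= n%:R ^+ 3 * B -> (3 + M) / m / n%:R ^+ 4 <= 2^-1 ->
  ln (\det (Sigma delta n th')) + qform (invmx (Sigma delta n th')) e
    - (3 + M) / m * (2 + B / m) <=
  ln (\det (Sigma delta n th)) + qform (invmx (Sigma delta n th)) e.
Proof.
move=> n0 hb hb' hd eB eta2.
have n0' : 0 < n%:R :> R by rewrite ltr0n.
have n1 : 1 <= n%:R :> R by rewrite ler1n.
have M0 : 0 < M := lt_le_trans m0 mM.
set eta := (3 + M) / m / n%:R ^+ 4 in eta2.
have eta0 : 0 <= eta by rewrite !divr_ge0 ?exprn_ge0 ?(ltW m0)//; lra.
have hb1 := in_boxW hb.
have p0 := Sigma_posdef delta01 m0 n0 hb'; have p1 := Sigma_posdef delta01 m0 n0 hb1.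
have r0 : 0 <= (n ^ 6)%:R^-1 :> R by rewrite invr_ge0.
have pert (x : 'cV[R]_n) : `|qform (Sigma delta n th) x - qform (Sigma delta n th') x| <=
    eta * qform (Sigma delta n th') x.
  apply: le_trans (qform_Sigma_perturb delta01 m0 x n0 r0 hb1 hb' hd) _.
  have -> : (2 + (M + 1)) * n%:R ^+ 2 * (n ^ 6)%:R^-1 * \sum_i x i 0 ^+ 2 =
     eta * (m * \sum_i x i 0 ^+ 2).
    rewrite /eta natrX; field.
    by rewrite gt_eqF// gt_eqF.
  by apply: ler_wpM2l => //; exact: (qform_Sigma_ge delta01 m0 x n0 hb').
have et : 0 <= eta <= 2^-1 by rewrite eta0.
have := loglik_perturb e p0 p1 et pert.
have q1 : eta * qform (invmx (Sigma delta n th')) e <= (3 + M) / m * (B / m).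
  apply: (@le_trans _ _ (eta * (m^-1 * (n%:R ^+ 3 * B)))).
    apply: ler_wpM2l => //; apply: le_trans (qform_invSigma_le delta01 m0 e n0 hb') _.
    by apply: ler_wpM2l => //; rewrite invr_ge0 ltW.
  have B0 : 0 <= B.
    rewrite -(pmulr_rge0 B (exprn_gt0 3 n0')); apply: le_trans eB.
    by apply: sumr_ge0 => i _; exact: sqr_ge0.
  rewrite (_ : eta * _ = (3 + M) / m * (B / m) * n%:R^-1).
    rewrite ler_piMr ?invf_le1//.
    by rewrite !mulr_ge0 ?invr_ge0 ?(ltW m0)//; lra.
  by rewrite /eta; field; rewrite !gt_eqF.
have q2 : n%:R * (2 * eta) <= (3 + M) / m * 2.
  rewrite (_ : n%:R * (2 * eta) = (3 + M) / m * 2 * (n%:R ^+ 3)^-1).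
    rewrite ler_piMr ?invf_le1 ?exprn_gt0 ?exprn_ege1//.
    by rewrite !mulr_ge0 ?invr_ge0 ?(ltW m0)//; lra.
  by rewrite /eta; field; rewrite !gt_eqF.
lra.
Qed.

End events.

Section good_events.
Context {R : realType} d (T : measurableType d) (P : probability T R).
Variables (delta m M : R).
Hypotheses (delta01 : 0 < delta < 1) (m0 : 0 < m) (mM : m <= M).

Lemma measurable_form n (Z : T -> 'cV[R]_n) (mu a : 'cV[R]_n) :
  (forall i, measurable_fun setT (fun w => Z w i 0)) ->
  measurable_fun setT (fun w => (a^T *m (Z w - mu)) 0 0).
Proof.
move=> mZ; rewrite (_ : (fun w => _) = fun w => \sum_j a j 0 * (Z w j 0 - mu j 0)).
  by apply: measurable_sum => j; apply: measurable_funM => //; exact: measurable_funB.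
by apply/funext => w; rewrite mxE; apply: eq_bigr => j _; rewrite !mxE.
Qed.

Lemma measurable_qform n (Z : T -> 'cV[R]_n) (mu : 'cV[R]_n) (W : 'M[R]_n) :
  (forall i, measurable_fun setT (fun w => Z w i 0)) ->
  measurable_fun setT (fun w => qform W (Z w - mu)).
Proof.
move=> mZ; rewrite (_ : (fun w => _) = fun w =>
  \sum_j (W *m (Z w - mu)) j 0 * (Z w j 0 - mu j 0)).
  apply: measurable_sum => j; apply: measurable_funM; first exact: measurable_mulmx.
  exact: measurable_funB.
apply/funext => w; rewrite /qform -mulmxA mxE; apply: eq_bigr => j _.
by rewrite mulrC; congr (_ * _); rewrite !mxE.
Qed.

(** Three union bounds, over the p + 1 columns, the n coordinates and the G^3 grid points. The union
    over coordinates serves both the remainder of the scores and the size of e in the passage from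
    the grid to all parameters. *)
Lemma good_event n p (Z : T -> 'cV[R]_n) (mu : 'cV[R]_n) (th0 : R * R * R)
    (y1 y2 t : R) (q G : nat) :
  (0 < n)%N -> gaussian_vector P Z mu (Sigma delta n th0) -> in_box m M th0 ->
  exists Bad : set T, [/\ measurable Bad,
    (P Bad <= (p.+1%:R * (2 * expR (2^-1 - y1)) + n%:R * (2 * expR (2^-1 - y2)) +
       (G * G * G)%:R * (2 * expR (- (t / 4))))%:E)%E &
    forall w, ~ Bad w -> let e := Z w - mu in
    [/\ forall j : 'I_p.+1, `|((col j (design delta n p))^T *m e) 0 0| <=
          y1 * Num.sqrt (Sigma_ub m M / mesh delta n * n%:R),
        forall i, `|e i 0| <= y2 * Num.sqrt (2 * M) &
        forall i : 'I_G * 'I_G * 'I_G,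
          let th := grid_point q (i.1.1 : nat, i.1.2 : nat, i.2 : nat) in
          in_box m (M + 1) th ->
          ln (\det (Sigma delta n th0)) + qform (invmx (Sigma delta n th0)) e - t <=
          ln (\det (Sigma delta n th)) + qform (invmx (Sigma delta n th)) e]].
Proof.
move=> n0 gZ hb0; have [mZ _] := gZ.
have p0 := Sigma_posdef delta01 m0 n0 hb0.
have M0 : 0 < M := lt_le_trans m0 mM.
have V1 : 0 < Sigma_ub m M / mesh delta n * n%:R.
  by rewrite mulr_gt0 ?ltr0n// divr_gt0 ?mesh_gt0// Sigma_ub_gt0.
have V2 : 0 < 2 * M by rewrite mulr_gt0.
have mabs (a : 'cV[R]_n) c : measurable [set w | c < `|(a^T *m (Z w - mu)) 0 0|].
  by apply: measurable_gt_cst; apply: measurableT_comp => //; exact: measurable_form.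
have [mA PA'] := @prob_exists_le R _ T P 'I_p.+1
  (fun j => [set w | y1 * Num.sqrt (Sigma_ub m M / mesh delta n * n%:R) <
     `|((col j (design delta n p))^T *m (Z w - mu)) 0 0|]) _ (fun j => mabs _ _)
  (fun j => gaussian_vector_tail y1 gZ p0 V1 (qform_design_le delta01 m0 mM j n0 hb0)).
have [mB PB'] := @prob_exists_le R _ T P 'I_n
  (fun i => [set w | y2 * Num.sqrt (2 * M) < `|((delta_mx i 0 : 'cV[R]_n)^T *m (Z w - mu)) 0 0|]) _ (fun j => mabs _ _)
  (fun i => gaussian_vector_tail y2 gZ p0 V2 (qform_delta_le delta i hb0)).
(* A grid point outside the box contributes the empty event, because the tail bound supposes a
   positive definite covariance. *)
pose D (i : 'I_G * 'I_G * 'I_G) : set T := let th := grid_point q (i.1.1 : nat, i.1.2 : nat, i.2 : nat) in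
  [set w | in_box m (M + 1) th /\ ln (\det (Sigma delta n th)) - ln (\det (Sigma delta n th0)) +
     qform (invmx (Sigma delta n th)) (Z w - mu) - qform (invmx (Sigma delta n th0)) (Z w - mu) < - t].
have mD i : measurable (D i).
  rewrite /D; set th := grid_point _ _; have [hb|hb] := pselect (in_box m (M + 1) th).
    rewrite (_ : mkset _ = [set w | ln (\det (Sigma delta n th)) - ln (\det (Sigma delta n th0)) +
     qform (invmx (Sigma delta n th)) (Z w - mu) - qform (invmx (Sigma delta n th0)) (Z w - mu) < - t]).
      apply: measurable_lt_cst; apply: measurable_funB; last exact: measurable_qform.
      by apply: measurable_funD => //; exact: measurable_qform.
    by apply/seteqP; split => w /= // [].
  rewrite (_ : mkset _ = set0)//; apply/seteqP; split => w //= [].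
  by move=> hb'.
have PD' i : (P (D i) <= (2 * expR (- (t / 4)))%:E)%E.
  rewrite /D; set th := grid_point _ _; have [hb|hb] := pselect (in_box m (M + 1) th).
    have := gaussian_vector_loglik_tail t gZ p0 (Sigma_posdef delta01 m0 n0 hb) (posdef_det_gt0 p0).
    apply: le_trans; rewrite le_eqVlt; apply/orP; left; apply/eqP; congr (P _).
    by apply/seteqP; split => w /= // [].
  rewrite (_ : mkset _ = set0) ?measure0 ?lee_fin ?mulr_ge0 ?expR_ge0//.
  by apply/seteqP; split => w //= [].
have [mC PC'] := prob_exists_le mD PD'.
pose A : set T := [set w | exists j : 'I_p.+1, y1 * Num.sqrt (Sigma_ub m M / mesh delta n * n%:R) <
     `|((col j (design delta n p))^T *m (Z w - mu)) 0 0|].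
pose B : set T := [set w | exists i : 'I_n, y2 * Num.sqrt (2 * M) < `|((delta_mx i 0 : 'cV[R]_n)^T *m (Z w - mu)) 0 0|].
exists ((A `|` B) `|` [set w : T | exists i, D i w]); split.
- by apply: measurableU => //; exact: measurableU.
- apply: le_trans (measureU2 _ _ mC) _; first exact: measurableU.
  rewrite EFinD; apply: leeD; last by rewrite !card_prod card_ord in PC'.
  apply: le_trans (measureU2 _ mA mB) _; rewrite EFinD; apply: leeD.
  + by rewrite card_ord in PA'.
  + by rewrite card_ord in PB'.
move=> w hw; split.
- move=> j; rewrite leNgt; apply/negP => h; apply: hw; left; left; by exists j.
- move=> i; rewrite leNgt; apply/negP => h; apply: hw; left; right; exists i.
  by rewrite trmx_delta -rowE mxE.
move=> i th hb; rewrite leNgt; apply/negP => h; apply: hw; right; exists i; split => //.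
rewrite -/th; lra.
Qed.

End good_events.

(** * Consistency *)

Section finite_sample.
Context {R : realType} d (T : measurableType d) (P : probability T R).
Variables (delta m M C : R) (p : nat) (beta0 : 'cV[R]_p.+1).
Hypotheses (delta01 : 0 < delta < 1) (m0 : 0 < m) (mM : m <= M) (C0 : 0 < C).

(** [gls_rate] times n^delta is the constant K of the selection argument: the spectral bound mesh /
    [Sigma_ub] times the Gram bound n / C. *)
Definition gls_rate : R := (Sigma_ub m M * C)^-1.
Definition score_rate : R := gls_rate / (4 * p.+1%:R).
(** A positive lower bound for the squares of the nonzero coefficients. Zero coefficients add
    nothing, the inverse of 0 being 0, and the 1 covers the case where all vanish. *)
Definition min_coef : R := (1 + \sum_j (beta0 j 0 ^+ 2)^-1)^-1.
(** Underfitting costs K / 2 times [min_coef], that is 2 [gap_rate] n^delta. One half pays for the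
    likelihood fluctuation, itself shared equally by the tail at grid points and the grid error; the
    other half pays for the scores and the penalty. *)
Definition gap_rate : R := gls_rate * min_coef / 4.
(** With these two rates, each of the two terms of [score_le] is exactly half of the score budget
    s. *)
Definition column_rate : R := Num.sqrt score_rate / (2 * (M / m) * Num.sqrt (Sigma_ub m M)).
Definition noise_rate : R := Num.sqrt score_rate / (2 * score_bound m M p * Num.sqrt (2 * M)).
Definition grid_error : R := (3 + M) / m * (2 + noise_rate ^+ 2 * (2 * M) / m).

Definition error_bound (tau : nat -> R) (n : nat) : R :=
  p.+1%:R * (2 * expR (2^-1 - column_rate * Num.sqrt (tau n))) +
  n%:R * (2 * expR (2^-1 - noise_rate * n%:R `^ (delta / 2))) +
  ((Num.truncn M).+1 * n ^ 6)%:R ^+ 3 * (2 * expR (- (gap_rate / 2 * n%:R `^ delta / 4))).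

Let M0 : 0 < M. Proof. exact: lt_le_trans m0 mM. Qed.

Let ub0 : 0 < Sigma_ub m M. Proof. exact: Sigma_ub_gt0. Qed.

Lemma gls_rate_gt0 : 0 < gls_rate.
Proof. by rewrite invr_gt0 mulr_gt0. Qed.

Lemma score_rate_gt0 : 0 < score_rate.
Proof. by rewrite divr_gt0 ?gls_rate_gt0// mulr_gt0. Qed.

Let minv_sum : 0 <= \sum_j (beta0 j 0 ^+ 2)^-1.
Proof. by apply: sumr_ge0 => j _; rewrite invr_ge0 sqr_ge0. Qed.

Lemma min_coef_gt0 : 0 < min_coef.
Proof. by rewrite invr_gt0; move: minv_sum; lra. Qed.

Lemma min_coef_le j : beta0 j 0 != 0 -> min_coef <= beta0 j 0 ^+ 2.
Proof.
move=> bj; have b2 : 0 < beta0 j 0 ^+ 2 by rewrite lt_def sqrf_eq0 bj sqr_ge0.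
rewrite -[leRHS]invrK lef_pV2 ?posrE ?invr_gt0//; last by move: minv_sum; lra.
rewrite (bigD1 j)//= addrCA lerDl addr_ge0//.
by apply: sumr_ge0 => i _; rewrite invr_ge0 sqr_ge0.
Qed.

Lemma gap_rate_gt0 : 0 < gap_rate.
Proof. by rewrite !mulr_gt0 ?gls_rate_gt0 ?min_coef_gt0 ?invr_gt0. Qed.

Lemma score_bound_gt0 : 0 < score_bound m M p.
Proof.
have c0 : 0 < m / (1 + M) by rewrite divr_gt0//; move: M0; lra.
have h : 0 <= 3 * (p%:R * 2 ^+ p) / (m / (1 + M)).
  by apply: divr_ge0 (ltW c0); rewrite mulr_ge0// mulr_ge0// exprn_ge0.
by rewrite /score_bound divr_gt0//; move: h; lra.
Qed.

Lemma column_rate_gt0 : 0 < column_rate.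
Proof.
have h1 : 0 < Num.sqrt score_rate by rewrite sqrtr_gt0 score_rate_gt0.
have h2 : 0 < Num.sqrt (Sigma_ub m M) by rewrite sqrtr_gt0.
have h3 : 0 < M / m by exact: divr_gt0.
by apply: divr_gt0 => //; apply: mulr_gt0 => //; exact: mulr_gt0.
Qed.

Lemma noise_rate_gt0 : 0 < noise_rate.
Proof.
have h1 : 0 < Num.sqrt score_rate by rewrite sqrtr_gt0 score_rate_gt0.
have h2 : 0 < Num.sqrt (2 * M) by rewrite sqrtr_gt0 mulr_gt0.
apply: divr_gt0 => //; apply: mulr_gt0 => //; apply: mulr_gt0 => //.
exact: score_bound_gt0.
Qed.

Lemma error_bound_cvg0 (tau : nat -> R) : tau @ \oo --> +oo ->
  error_bound tau n @[n --> \oo] --> (0 : R).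
Proof.
move=> htau; rewrite /error_bound.
have d0 : 0 < delta by case/andP: delta01.
have h1 := cvg_expR_sqrt column_rate_gt0 htau.
have h2 := @cvg_natX_expR R 1 (delta / 2) noise_rate (divr_gt0 d0 (ltr0Sn _ 1)) noise_rate_gt0.
(* 18 = 3 * 6: three parameters with a multiple of n^6 grid values each. *)
have h3 := @cvg_natX_expR R 18 delta (gap_rate / 8) d0 (divr_gt0 gap_rate_gt0 (ltr0Sn _ 7)).
rewrite (_ : (fun n => _) = fun n => (2 * p.+1%:R * expR 2^-1) * expR (- (column_rate * Num.sqrt (tau n))) +
  (2 * expR 2^-1) * (n%:R ^+ 1 * expR (- (noise_rate * n%:R `^ (delta / 2)))) +
  (2 * (Num.truncn M).+1%:R ^+ 3) * (n%:R ^+ 18 * expR (- (gap_rate / 8 * n%:R `^ delta)))); last first.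
  apply/funext => n; congr (_ + _ + _).
  - by rewrite expRD; ring.
  - by rewrite expRD expr1; ring.
  - rewrite natrM natrX exprMn -exprM (_ : gap_rate / 2 * n%:R `^ delta / 4 = gap_rate / 8 * n%:R `^ delta); last by field.
    ring.
rewrite -[X in _ --> X]addr0 -[X in _ --> X + _]addr0.
apply: cvgD; [apply: cvgD|].
- by rewrite -[X in _ --> X](mulr0 (2 * p.+1%:R * expR 2^-1)); apply: cvgM => //; exact: cvg_cst.
- by rewrite -[X in _ --> X](mulr0 (2 * expR 2^-1)); apply: cvgM => //; exact: cvg_cst.
- by rewrite -[X in _ --> X](mulr0 (2 * (Num.truncn M).+1%:R ^+ 3)); apply: cvgM => //; exact: cvg_cst.
Qed.

Lemma selection_prob_ge (Theta : set (R * R * R)) (th0 : R * R * R) (n : nat)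
    (Z : T -> 'cV[R]_n) (alpha0 : {set 'I_p})
    (thetahat : T -> {set 'I_p} -> R * R * R) (tau : nat -> R) (alphahat : T -> {set 'I_p}) :
  (p < n)%N -> (1 < n)%N ->
  (forall b : 'cV[R]_p.+1, \sum_j b j 0 ^+ 2 <= C / n%:R * \sum_i (design delta n p *m b) i 0 ^+ 2) ->
  (forall th, Theta th -> in_box m M th) -> Theta th0 ->
  gaussian_vector P Z (design delta n p *m beta0) (Sigma delta n th0) ->
  smallest_correct_model delta n beta0 alpha0 ->
  (forall w a, nested_models a -> is_MLE delta Theta a (Z w) (thetahat w a)) ->
  (forall w, is_argmin (@nested_models p) (GIC delta (tau n) (Z w) (thetahat w)) (alphahat w)) ->
  measurable [set w | alphahat w = alpha0] ->
  1 <= tau n -> tau n <= n%:R `^ delta -> tau n * p.+1%:R <= gap_rate * n%:R `^ delta ->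
  2 * ((3 + M) / m) <= tau n -> grid_error <= gap_rate / 2 * tau n ->
  ((1 - error_bound tau n)%:E <= P [set w | alphahat w = alpha0])%E.
Proof.
move=> pn n1 gram hbox hth0 gZ ha0 hMLE hamin mA t1 tN tgap tM tgrid.
have n0 : (0 < n)%N := ltnW n1.
have n0' : 0 < n%:R :> R by rewrite ltr0n.
have n1' : 1 <= n%:R :> R by rewrite ler1n.
have h0 := mesh_gt0 delta n0.
have NE := natr_mesh delta n0.
set N := n%:R `^ delta in tN tgap NE *.
have N0 : 0 < N by rewrite powR_gt0.
have Nn : N <= n%:R by rewrite -NE ler_piMr ?mesh_le1// ltW.
have t0 : 0 < tau n by lra.
(* With this s, the loss 2 (p + 1) s^2 / K is tau n / 2, below the penalty for one regressor. *)
pose s := Num.sqrt score_rate * (Num.sqrt N * Num.sqrt (tau n)).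
have s2 : s ^+ 2 = score_rate * (N * tau n).
  by rewrite !exprMn !sqr_sqrtr ?(ltW N0) ?(ltW t0) ?(ltW score_rate_gt0).
have cube (k : nat) : (k * k * k)%:R = k%:R ^+ 3 :> R.
  by rewrite -natrX !expnS expn0 muln1 mulnA.
pose G := ((Num.truncn M).+1 * n ^ 6)%N.
have [Bad [mBad PBad good]] := @good_event R _ T P delta m M delta01 m0 mM n p Z
  (design delta n p *m beta0) th0 (column_rate * Num.sqrt (tau n))
  (noise_rate * (Num.sqrt N * Num.sqrt (tau n))) (gap_rate / 2 * N) (n ^ 6) G n0 gZ (hbox _ hth0).
apply: (prob_ge_of_cover mA mBad); last first.
  apply: (le_trans PBad); rewrite lee_fin /error_bound -/N; apply: lerD; last first.
    by rewrite cube.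
  apply: lerD => //; apply: ler_wpM2l => //; apply: ler_wpM2l => //.
  (* Since tau n >= 1, the threshold on the coordinates is at least of order n^(delta / 2), which
     suffices against the n coordinates. *)
  rewrite ler_expR lerD2l lerN2; apply: ler_wpM2l; first exact/ltW/noise_rate_gt0.
  have -> : n%:R `^ (delta / 2) = Num.sqrt N by rewrite powRrM powR12_sqrt// ltW.
  by rewrite ler_peMr ?sqrtr_ge0// -[leLHS]sqrtr1; exact: ler_wsqrtr.
move=> w /good []; set e := _ - _ => hcol hnoise hgrid /=.
have sb0 := score_bound_gt0.
apply: (@GIC_selects R delta n p delta01 pn Theta th0 beta0 (Z w) alpha0 (thetahat w) (tau n)
  (gls_rate * N) s (gap_rate * N) min_coef) => //.
- by move=> th /hbox; exact: Sigma_posdef.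
- exact: hMLE.
- by rewrite mulr_gt0// gls_rate_gt0.
- move=> th b /hbox hb.
  apply: le_trans (qform_invSigma_ge delta01 m0 mM _ n0 hb).
  apply: (@le_trans _ _ (gls_rate * N * (C / n%:R * \sum_i (design delta n p *m b) i 0 ^+ 2))).
    by apply: ler_wpM2l; [rewrite mulr_ge0 ?(ltW N0) ?(ltW gls_rate_gt0)|exact: gram].
  rewrite le_eqVlt; apply/orP; left; apply/eqP; rewrite -NE /gls_rate.
  by field; rewrite !gt_eqF.
- move=> th j /hbox hb.
  have b0 : 0 <= noise_rate * (Num.sqrt N * Num.sqrt (tau n)) * Num.sqrt (2 * M).
    have nr := ltW noise_rate_gt0.
    by apply: mulr_ge0 (sqrtr_ge0 _); apply: mulr_ge0 => //; apply: mulr_ge0; exact: sqrtr_ge0.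
  apply: le_trans (score_le delta01 m0 n1 hb b0 (hcol j) hnoise) _.
  rewrite le_eqVlt; apply/orP; left; apply/eqP.
  have hs : mesh delta n * Num.sqrt (Sigma_ub m M / mesh delta n * n%:R) = Num.sqrt (Sigma_ub m M) * Num.sqrt N.
    rewrite -[X in X * _](ger0_norm (ltW h0)) -sqrtr_sqr -!sqrtrM ?sqr_ge0 ?(ltW ub0)//.
    by rewrite -NE; congr Num.sqrt; field; rewrite gt_eqF.
  rewrite (_ : M / m * mesh delta n * _ = M / m * (column_rate * Num.sqrt (tau n)) * (mesh delta n *
    Num.sqrt (Sigma_ub m M / mesh delta n * n%:R))); last by ring.
  rewrite hs /column_rate /noise_rate /s.
  have u1 : Num.sqrt (Sigma_ub m M) != 0 by rewrite gt_eqF// sqrtr_gt0.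
  have u2 : Num.sqrt (2 * M) != 0 by rewrite gt_eqF// sqrtr_gt0 mulr_gt0.
  by field; rewrite u1 u2 !gt_eqF.
- move=> th hth; have hb := hbox _ hth.
  have q0 : (0 < n ^ 6)%N by rewrite expn_gt0 n0.
  have MG : M * (n ^ 6)%:R < G%:R.
    rewrite /G natrM ltr_pM2r ?ltr0n//.
    by have /andP[] := truncn_itv (ltW M0).
  have [i [hb' near]] := grid_point_near m0 q0 MG hb.
  (* N and tau n are both at most n, so every squared coordinate is at most a constant times n^2. *)
  have e2 : \sum_i e i 0 ^+ 2 <= n%:R ^+ 3 * (noise_rate ^+ 2 * (2 * M)).
    apply: (@le_trans _ _ (\sum_(i < n) n%:R ^+ 2 * (noise_rate ^+ 2 * (2 * M)))); last first.
      by rewrite sumr_const card_ord -[leLHS]mulr_natl exprS mulrA.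
    apply: ler_sum => k _; have nk := hnoise k.
    rewrite -(real_normK (num_real (e k 0))).
    apply: (@le_trans _ _ ((noise_rate * (Num.sqrt N * Num.sqrt (tau n)) * Num.sqrt (2 * M)) ^+ 2)).
      by rewrite lerXn2r ?nnegrE ?normr_ge0// (le_trans (normr_ge0 _) nk).
    have sqrE (x a b c : R) : 0 <= a -> 0 <= b -> 0 <= c ->
        (x * (Num.sqrt a * Num.sqrt b) * Num.sqrt c) ^+ 2 = a * b * (x ^+ 2 * c).
      by move=> *; rewrite !exprMn !sqr_sqrtr//; ring.
    rewrite sqrE ?(ltW N0) ?(ltW t0) ?mulr_ge0 ?(ltW M0)//; apply: ler_wpM2r.
      by rewrite mulr_ge0 ?sqr_ge0// mulr_ge0// ltW.
    by rewrite expr2; apply: ler_pM => //; [exact: ltW|exact: ltW|exact: le_trans Nn].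
  have eta : (3 + M) / m / n%:R ^+ 4 <= 2^-1.
    rewrite ler_pdivrMr ?exprn_gt0//.
    have : n%:R <= n%:R ^+ 4 :> R by rewrite -{1}[n%:R]expr1 ler_weXn2l.
    lra.
  have := loglik_grid_le delta01 m0 mM n0 hb hb' near e2 eta.
  have := hgrid _ hb'.
  have : gap_rate / 2 * tau n <= gap_rate / 2 * N.
    by apply: ler_wpM2l => //; rewrite divr_ge0// ltW// gap_rate_gt0.
  rewrite -/grid_error; lra.
- exact: min_coef_le.
- rewrite s2 (_ : 2 * p.+1%:R * _ / _ = tau n / 2); first by lra.
  rewrite /score_rate; have := gls_rate_gt0; move=> g0; field.
  by rewrite !gt_eqF.
- rewrite s2 (_ : 2 * p.+1%:R * _ / _ = tau n / 2); last first.
    rewrite /score_rate; have := gls_rate_gt0; move=> g0; field.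
    by rewrite !gt_eqF.
  have -> : gls_rate * N / 2 * min_coef = 2 * (gap_rate * N) by rewrite /gap_rate; field.
  by move: tgap; rewrite -natr1; lra.
Qed.

End finite_sample.

Theorem theorem5p4 (R : realType) (d : measure_display) (T : measurableType d)
    (P : probability T R)
    (delta : R) (hdelta : 0 < delta < 1)
    (p : nat) (beta0 : 'cV[R]_p.+1)
    (Theta : set (R * R * R)) (th0 : R * R * R)
    (hTheta_pos : forall th : R * R * R, Theta th ->
       [/\ 0 < v2 th, 0 < sigma2 th & 0 < kappa th])
    (hTheta_compact : compact Theta)
    (hth0 : Theta th0)
    (hgamma : forall k : nat, (k <= p)%N ->
       Theta (th0 + (0, gamma beta0 k,
         - ((sigma2 th0 + gamma beta0 k)^-1 * gamma beta0 k * kappa th0))))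
    (Z : forall n : nat, T -> 'cV[R]_n)
    (hZ : forall n : nat, (0 < n)%N ->
       gaussian_vector P (Z n) (design delta n p *m beta0) (Sigma delta n th0))
    (alpha0 : nat -> {set 'I_p})
    (halpha0 : forall n : nat, (0 < n)%N ->
       smallest_correct_model delta n beta0 (alpha0 n))
    (thetahat : nat -> T -> {set 'I_p} -> R * R * R)
    (hthetahat : forall (n : nat) (w : T) (a : {set 'I_p}), (p < n)%N ->
       nested_models a -> is_MLE delta Theta a (Z n w) (thetahat n w a))
    (tau : nat -> R)
    (htau_infty : tau @ \oo --> +oo)
    (htau_o : tau =o_\oo (fun n : nat => n%:R `^ delta))
    (alphahat : nat -> T -> {set 'I_p})
    (halphahat : forall (n : nat) (w : T), (p < n)%N ->
       is_argmin (@nested_models p)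
         (GIC delta (tau n) (Z n w) (thetahat n w)) (alphahat n w))
    (halphahat_meas : forall (n : nat) (a : {set 'I_p}), (p < n)%N ->
       measurable [set w | alphahat n w = a]) :
  P [set w | alphahat n w = alpha0 n] @[n --> \oo] --> 1%E.
Proof.
have [m [M [m0 hbox]]] := compact_positive_box hTheta_compact hth0 hTheta_pos.
have mM : m <= M by have [/andP[a b] _ _] := hbox _ hth0; exact: le_trans b.
have [C C0 gram] := @design_gram R delta hdelta p.
have gap0 := gap_rate_gt0 beta0 m0 mM C0.
have gap2 : 0 < gap_rate m M C beta0 / 2 by exact: divr_gt0.
(* The relation tau = o(n^delta) is used at this one level: 1 gives tau <= n^delta, and the other
   bound gives tau (p + 1) <= [gap_rate] n^delta. *)
pose eps := Num.min 1 (gap_rate m M C beta0 / p.+1%:R).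
have eps0 : 0 < eps by rewrite lt_min ltr01 divr_gt0.
have e0 := @error_bound_cvg0 R delta m M C p beta0 hdelta m0 mM C0 tau htau_infty.
apply: (@squeeze_cvge _ _ _ _ (fun n => (1 - error_bound delta m M C beta0 tau n)%:E) _ (fun=> 1%E)).
- have := htau_o; move/eqoP => /(_ eps eps0) ho.
  move/cvgryPge : htau_infty => hinf.
  near=> n; apply/andP; split; last first.
    apply: probability_le1; apply: halphahat_meas; near: n; exact: nbhs_infty_gt.
  have pn : (p < n)%N by near: n; exact: nbhs_infty_gt.
  have n1 : (1 < n)%N by near: n; exact: nbhs_infty_gt.
  have n0 : (0 < n)%N := ltnW n1.
  have t1 : 1 <= tau n by near: n; exact: hinf.
  have tN : `|tau n| <= eps * `|n%:R `^ delta| by near: n.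
  rewrite ger0_norm ?(le_trans ler01)// ger0_norm ?powR_ge0// in tN.
  apply: (@selection_prob_ge _ _ T P delta m M C p beta0 hdelta m0 mM C0 Theta th0 n (Z n) (alpha0 n)
    (thetahat n) tau (alphahat n) pn n1) => //.
  + by move=> b; exact: gram.
  + exact: hZ.
  + exact: halpha0.
  + by move=> w a; exact: hthetahat.
  + by move=> w; exact: halphahat.
  + exact: halphahat_meas.
  + apply: (le_trans tN); rewrite ler_piMl ?powR_ge0//.
    by rewrite /eps ge_min lexx.
  + rewrite -ler_pdivlMr// (le_trans tN)// mulrAC; apply: ler_wpM2r; first exact: powR_ge0.
    by rewrite /eps ge_min lexx orbT.
  + by near: n; exact: hinf.
  + by rewrite -(ler_pdivrMl _ _ gap2); near: n; exact: hinf.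
- apply: cvg_EFin; first exact: nearW.
  rewrite -[X in _ --> X](subr0 1); apply: cvgB => //; exact: cvg_cst.
- exact: cvg_cst.
Unshelve. all: by end_near. Qed.
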